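(* Let $n\ge3$ and let $E$ be a Banach space. The norms $\backslash\varepsilon_{n,s}/$ and $\backslash/\pi_{n,s}\backslash/$ are equivalent on $\otimes^{n,s}E$ if and only if $E$ is finite dimensional. Likewise, the norms $/\pi_{n,s}\backslash$ and $/\backslash\varepsilon_{n,s}/\backslash$ are equivalent on $\otimes^{n,s}E$ if and only if $E$ is finite dimensional.
   Context: $\otimes^{n,s}E$ is the $n$-fold symmetric tensor product of a Banach space $E$ over $\mathbb K$; $\varepsilon_{n,s}$ and $\pi_{n,s}$ are the injective and projective symmetric tensor norms. An s-tensor norm $\beta$ of order $n$ assigns to each Banach space $E$ a norm on $\otimes^{n,s}E$ (the normed space is written $\otimes^{n,s}_\beta E$) such that $\varepsilon_{n,s}\le\beta\le\pi_{n,s}$ and $\|\otimes^{n,s}T:\otimes^{n,s}_\beta E\to\otimes^{n,s}_\beta F\|\le\|T\|^n$ for every bounded linear $T:E\to F$. All s-tensor norms are assumed finitely generated: $\beta(z,\otimes^{n,s}E)=\inf\{\beta(z,\otimes^{n,s}M): M\subset E \text{ finite dimensional},\ z\in\otimes^{n,s}M\}$. $\beta$ is injective if $\otimes^{n,s}I$ is an isometric embedding $\otimes^{n,s}_\beta E\to\otimes^{n,s}_\beta F$ for every isometric embedding $I:E\to F$; it is projective if $\otimes^{n,s}Q$ is a metric surjection (inducing the quotient norm) for every metric surjection $Q:E\to F$. The injective hull $/\beta\backslash$ is the greatest injective s-tensor norm $\le\beta$; it is characterized by $\otimes^{n,s}I_E:\otimes^{n,s}_{/\beta\backslash}E\to\otimes^{n,s}_\beta\ell_\infty(B_{E'})$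 being an isometric embedding, where $I_E(x)=(x'(x))_{x'\in B_{E'}}$. The projective hull $\backslash\beta/$ is the smallest projective s-tensor norm $\ge\beta$; it is characterized by $\otimes^{n,s}Q_E:\otimes^{n,s}_\beta\ell_1(B_E)\to\otimes^{n,s}_{\backslash\beta/}E$ being a metric surjection, where $Q_E((a_x)_x)=\sum_{x\in B_E}a_xx$. $\backslash/\beta\backslash/$ is the projective hull of $/\beta\backslash$ and $/\backslash\beta/\backslash$ is the injective hull of $\backslash\beta/$. *)

(* Defs.v *)
From HB Require Import structures.
From mathcomp Require Import all_boot all_order all_algebra.
From mathcomp Require Import all_classical all_reals all_analysis.
From mathcomp Require Export complex.

Set Implicit Arguments.
Unset Strict Implicit.
Unset Printing Implicit Defensive.

Import Order.TTheory GRing.Theory Num.Theory.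
Import numFieldNormedType.Exports.

Local Open Scope classical_set_scope.
Local Open Scope ring_scope.

(* The scalar field is an arbitrary [K : numFieldType]; the theorem takes it to
   be R or R[i]. As for library norms, all norms take (nonnegative, hence real)
   values in K, and infima and suprema are those of the order of K. *)

(* The symmetric tensor power is a subspace of the tensor power of E, and the
   latter is the span of the elementary tensors x_1 (x) ... (x) x_n inside the
   algebraic dual of the space of n-linear forms on E, where
   x_1 (x) ... (x) x_n is evaluation at (x_1, ..., x_n). Over a field this is
   the usual algebraic tensor power, because two formal sums of elementary
   tensors agree in it iff all n-linear forms agree on them. *)
Section symtensor.
Variables (K : numFieldType) (n : nat).

Definition multilinear (E : lmodType K) (phi : ('I_n -> E) -> K) : Prop :=
  forall (x : 'I_n -> E) (i : 'I_n) (a : K) (u v : E),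
    phi (dfwith x i (a *: u + v)) = a * phi (dfwith x i u) + phi (dfwith x i v).

Record mlform (E : lmodType K) := MLForm {
  mlval :> ('I_n -> E) -> K;
  mlvalP : multilinear mlval }.

Definition tpow_ev (E : lmodType K) (x : E) : mlform E -> K^o :=
  fun phi => phi (fun=> x).

Definition symtensor_pred (E : lmodType K) : {pred mlform E -> K^o} :=
  fun f => `[< exists s : seq (K * E),
                 f = \sum_(p <- s) p.1 *: tpow_ev p.2 >].
Arguments symtensor_pred : clear implicits.

Lemma symtensor_submod (E : lmodType K) : submod_closed (symtensor_pred E).
Proof.
split; first by apply/asboolP; exists [::]; rewrite big_nil.
move=> a f g /asboolP[s ->] /asboolP[t ->]; apply/asboolP.
exists ([seq (a * p.1, p.2) | p <- s] ++ t).
rewrite big_cat big_map scaler_sumr; congr (_ + _).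
by apply: eq_bigr => p _; rewrite scalerA.
Qed.

HB.instance Definition _ (E : lmodType K) :=
  GRing.isSubmodClosed.Build K (mlform E -> K^o) (symtensor_pred E)
    (symtensor_submod E).

Record symtensor (E : lmodType K) := SymTensor {
  symval : mlform E -> K^o;
  symvalP : symval \in symtensor_pred E }.

HB.instance Definition _ (E : lmodType K) :=
  [isSub of symtensor E for @symval E].
HB.instance Definition _ (E : lmodType K) := [Choice of symtensor E by <:].
HB.instance Definition _ (E : lmodType K) :=
  [SubChoice_isSubLmodule of symtensor E by <:].

Lemma tpow_subproof (E : lmodType K) (x : E) :
  tpow_ev x \in symtensor_pred E.
Proof.
by apply/asboolP; exists [:: (1, x)]; rewrite big_seq1 scale1r.
Qed.

Definition tpow (E : lmodType K) (x : E) : symtensor E :=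
  SymTensor (tpow_subproof x).

Lemma mlpull_subproof (E F : lmodType K) (T : {linear E -> F})
  (phi : mlform F) : multilinear (fun x : 'I_n -> E => phi (T \o x)).
Proof.
have Tdf x i u : T \o dfwith x i u = dfwith (T \o x) i (T u) :> ('I_n -> F).
  apply/funext => j /=; have [->|ij] := eqVneq i j.
    by rewrite !dfwithin.
  by rewrite !dfwithout.
by move=> x i a u v; rewrite !Tdf linearP mlvalP.
Qed.

Definition mlpull (E F : lmodType K) (T : {linear E -> F}) (phi : mlform F) :
  mlform E := MLForm (mlpull_subproof T phi).

Lemma tmap_subproof (E F : lmodType K) (T : {linear E -> F})
  (z : symtensor E) : symval z \o mlpull T \in symtensor_pred F.
Proof.
case: z => f /= /asboolP[s ->]; apply/asboolP.
exists [seq (p.1, T p.2) | p <- s]; apply/funext => phi /=.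
by rewrite big_map !fct_sumE; apply: eq_bigr.
Qed.

Definition tmap (E F : lmodType K) (T : {linear E -> F}) (z : symtensor E) :
  symtensor F := SymTensor (tmap_subproof T z).

Lemma tmap_is_linear (E F : lmodType K) (T : {linear E -> F}) :
  linear (tmap T).
Proof. by move=> a z w; apply/val_inj/funext. Qed.

HB.instance Definition _ (E F : lmodType K) (T : {linear E -> F}) :=
  GRing.isLinear.Build K (symtensor E) (symtensor F) *:%R (tmap T)
    (tmap_is_linear T).

Lemma tmap_tpow (E F : lmodType K) (T : {linear E -> F}) (x : E) :
  tmap T (tpow x) = tpow (T x).
Proof. exact: val_inj. Qed.

Lemma mlprod_subproof (E : lmodType K) (f : {linear E -> K^o}) :
  multilinear (fun x : 'I_n -> E => \prod_(i < n) f (x i)).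
Proof.
move=> x i a u v.
have dfE w : \prod_(j < n) f (dfwith x i w j) =
             f w * \prod_(j < n | j != i) f (x j).
  rewrite (bigD1 i) //= dfwithin; congr (_ * _).
  by apply: eq_bigr => j ji; rewrite dfwithout// eq_sym.
by rewrite !dfE linearP mulrDl -mulrA.
Qed.

Definition mlprod (E : lmodType K) (f : {linear E -> K^o}) : mlform E :=
  MLForm (mlprod_subproof f).

End symtensor.

Section symmetric_tensor_norms.
Variables (K : numFieldType) (n : nat).

Definition finite_dimensional (E : lmodType K) : Prop :=
  exists s : seq E, forall x : E, exists c : 'I_(size s) -> K,
    x = \sum_(i < size s) c i *: s`_i.

Definition dual_ball (E : normedModType K) : set {linear E -> K^o} :=
  [set f | forall x : E, `|f x| <= `|x|].

Definition opnorm (E F : normedModType K) (T : {linear E -> F}) : K :=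
  infimum 0 [set M : K | 0 <= M /\ forall x : E, `|T x| <= M * `|x|].

Definition isometric_embedding (U V : Type) (NU : U -> K) (NV : V -> K)
  (I : U -> V) : Prop := forall x : U, NV (I x) = NU x.

Definition metric_surjection (U V : Type) (NU : U -> K) (NV : V -> K)
  (Q : U -> V) : Prop :=
  (forall y : V, exists x : U, Q x = y) /\
  (forall y : V, infimums [set NU x | x in [set x | Q x = y]] (NV y)).

Definition is_norm (V : lmodType K) (N : V -> K) : Prop :=
  [/\ forall x, 0 <= N x,
      forall x, N x = 0 -> x = 0,
      forall a x, N (a *: x) = `|a| * N x
    & forall x y, N (x + y) <= N x + N y].

Definition tensor_norm := forall E : completeNormedModType K, symtensor n E -> K.

Definition tnorm_le (alpha beta : tensor_norm) : Prop :=
  forall (E : completeNormedModType K) (z : symtensor n E),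
    alpha E z <= beta E z.

Definition eps_norm : tensor_norm := fun E z =>
  supremum 0 [set `|symval z (mlprod n f)| | f in @dual_ball E].

Definition pi_norm : tensor_norm := fun E z =>
  infimum 0 [set \sum_(p <- s) `|p.1| * `|p.2| ^+ n
            | s in [set s : seq (K * E) | z = \sum_(p <- s) p.1 *: tpow n p.2]].

(* A finite dimensional subspace of E is given by a finite dimensional Banach
   space M together with a linear isometric embedding of M into E. *)
Definition finitely_generated (beta : tensor_norm) : Prop :=
  forall (E : completeNormedModType K) (z : symtensor n E),
    infimums [set r : K | exists (M : completeNormedModType K)
                 (I : {linear M -> E}) (w : symtensor n M),
                 [/\ finite_dimensional M,
                     isometric_embedding (@Num.norm K M) (@Num.norm K E) I,
                     tmap I w = z
                   & r = beta M w]]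
             (beta E z).

Definition is_s_tensor_norm (beta : tensor_norm) : Prop :=
  [/\ forall E : completeNormedModType K, is_norm (beta E),
      tnorm_le eps_norm beta,
      tnorm_le beta pi_norm,
      forall (E F : completeNormedModType K) (T : {linear E -> F}),
        continuous T ->
        forall z : symtensor n E, beta F (tmap T z) <= opnorm T ^+ n * beta E z
    & finitely_generated beta].

Definition is_injective (beta : tensor_norm) : Prop :=
  forall (E F : completeNormedModType K) (I : {linear E -> F}),
    isometric_embedding (@Num.norm K E) (@Num.norm K F) I ->
    isometric_embedding (beta E) (beta F) (tmap I).

Definition is_projective (beta : tensor_norm) : Prop :=
  forall (E F : completeNormedModType K) (Q : {linear E -> F}),
    metric_surjection (@Num.norm K E) (@Num.norm K F) Q ->
    metric_surjection (beta E) (beta F) (tmap Q).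

Definition is_injective_hull (beta gamma : tensor_norm) : Prop :=
  [/\ is_s_tensor_norm gamma, is_injective gamma, tnorm_le gamma beta
    & forall delta : tensor_norm, is_s_tensor_norm delta ->
        is_injective delta -> tnorm_le delta beta -> tnorm_le delta gamma].

Definition is_projective_hull (beta gamma : tensor_norm) : Prop :=
  [/\ is_s_tensor_norm gamma, is_projective gamma, tnorm_le beta gamma
    & forall delta : tensor_norm, is_s_tensor_norm delta ->
        is_projective delta -> tnorm_le beta delta -> tnorm_le gamma delta].

Definition equivalent_on (E : completeNormedModType K)
  (alpha beta : tensor_norm) : Prop :=
  exists c C : K, [/\ 0 < c, 0 < C &
    forall z : symtensor n E,
      c * alpha E z <= beta E z /\ beta E z <= C * alpha E z].

End symmetric_tensor_norms.

Arguments eps_norm : clear implicits.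
Arguments pi_norm : clear implicits.

(* Main.v *)
(* The norms differ on every infinite dimensional E because Grothendieck's
   inequality has no trilinear analogue. The creation operators of a fermionic
   Fock space give a trilinear form of norm 1 on Hilbert spaces, whose sup-norm
   ball bound [q * d] is small compared with the sum [q * q * d / 2] of the
   squares of its coefficients. Symmetrised with powers of one more variable, it
   yields both a tensor and a form to test it with ([test_tensor]).

   The Dvoretzky-Rogers lemma transports them to E: there are biorthogonal
   systems x_i in E, f_i in E' with either |f_i| <= 1 and
   |sum a_i x_i| <= 2 |a|_2, or |x_i| <= 1 and |(f_i y)_i|_2 <= 2 |y|.

   The hulls are only used through their extremality. If delta is the supremum
   of a fixed form over all contractions into ell_infty, then max (/pi\, delta)
   is injective and below pi, so delta <= /pi\. The quotient norm of epsilon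
   from finite dimensional ell_1-spaces is projective and above epsilon, so it
   dominates \epsilon/.

   Riesz products (that is, Khinchin's inequality) make the remaining two norms
   computable: the pushout of ell_2^m -> E along the Rademacher embedding of
   ell_2^m into ell_1 is a Banach space containing the span of the x_i, in which
   /\epsilon/\ is at most \epsilon/, hence comparable with the injective norm
   over ell_2^m; dually, E is a quotient of the pullback of E -> ell_2^m along
   ell_infty -> ell_2^m, which bounds \/pi\/ from below. *)

(* The sup-norm ball of K^N lies in sqrt N times the Hilbert ball, so a trilinear form of Hilbert
   norm 1 in q * q, d and d variables has sup-norm bound q * d; this is why there are q * q creation
   operators. For fixed n the pairing then exceeds the product of one Hilbert bound and one sup-norm
   bound by a factor of order q. The number q is chosen after the equivalence constants, while m and
   d depend on q. Hence no constant in the final estimates may involve m, and the systems in E must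
   be biorthogonal and Hilbertian with absolute constants.

   The first equivalence is refuted with the sup-norm bound of the tensor and the Hilbert bound of
   the form, the second with the other two bounds. Mapping ell_1 into E asks for |x_i| <= 1, mapping
   E into ell_infty for |f_i| <= 1; hence two kinds of systems.

   The Rademacher embedding is only an isomorphic one, whereas injectivity and projectivity concern
   isometric embeddings and metric surjections. The pushout and the pullback repair this, at the
   price of a factor 16 for each of the n variables. *)
From HB Require Import structures.
Require Import Defs.
From mathcomp Require Import all_boot all_order all_algebra.
From mathcomp Require Import all_classical all_reals all_analysis.
From mathcomp Require Import perm.
From mathcomp Require Import ring lra.

Set Implicit Arguments.
Unset Strict Implicit.
Unset Printing Implicit Defensive.

Import Order.TTheory GRing.Theory Num.Theory.
Import numFieldNormedType.Exports.

Local Open Scope classical_set_scope.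
Local Open Scope ring_scope.

(* [K] over its real subfield [R]: every scalar is [re x + iu * im x] with
   [im x = - re (iu * x)]; [iu] is 0 if [K = R] and the imaginary unit if
   [K = R[i]], which is all that distinguishes the two cases. *)
Record scalars (R : realType) (K : numFieldType) := Scalars {
  ofR : {rmorphism R -> K};
  re : K -> R;
  iu : K;
  cj : {rmorphism K -> K};
  reD : forall x y, re (x + y) = re x + re y;
  reZ : forall r x, re (ofR r * x) = r * re x;
  re_ofR : forall r, re (ofR r) = r;
  scalarsE : forall x, x = ofR (re x) - iu * ofR (re (iu * x));
  iu_cases : iu = 0 \/ iu ^+ 2 = -1;
  norm_ofR : forall x : K, `|x| = ofR (re `|x|);
  le_ofR : forall a b, (ofR a <= ofR b) = (a <= b);
  re_le : forall x : K, `|re x| <= re `|x|;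
  re_iu_ofR : forall r, re (iu * ofR r) = 0;
  mulcj : forall x : K, x * cj x = `|x| ^+ 2;
  cjK : forall x : K, cj (cj x) = x
}.

Lemma real_scalars (R : realType) : scalars R R.
Proof.
apply: (@Scalars R R idfun id 0 idfun) => //=.
- by move=> x; rewrite mul0r subr0.
- by left.
- by move=> r; rewrite mul0r.
- by move=> x; rewrite real_normK ?num_real.
Qed.

Lemma complex_scalars (R : realType) : scalars R R[i].
Proof.
refine (@Scalars R R[i] (real_complex R : {rmorphism R -> R[i]}) (@complex.Re R) 'i%C
  (@conjc R : {rmorphism R[i] -> R[i]}) _ _ _ _ _ _ _ _ _ _ _).
- by move=> [a b] [c d].
- by move=> r [a b] /=; rewrite mul0r subr0.
- by [].
- by move=> [a b]; simpc.
- by right; rewrite sqr_i.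
- by move=> x; rewrite normc_def.
- by move=> r s; rewrite lecR.
- by move=> x; rewrite -lecR; apply: le_trans (normc_ge_Re x) _; rewrite normc_def.
- by move=> r; simpc.
- by move=> x; rewrite sqr_normc.
- by move=> [a b] /=; rewrite opprK.
Qed.

Lemma scalars_of (R : realType) (K : numFieldType) :
  K = R :> numFieldType \/ K = R[i] :> numFieldType -> scalars R K.
Proof.
(* The alternative is a mere proposition, so the record is first shown to exist and then chosen. *)
move=> h; suff /cid[] : exists _ : scalars R K, True by [].
by case: h => ->; [exists (real_scalars R)|exists (complex_scalars R)].
Qed.

(** * Hahn-Banach over the real and complex scalars *)

Section scalars_theory.
Variables (R : realType) (K : numFieldType) (S : scalars R K).

Local Notation of_ := (ofR S).

(** Norms are moved to R, where the order is total and bounded sets have suprema; the order of R[i]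
    is partial. *)
Definition nrm (V : normedZmodType K) (x : V) : R := re S `|x|.

Lemma re0 : re S 0 = 0. Proof. by rewrite -(rmorph0 of_) re_ofR. Qed.

Lemma reN x : re S (- x) = - re S x.
Proof. by apply/eqP; rewrite -addr_eq0 -reD addNr re0. Qed.

Lemma reB x y : re S (x - y) = re S x - re S y.
Proof. by rewrite reD reN. Qed.

Lemma ofR_inj : injective of_.
Proof. by move=> a b /(congr1 (re S)); rewrite !re_ofR. Qed.

Lemma ofR_ge0 a : (0 <= of_ a) = (0 <= a).
Proof. by rewrite -(rmorph0 of_) le_ofR. Qed.

Lemma lt_ofR a b : (of_ a < of_ b) = (a < b).
Proof. by rewrite !lt_def le_ofR (inj_eq ofR_inj). Qed.

Lemma ofR_gt0 a : (0 < of_ a) = (0 < a).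
Proof. by rewrite -(rmorph0 of_) lt_ofR. Qed.

Lemma ge0_ofR (x : K) : 0 <= x -> x = of_ (re S x).
Proof. by move=> x0; have := norm_ofR S x; rewrite ger0_norm. Qed.

Lemma re_ge0 (x : K) : 0 <= x -> 0 <= re S x.
Proof. by move=> x0; rewrite -ofR_ge0 -ge0_ofR. Qed.

Section norm.
Variable V : normedZmodType K.
Implicit Types x y : V.

Lemma nrmE x : `|x| = of_ (nrm x). Proof. exact: ge0_ofR. Qed.

Lemma nrm_ge0 x : 0 <= nrm x. Proof. exact: re_ge0. Qed.

Lemma nrm_le_ofR x r : (`|x| <= of_ r) = (nrm x <= r).
Proof. by rewrite nrmE le_ofR. Qed.

Lemma nrmD x y : nrm (x + y) <= nrm x + nrm y.
Proof. by rewrite -nrm_le_ofR rmorphD -!nrmE ler_normD. Qed.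

Lemma nrm0 : nrm (0 : V) = 0.
Proof. by rewrite /nrm normr0 re0. Qed.

Lemma nrm0_eq0 x : nrm x = 0 -> x = 0.
Proof. by move=> x0; apply/normr0_eq0; rewrite nrmE x0 rmorph0. Qed.

Lemma nrm_gt0 x : (0 < nrm x) = (x != 0).
Proof.
rewrite lt_def nrm_ge0 andbT; congr (~~ _); apply/eqP/eqP => [|->].
  exact: nrm0_eq0.
exact: nrm0.
Qed.

Lemma nrmN x : nrm (- x) = nrm x.
Proof. by rewrite /nrm normrN. Qed.

Lemma nrm_sum (I : Type) (r : seq I) (P : pred I) (F : I -> V) :
  nrm (\sum_(i <- r | P i) F i) <= \sum_(i <- r | P i) nrm (F i).
Proof.
elim/big_ind2 : _ => [|x a y b xa yb|//]; first by rewrite nrm0.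
exact: le_trans (nrmD _ _) (lerD xa yb).
Qed.

End norm.

Lemma nrmZ (V : normedModType K) (a : K) (x : V) :
  nrm (a *: x) = nrm (a : K) * nrm x.
Proof. by apply: ofR_inj; rewrite rmorphM -!nrmE normrZ. Qed.

Lemma nrmM (a b : K) : nrm (a * b) = nrm a * nrm b.
Proof. by apply: ofR_inj; rewrite rmorphM -!nrmE normrM. Qed.

Lemma nrm1 : nrm (1 : K) = 1.
Proof. by apply: ofR_inj; rewrite rmorph1 -!nrmE normr1. Qed.

Lemma nrmX (a : K) n : nrm (a ^+ n) = nrm a ^+ n.
Proof. by apply: ofR_inj; rewrite rmorphXn -!nrmE normrX. Qed.

Lemma nrmV (a : K) : nrm a^-1 = (nrm a)^-1.
Proof. by apply: ofR_inj; rewrite fmorphV -!nrmE normfV. Qed.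

Lemma nrm_prod (I : Type) (r : seq I) (P : pred I) (F : I -> K) :
  nrm (\prod_(i <- r | P i) F i) = \prod_(i <- r | P i) nrm (F i).
Proof. exact: (big_morph _ nrmM nrm1). Qed.

Lemma nrm_ofR r : nrm (of_ r) = `|r|.
Proof.
wlog r0 : r / 0 <= r => [hw|].
  have [/hw//|r0] := leP 0 r.
  by rewrite -[r]opprK rmorphN nrmN normrN hw// oppr_ge0 ltW.
by rewrite /nrm (ger0_norm r0) ger0_norm ?ofR_ge0// re_ofR.
Qed.

Lemma nrm_ofR_ge0 r : 0 <= r -> nrm (of_ r) = r.
Proof. by move=> r0; rewrite nrm_ofR ger0_norm. Qed.

Lemma re_norm_le (x : K) : re S x <= nrm x.
Proof. exact: le_trans (ler_norm _) (re_le S x). Qed.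

Lemma nrm_sqr (x : K) : x * cj S x = of_ (nrm x ^+ 2).
Proof. by rewrite mulcj nrmE rmorphXn. Qed.

Lemma nrm_cj (x : K) : nrm (cj S x) = nrm x.
Proof.
have /(congr1 (re S)) := nrm_sqr x; rewrite re_ofR.
have := nrm_sqr (cj S x); rewrite cjK mulrC => ->; rewrite re_ofR => /eqP.
by rewrite eqrXn2 ?nrm_ge0// => /eqP.
Qed.

Lemma nrm_iu : nrm (iu S) <= 1.
Proof.
have [->|h] := iu_cases S; first by rewrite nrm0.
by rewrite -(@expr_le1 _ 2) ?nrm_ge0// -nrmX h nrmN nrm1.
Qed.

Definition im (x : K) : R := - re S (iu S * x).

Lemma scalars_reim x : x = of_ (re S x) + iu S * of_ (im x).
Proof. by rewrite {1}(scalarsE S x) /im rmorphN mulrN. Qed.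

Lemma im_le x : `|im x| <= nrm x.
Proof.
rewrite normrN; apply: le_trans (re_le S _) _.
by rewrite -/(nrm _) nrmM ler_piMl ?nrm_ge0 ?nrm_iu.
Qed.

Lemma unimodular (x : K) : exists t : K, nrm t = 1 /\ t * x = of_ (nrm x).
Proof.
have [->|x0] := eqVneq x 0; first by exists 1; rewrite nrm1 mulr0 nrm0 rmorph0.
have a0 : nrm x != 0 by apply: contra x0 => /eqP /nrm0_eq0 ->.
exists (of_ (nrm x) / x); split; last by rewrite divfK.
by rewrite nrmM nrmV nrm_ofR_ge0 ?nrm_ge0// mulfV.
Qed.

(** The converse inequality is the given one for [a^-1] at [a *: x]. *)
Lemma homogeneous_of_le (V : lmodType K) (p : V -> R) : (forall x, 0 <= p x) ->
  (forall a x, p (a *: x) <= nrm a * p x) -> forall a x, p (a *: x) = nrm a * p x.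
Proof.
move=> p0 le a x; apply/eqP; rewrite eq_le le/=.
have [->|a0] := eqVneq a 0; first by rewrite nrm0 mul0r p0.
have := le a^-1 (a *: x); rewrite scalerA mulVf// scale1r nrmV.
by rewrite mulrC ler_pdivlMr ?nrm_gt0// mulrC.
Qed.

Definition seminorm (V : lmodType K) (p : V -> R) : Prop :=
  (forall x y, p (x + y) <= p x + p y) /\ (forall a x, p (a *: x) = nrm a * p x).

Lemma seminorm0 (V : lmodType K) (p : V -> R) : seminorm p -> p 0 = 0.
Proof. by move=> [_ pZ]; rewrite -(scale0r 0) pZ nrm0 mul0r. Qed.

Lemma seminorm_ge0 (V : lmodType K) (p : V -> R) x : seminorm p -> 0 <= p x.
Proof.
move=> ps; have [pD pZ] := ps; have := pD x (-1 *: x).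
by rewrite pZ nrmN nrm1 mul1r scaleN1r subrr (seminorm0 ps); lra.
Qed.

Lemma seminormN (V : lmodType K) (p : V -> R) x : seminorm p -> p (- x) = p x.
Proof. by move=> [_ pZ]; rewrite -scaleN1r pZ nrmN nrm1 mul1r. Qed.

Lemma seminorm_sum (V : lmodType K) (p : V -> R) (I : Type) (r : seq I)
  (P : pred I) (F : I -> V) : seminorm p ->
  p (\sum_(i <- r | P i) F i) <= \sum_(i <- r | P i) p (F i).
Proof.
move=> ps; elim/big_ind2 : _ => [|x a y b xa yb|//]; first by rewrite seminorm0.
exact: le_trans (ps.1 _ _) (lerD xa yb).
Qed.

Lemma nrm_seminorm (V : normedModType K) : seminorm (@nrm V).
Proof. by split; [exact: nrmD|exact: nrmZ]. Qed.

Section hahn_banach.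
Variables (U V : lmodType K) (I : {linear U -> V}) (p : V -> R).
Hypothesis ps : seminorm p.

Section real_part.
Variable h : U -> R.
Hypotheses (hD : forall x y, h (x + y) = h x + h y).
Hypotheses (hZ : forall r x, h (of_ r *: x) = r * h x).
Hypotheses (hp : forall u, h u <= p (I u)).

Let graph : set (V * R) := [set q | exists u, q = (I u, h u)].

(** Partial functionals are encoded by their graphs. Single-valuedness is a consequence of
    domination: two values over one point differ by at most [p 0 = 0]. *)
Let dominated_linear (G : set (V * R)) :=
  (forall x y a b r, G (x, a) -> G (y, b) -> G (x + of_ r *: y, a + r * b)) /\
  (forall x a, G (x, a) -> a <= p x).

Let dominated_linear_graph : dominated_linear graph.
Proof.
split=> [x y a b r [u [-> ->]] [v [-> ->]]|x a [u [-> ->]]]; last exact: hp.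
by exists (u + of_ r *: v); rewrite linearD linearZ hD hZ.
Qed.

Let pR r x : 0 <= r -> p (of_ r *: x) = r * p x.
Proof. by move=> r0; rewrite ps.2 nrm_ofR_ge0. Qed.

Let extend (G : set (V * R)) z : dominated_linear G -> G (0, 0) ->
  exists c, dominated_linear
    [set q | exists x a r, G (x, a) /\ q = (x + of_ r *: z, a + r * c)].
Proof.
move=> [Glin Gp] G0.
(* The value c at [z] has to satisfy a - p (x - z) <= c <= p (y + z) - b for all (x, a) and (y, b)
   in the graph; the least such c is taken. Multiples of [z] reduce to these two cases by
   homogeneity. *)
pose L := [set l | exists x a, G (x, a) /\ l = a - p (x - z)].
have Lub y b : G (y, b) -> ubound L (p (y + z) - b).
  move=> Gyb _ [x [a [Gxa ->]]].
  have := Gp _ _ (Glin _ _ _ _ 1 Gxa Gyb); rewrite rmorph1 scale1r mul1r.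
  have := ps.1 (x - z) (y + z); rewrite addrACA addNr addr0; lra.
have L0 : L (0 - p (0 - z)) by exists 0, 0.
have supL : has_sup L by split; [exists (0 - p (0 - z))|exists (p (0 + z) - 0); exact: Lub].
have GZ r x a : G (x, a) -> G (of_ r *: x, r * a).
  by move=> /(Glin _ _ _ _ r G0); rewrite !add0r.
exists (sup L); split=> [_ _ _ _ r [x [a [s [Gx [-> ->]]]]] [y [b [t [Gy [-> ->]]]]]|].
  exists (x + of_ r *: y), (a + r * b), (s + r * t); split; first exact: Glin.
  congr (_, _); last by ring.
  by rewrite rmorphD rmorphM scalerDr scalerDl scalerA addrACA.
move=> _ _ [x [a [r [Gx [-> ->]]]]].
have [r0|r0|->] := ltgtP r 0; last 1 first.
- by rewrite rmorph0 scale0r addr0 mul0r addr0; exact: Gp.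
- have s0 : 0 < - r by rewrite oppr_gt0.
  have := GZ (- r)^-1 _ _ Gx => Gx'.
  have : (- r)^-1 * a - p (of_ (- r)^-1 *: x - z) <= sup L.
    by apply: ub_le_sup; [case: supL|exists (of_ (- r)^-1 *: x), ((- r)^-1 * a)].
  have -> : x + of_ r *: z = of_ (- r) *: (of_ (- r)^-1 *: x - z).
    rewrite scalerBr scalerA -rmorphM mulfV ?gt_eqF// rmorph1 scale1r.
    by rewrite rmorphN scaleNr opprK.
  rewrite (pR _ (ltW s0)) => h1.
  have := ler_wpM2l (ltW s0) h1; rewrite mulrBr mulrA mulfV ?gt_eqF// mul1r; lra.
- have Gx' := GZ r^-1 _ _ Gx.
  have : sup L <= p (of_ r^-1 *: x + z) - r^-1 * a.
    by apply: sup_le_ub; [case: supL|exact: Lub].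
  have -> : x + of_ r *: z = of_ r *: (of_ r^-1 *: x + z).
    by rewrite scalerDr scalerA -rmorphM mulfV ?gt_eqF// rmorph1 scale1r.
  rewrite (pR _ (ltW r0)) => h1.
  have := ler_wpM2l (ltW r0) h1; rewrite mulrBr mulrA mulfV ?gt_eqF// mul1r; lra.
Qed.

Lemma hahn_banach_re : exists u : V -> R,
  [/\ forall x y, u (x + y) = u x + u y,
      forall r x, u (of_ r *: x) = r * u x,
      forall x, u x <= p x & forall y, u (I y) = h y].
Proof.
(* Joining [graph] to every set gives the empty chain an upper bound in Zorn's lemma. *)
pose P (G : set (V * R)) := dominated_linear (G `|` graph).
have [|M [[Mlin Mp] Mmax]] := @Zorn_bigcup _ P.
  move=> F FP Ftot; split; last first.
    move=> x a [[X FX Xxa]|]; last exact: dominated_linear_graph.2.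
    by apply: (FP X FX).2; left.
  move=> x y a b r [[X FX Xxa]|gx] [[Y FY Yyb]|gy].
  - have [XY|YX] := Ftot _ _ FX FY.
      have [] := (FP Y FY).1 x y a b r _ _; [by left; exact: XY|by left| |].
        by left; exists Y.
      by right.
    have [] := (FP X FX).1 x y a b r _ _; [by left|by left; exact: YX| |].
      by left; exists X.
    by right.
  - have [] := (FP X FX).1 x y a b r _ _; [by left|by right| |].
      by left; exists X.
    by right.
  - have [] := (FP Y FY).1 x y a b r _ _; [by right|by left| |].
      by left; exists Y.
    by right.
  - by right; exact: dominated_linear_graph.1.
pose G := M `|` graph.
have h0 : h 0 = 0 by rewrite -(scale0r 0) -(rmorph0 of_) hZ mul0r.
have G0 : G (0, 0) by right; exists 0; rewrite linear0 h0.
have tot z : exists a, G (z, a).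
  apply: contrapT => /forallNP nG.
  have [c [clin cp]] := extend z (conj Mlin Mp) G0.
  set B := [set q | _] in clin cp.
  have GB : G `<=` B.
    by move=> [x a] Gxa; exists x, a, 0; rewrite rmorph0 scale0r mul0r !addr0.
  have PB : P B.
    by rewrite /P (_ : B `|` graph = B)//; apply/setUidl => q gq; apply: GB; right.
  apply: (Mmax B) => //; split; first by move=> q Mq; apply: GB; left.
  move=> BM; apply: (nG c); left; apply: BM.
  by exists 0, 0, 1; rewrite rmorph1 scale1r mul1r !add0r.
have Guniq x a b : G (x, a) -> G (x, b) -> a = b.
  suff le a' b' : G (x, a') -> G (x, b') -> a' <= b'.
    by move=> ga gb; apply/eqP; rewrite eq_le !le.
  move=> ga gb; have := Mp _ _ (Mlin _ _ _ _ (-1) ga gb).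
  by rewrite rmorphN1 scaleN1r subrr (seminorm0 ps) mulN1r subr_le0.
have [u Gu] := choice tot.
exists u; split=> [x y|r x|x|y].
- apply: (Guniq (x + y)) => //.
  by have := Mlin _ _ _ _ 1 (Gu x) (Gu y); rewrite rmorph1 scale1r mul1r.
- apply: (Guniq (of_ r *: x)) => //.
  by have := Mlin _ _ _ _ r G0 (Gu x); rewrite !add0r.
- exact: (Mp _ _ (Gu x)).
- by apply: (Guniq (I y)) => //; right; exists y.
Qed.

End real_part.

Lemma hahn_banach (g : {linear U -> K^o}) :
  (forall u, nrm (g u : K) <= p (I u)) ->
  exists f : {linear V -> K^o},
    (forall x, nrm (f x : K) <= p x) /\ (forall u, f (I u) = g u).
Proof.
move=> gp.
have [|||u [uD uZ up uI]] := @hahn_banach_re (fun x => re S (g x)).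
- by move=> x y; rewrite linearD reD.
- by move=> r x; rewrite linearZ reZ.
- by move=> x; apply: le_trans (re_norm_le _) (gp x).
(* A functional is recovered from its real part [u]; if [iu] is 0, [f] is [u] itself. *)
pose f (x : V) : K := of_ (u x) - iu S * of_ (u (iu S *: x)).
have fD x y : f (x + y) = f x + f y.
  by rewrite /f scalerDr !uD !rmorphD mulrDr; ring.
have fR r x : f (of_ r *: x) = of_ r * f x.
  by rewrite /f scalerA (mulrC (iu S) (of_ r)) -scalerA !uZ !rmorphM; ring.
have fi x : f (iu S *: x) = iu S * f x.
  rewrite /f scalerA -expr2.
  have u0 : u 0 = 0 by rewrite -(scale0r 0) -(rmorph0 of_) uZ mul0r.
  have [->|i2] := iu_cases S.
    by rewrite expr2 !(scale0r, mul0r, u0, rmorph0, subr0).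
  rewrite i2 -(rmorphN1 of_) uZ mulrBr mulrA -expr2 i2 !rmorphM rmorphN1; ring.
have flin : linear (f : V -> K^o).
  move=> a x y; rewrite fD; congr (_ + _).
  rewrite {1}(scalars_reim a) scalerDl fD fR -scalerA fi fR.
  by rewrite /GRing.scale /= {3}(scalars_reim a) mulrDl mulrA.
pose f' : {linear V -> K^o} := HB.pack (f : V -> K^o) (GRing.isLinear.Build _ _ _ _ _ flin).
have ref x : re S (f x) = u x by rewrite /f reB re_ofR re_iu_ofR subr0.
exists f'; split=> [x|y] /=.
  (* Rotating [x] until [f] is real and nonnegative there turns the bound on the real part into one
     on the modulus. *)
  have [t [t1 tx]] := unimodular (f x).
  have ft : f (t *: x) = t * f x by rewrite -[LHS]/(f' (t *: x)) linearZ.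
  have <- : u (t *: x) = nrm (f x : K) by rewrite -ref ft tx re_ofR.
  by apply: le_trans (up _) _; rewrite ps.2 t1 mul1r.
have Iiu : iu S *: I y = I (iu S *: y) by rewrite linearZ.
have giu : g (iu S *: y) = iu S * g y by rewrite linearZ.
by rewrite /f Iiu !uI giu -scalarsE.
Qed.

End hahn_banach.

End scalars_theory.

(** * Biorthogonal systems *)

Definition mklin (K : numFieldType) (U V : lmodType K) (f : U -> V)
    (fl : linear f) : {linear U -> V} :=
  HB.pack f (GRing.isLinear.Build K U V *:%R f fl).

Lemma scale_linear (K : numFieldType) (V : lmodType K) (y : V) :
  linear (fun a : K^o => a *: y).
Proof. by move=> a x z; rewrite scalerDl scalerA. Qed.

Lemma lincomb_linear (K : numFieldType) (V : lmodType K) (J : finType)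
  (e : J -> V) : linear (fun c : J -> K^o => \sum_j c j *: e j).
Proof.
move=> a x y; rewrite scaler_sumr -big_split; apply: eq_bigr => j _ /=.
by rewrite scalerA -scalerDl.
Qed.

Lemma functionals_linear (K : numFieldType) (V : lmodType K) (J : Type)
  (f : J -> {linear V -> K^o}) : linear (fun x => (fun j => f j x) : J -> K^o).
Proof. by move=> a x y; apply/funext => j; rewrite linearP. Qed.

Lemma linear_form (K : numFieldType) (V : lmodType K) (J : finType)
  (f : {linear V -> K^o}) (e : J -> V) (c : J -> K) :
  f (\sum_j c j *: e j) = \sum_j c j * f (e j).
Proof. by rewrite linear_sum; apply: eq_bigr => j _; rewrite linearZ. Qed.

Lemma finite_dimensional_family (K : numFieldType) (V : lmodType K) k (e : 'I_k -> V) :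
  (forall x, exists c : 'I_k -> K, x = \sum_i c i *: e i) -> finite_dimensional V.
Proof.
move=> sp; exists [seq e i | i <- enum 'I_k] => x; have [c xE] := sp x.
have sz : size [seq e i | i <- enum 'I_k] = k by rewrite size_map size_enum_ord.
exists (fun i => c (cast_ord sz i)).
rewrite [LHS]xE (reindex (cast_ord sz))/=.
  apply: eq_bigr => i _; congr (_ *: _).
  rewrite (nth_map (cast_ord sz i)) ?size_enum_ord -?[X in (_ < X)%N]sz//.
  congr (e _); apply/val_inj; rewrite /= nth_enum_ord//.
  by rewrite -[X in (_ < X)%N]sz.
by exists (cast_ord (esym sz)) => i _; rewrite ?cast_ordK ?cast_ordKV.
Qed.

Section biorthogonal.
Variables (R : realType) (K : numFieldType) (S : scalars R K).
Variables (V : lmodType K) (p : V -> R).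
Hypothesis ps : seminorm S p.

Lemma norming_functional (y : V) : exists f : {linear V -> K^o},
  (forall x, nrm S (f x : K) <= p x) /\ f y = ofR S (p y).
Proof.
have gl : linear (fun a : K^o => (a * ofR S (p y) : K^o)).
  by move=> a x z; rewrite mulrDl -mulrA.
have [|f [fp fI]] := @hahn_banach _ _ S K^o V (mklin (scale_linear y)) p ps
    (mklin gl).
  move=> a /=; rewrite nrmM ps.2 nrm_ofR_ge0//.
  exact: (seminorm_ge0 y ps).
by exists f; split=> //; have := fI 1; rewrite /= scale1r mul1r.
Qed.

Definition biorthogonal k (e : 'I_k -> V) (f : 'I_k -> {linear V -> K^o}) :=
  (forall i j, f i (e j) = (i == j)%:R) /\
  (forall i, exists C, forall x, nrm S (f i x : K) <= C * p x).

Hypothesis p0 : forall x, p x = 0 -> x = 0.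

(** A Gram-Schmidt step. All [f i] vanish on y = x - Pr x, and a norming functional of y, composed
    with the complementary projection and normalised, vanishes on all [e j] and is 1 at y. *)
Lemma biorthogonal_extend k (e : 'I_k -> V) (f : 'I_k -> {linear V -> K^o}) x :
  biorthogonal e f -> x != \sum_i f i x *: e i ->
  exists (e' : 'I_k.+1 -> V) (f' : 'I_k.+1 -> {linear V -> K^o}),
    [/\ biorthogonal e' f', x = \sum_i f' i x *: e' i &
        forall w, w = \sum_i f i w *: e i -> w = \sum_i f' i w *: e' i].
Proof.
move=> [fe fb] xne.
pose Pr w := \sum_i f i w *: e i.
have PrB : linear (fun w => w - Pr w).
  move=> a u v; rewrite /Pr scalerBr scaler_sumr addrACA -opprD; congr (_ - _).
  by rewrite -big_split; apply: eq_bigr => i _; rewrite linearP scalerDl scalerA.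
have fPr i w : f i (Pr w) = f i w.
  rewrite linear_form (bigD1 i)//= fe eqxx mulr1 big1 ?addr0// => j /negbTE ji.
  by rewrite fe eq_sym ji mulr0.
have Pre j : Pr (e j) = e j.
  rewrite /Pr (bigD1 j)//= fe eqxx scale1r big1 ?addr0// => i /negbTE ij.
  by rewrite fe ij scale0r.
pose y := x - Pr x.
have y0 : p y != 0.
  by apply: contra xne => /eqP /p0 /eqP; rewrite subr_eq0.
have fy i : f i y = 0 by rewrite linearB fPr subrr.
have Pry : Pr y = 0 by rewrite /Pr big1// => i _; rewrite fy scale0r.
have [g [gp gy]] := norming_functional y.
have gl : linear (fun w => (g (w - Pr w) / ofR S (p y) : K^o)).
  move=> a u v; rewrite PrB linearP.
  by rewrite mulrDl -mulrA.
pose h := mklin gl.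
have hE w : h w = g (w - Pr w) / ofR S (p y) by [].
have py0 : ofR S (p y) != 0 by rewrite fmorph_eq0.
have hx : h x = 1 by rewrite hE gy divff.
have hy : h y = 1 by rewrite hE Pry subr0 gy divff.
have he j : h (e j) = 0 by rewrite hE Pre subrr linear0 mul0r.
pose e' i := oapp e y (unlift ord0 i).
pose f' i := oapp f h (unlift ord0 i).
have e'0 : e' ord0 = y by rewrite /e' unlift_none.
have f'0 : f' ord0 = h by rewrite /f' unlift_none.
have e'l i : e' (lift ord0 i) = e i by rewrite /e' liftK.
have f'l i : f' (lift ord0 i) = f i by rewrite /f' liftK.
have sumE w : \sum_i f' i w *: e' i = h w *: y + Pr w.
  rewrite big_ord_recl e'0 f'0; congr (_ + _).
  by apply: eq_bigr => i _; rewrite e'l f'l.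
exists e', f'; split.
- split=> [i j|i].
    have [{}i ->|->] := unliftP ord0 i; have [{}j ->|->] := unliftP ord0 j.
    - by rewrite e'l f'l fe (inj_eq (@lift_inj _ _)).
    - by rewrite e'0 f'l fy eq_sym (negbTE (neq_lift _ _)).
    - by rewrite e'l f'0 he (negbTE (neq_lift _ _)).
    - by rewrite e'0 f'0 hy eqxx.
  have [{}i ->|->] := unliftP ord0 i; first by rewrite f'l; exact: fb.
  have [C Cf] := choice fb.
  exists ((1 + \sum_i C i * p (e i)) / p y) => w; rewrite f'0 hE nrmM nrmV.
  rewrite nrm_ofR_ge0 ?(seminorm_ge0 y ps)// mulrAC ler_wpM2r//.
    by rewrite invr_ge0 (seminorm_ge0 y ps).
  apply: le_trans (gp _) _; apply: le_trans (ps.1 _ _) _.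
  rewrite mulrDl mul1r lerD2l (seminormN _ ps).
  apply: le_trans (seminorm_sum _ _ _ ps) _.
  rewrite mulr_suml; apply: ler_sum => j _; rewrite ps.2 mulrAC.
  by rewrite ler_wpM2r// (seminorm_ge0 _ ps).
- by rewrite sumE hx scale1r subrK.
- move=> w wE; rewrite sumE hE /Pr -wE subrr.
  by rewrite linear0 mul0r scale0r add0r.
Qed.


Lemma biorthogonal0 (e : 'I_0 -> V) f : biorthogonal e f.
Proof. by split=> -[]. Qed.

Lemma biorthogonal_span (s : seq V) :
  exists k (e : 'I_k -> V) (f : 'I_k -> {linear V -> K^o}),
    biorthogonal e f /\ forall x, x \in s -> x = \sum_i f i x *: e i.
Proof.
elim: s => [|x s [k [e [f [b sE]]]]].
  exists 0, (fun=> 0), (fun=> (\0 : {linear V -> K^o})).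
  by split=> //; exact: biorthogonal0.
have [xE|xne] := eqVneq x (\sum_i f i x *: e i).
  by exists k, e, f; split=> // y; rewrite inE => /predU1P[->//|/sE].
have [e' [f' [b' xE' wE]]] := biorthogonal_extend b xne.
exists k.+1, e', f'; split=> // y; rewrite inE => /predU1P[->//|/sE].
exact: wE.
Qed.

Lemma biorthogonal_infinite k : ~ finite_dimensional V ->
  exists (e : 'I_k -> V) (f : 'I_k -> {linear V -> K^o}), biorthogonal e f.
Proof.
move=> Vinf; elim: k => [|k [e [f b]]].
  exists (fun=> 0), (fun=> (\0 : {linear V -> K^o})).
  exact: biorthogonal0.
have [sp|/existsNP[x /eqP xne]] := pselect (forall x, x = \sum_i f i x *: e i).
  exfalso; apply: Vinf; apply: (finite_dimensional_family (e := e)) => x.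
  by exists (fun i => f i x).
have [e' [f' [b' _ _]]] := biorthogonal_extend b xne.
by exists e', f'.
Qed.

End biorthogonal.

(** * Banach spaces obtained by renorming *)

Section renormed.
Variables (K : numFieldType) (V : lmodType K) (p : V -> K).

(** The alias carries the proof [pn], so that the same module can receive several norms; [banach]
    below adds a proof of completeness in the same way. *)
Definition renormed (pn : is_norm p) : Type := V.

Variable pn : is_norm p.

HB.instance Definition _ := GRing.Lmodule.on (renormed pn).

Fact renormed_normD (x y : renormed pn) : p (x + y) <= p x + p y.
Proof. by have [_ _ _] := pn; apply. Qed.

Fact renormed_normZ (a : K) (x : renormed pn) : p (a *: x) = `|a| * p x.
Proof. by have [_ _ pZ _] := pn; exact: pZ. Qed.

Fact renormed_norm0 (x : renormed pn) : p x = 0 -> x = 0.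
Proof. by have [_ p0 _ _] := pn; exact: p0. Qed.

HB.instance Definition _ := Lmodule_isNormed.Build K (renormed pn)
  renormed_normD renormed_normZ renormed_norm0.

Lemma renormedE (x : renormed pn) : `|x| = p x. Proof. by []. Qed.

Definition renormed_complete : Prop :=
  forall F : set_system (renormed pn), ProperFilter F -> cauchy F -> cvg F.

Definition banach (pc : renormed_complete) : Type := renormed pn.

Variable pc : renormed_complete.

HB.instance Definition _ := NormedModule.on (banach pc).
HB.instance Definition _ := Uniform_isComplete.Build (banach pc) pc.

Definition banach_space : completeNormedModType K := banach pc.

Lemma banachE (x : banach_space) : `|x| = p x. Proof. by []. Qed.

End renormed.

(* A left inverse bounded with respect to [J] makes the range of [J] closed. *)
Lemma renormed_completeP (K : numFieldType) (V : lmodType K) (p : V -> K)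
    (pn : is_norm p) (W : completeNormedModType K) (J : {linear V -> W})
    (r : {linear W -> V}) (C D : K) :
  0 <= C -> 0 < D -> (forall x, `|J x| <= C * p x) ->
  (forall y, p (r y) <= D * `|y|) -> (forall x, r (J x) = x) ->
  renormed_complete pn.
Proof.
move=> C0 D0 JC rD rJ F FF Fc.
have C1 : 0 < C + 1 by rewrite ltr_wpDl.
have JFc : cauchy (J @ F).
  apply/cauchy_ballP => e e0.
  have /cauchy_ballP/(_ (e / (C + 1))) := Fc.
  rewrite divr_gt0// => /(_ isT) [[A B] /= [FA FB] AB].
  exists (J @` A, J @` B); first by split => /=;
    [apply: filterS FA => x Ax; exists x|apply: filterS FB => x Bx; exists x].
  move=> [_ _] /= [[x Ax <-] [y By <-]].
  have := AB (x, y) (conj Ax By); rewrite /= -!ball_normE /= => xy.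
  rewrite -linearB; apply: le_lt_trans (JC _) _.
  have : (C + 1) * `|x - y : renormed pn| < e by rewrite mulrC -ltr_pdivlMr.
  apply: le_lt_trans; rewrite mulrDl mul1r renormedE lerDl.
  by have [] := pn.
have /cauchy_cvg/cvg_ex[/= y Jy] := JFc.
apply/cvg_ex; exists (r y : renormed pn).
apply/cvgrPdist_lt => e e0.
have /cvgrPdist_lt/(_ (e / D)) := Jy; rewrite divr_gt0// => /(_ isT).
move=> h; near=> x.
have : `|y - J x| < e / D by near: x; exact: h.
rewrite ltr_pdivlMr// mulrC => /(le_lt_trans _); apply.
by rewrite -{1}(rJ x) -linearB; exact: rD.
Unshelve. all: by end_near. Qed.

(** * The Dvoretzky-Rogers lemma *)

(** Sylvester's identity det (1 - U V) = det (1 - V U), read off from two block factorisations of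
    [M]. *)
Lemma det_1_sub_mul (K : comNzRingType) N j (U : 'M[K]_(N, j)) (V : 'M[K]_(j, N)) :
  V *m U = 1%:M -> forall c, \det (1%:M - c *: (U *m V)) = (1 - c) ^+ j.
Proof.
move=> VU c; pose M := block_mx 1%:M U (c *: V) 1%:M.
have e1 : M = block_mx 1%:M 0 (c *: V) 1%:M *m block_mx 1%:M U 0 (1%:M - c *: 1%:M).
  rewrite mulmx_block !mul1mx !mul0mx !mulmx1 !addr0.
  by rewrite -scalemxAl VU addrC subrK.
have e2 : M = block_mx 1%:M U 0 1%:M *m block_mx (1%:M - c *: (U *m V)) 0 (c *: V) 1%:M.
  rewrite mulmx_block !mul1mx !mul0mx !mulmx1 !add0r.
  by rewrite -scalemxAr subrK.
have := congr1 determinant e1; rewrite {1}e2 !det_mulmx !det_ublock !det_lblock.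
rewrite !det1 !mul1r mulr1 => ->.
by rewrite scalemx1 -raddfB /= det_scalar.
Qed.

Section hilbert.
Variables (R : realType) (K : numFieldType) (S : scalars R K).

Definition adj m n (A : 'M[K]_(m, n)) : 'M[K]_(n, m) := map_mx (cj S) A^T.

Lemma adjM m n k (A : 'M[K]_(m, n)) (B : 'M[K]_(n, k)) :
  adj (A *m B) = adj B *m adj A.
Proof. by rewrite /adj trmx_mul map_mxM. Qed.

Lemma adjK m n (A : 'M[K]_(m, n)) : adj (adj A) = A.
Proof. by apply/matrixP => i j; rewrite !mxE cjK. Qed.

Lemma adjB m n (A B : 'M[K]_(m, n)) : adj (A - B) = adj A - adj B.
Proof. by rewrite /adj linearB map_mxB. Qed.

Definition hsq N (x : 'cV[K]_N) : R := \sum_i nrm S (x i ord0) ^+ 2.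
Definition l2 N (x : 'cV[K]_N) : R := Num.sqrt (hsq x).

Lemma hsq_ge0 N (x : 'cV[K]_N) : 0 <= hsq x.
Proof. by apply: sumr_ge0 => i _; rewrite sqr_ge0. Qed.

Lemma l2_ge0 N (x : 'cV[K]_N) : 0 <= l2 x. Proof. exact: sqrtr_ge0. Qed.

Lemma sqr_l2 N (x : 'cV[K]_N) : l2 x ^+ 2 = hsq x.
Proof. by rewrite sqr_sqrtr ?hsq_ge0. Qed.

Lemma adj_mul_self N (x : 'cV[K]_N) : adj x *m x = (ofR S (hsq x))%:M.
Proof.
apply/matrixP => i j; rewrite !ord1 !mxE rmorph_sum; apply: eq_bigr => k _ /=.
by rewrite !mxE mulrC nrm_sqr.
Qed.

Lemma hsqZ N a (x : 'cV[K]_N) : hsq (a *: x) = nrm S a ^+ 2 * hsq x.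
Proof.
by rewrite /hsq mulr_sumr; apply: eq_bigr => i _; rewrite mxE nrmM exprMn.
Qed.

Lemma nrm_le_l2 N (x : 'cV[K]_N) i : nrm S (x i ord0) <= l2 x.
Proof.
rewrite -(ler_pXn2r (n:=2))// ?nnegrE ?nrm_ge0 ?l2_ge0// sqr_l2 /hsq (bigD1 i)//=.
by rewrite lerDl sumr_ge0// => k _; rewrite sqr_ge0.
Qed.

Lemma hsq_eq0 N (x : 'cV[K]_N) : hsq x = 0 -> x = 0.
Proof.
move=> x0; apply/matrixP => i j; rewrite ord1 mxE; apply: (nrm0_eq0 (S := S)).
by have := nrm_le_l2 x i; rewrite /l2 x0 sqrtr0 => h; apply/eqP; rewrite eq_le h nrm_ge0.
Qed.

Lemma scalar_mx1_inj (a b : K) : (a%:M = b%:M :> 'M[K]_1) -> a = b.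
Proof. by move=> /matrixP/(_ ord0 ord0); rewrite !mxE. Qed.

Lemma hsq_isometry N j (U : 'M[K]_(N, j)) (a : 'cV[K]_j) :
  adj U *m U = 1%:M -> hsq (U *m a) = hsq a.
Proof.
move=> UU; apply: (ofR_inj (S := S)); apply: scalar_mx1_inj.
by rewrite -!adj_mul_self adjM -mulmxA (mulmxA (adj U)) UU mul1mx.
Qed.

(** Pythagoras for the orthogonal projection [U *m adj U]. *)
Lemma hsq_complement N j (U : 'M[K]_(N, j)) (x : 'cV[K]_N) :
  adj U *m U = 1%:M -> hsq (x - U *m (adj U *m x)) <= hsq x.
Proof.
move=> UU; suff <- : hsq (x - U *m (adj U *m x)) + hsq (adj U *m x) = hsq x.
  by rewrite lerDl hsq_ge0.
apply: (ofR_inj (S := S)); apply: scalar_mx1_inj; rewrite rmorphD raddfD /=.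
rewrite -!adj_mul_self adjB !adjM !adjK mulmxBl !mulmxBr.
rewrite -!mulmxA (mulmxA (adj U) U) UU mul1mx.
by rewrite subrr subr0 subrK.
Qed.

Section dvoretzky_rogers.
Variables (N m : nat) (p : 'cV[K]_N -> R) (c g : R).
Hypotheses (ps : seminorm S p) (c0 : 0 <= c) (g0 : 0 < g) (g1 : g < 1).
Hypothesis pc : forall (x : 'cV[K]_N) i, nrm S (x i ord0) <= c * p x.
Hypothesis Nbig : 2 ^+ m.+1 <= (1 + g / 2) ^+ (N - m).

Let admissible (T : 'M[K]_N) : Prop := forall x, p (T *m x) <= l2 x.

Let some_admissible : exists T, admissible T /\ 0 < nrm S (\det T).
Proof.
pose B := \sum_(i < N) p (delta_mx i ord0); pose e := (B + 1)^-1.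
have B0 : 0 <= B by apply: sumr_ge0 => i _; exact: (seminorm_ge0 _ ps).
have e0 : 0 < e by rewrite invr_gt0 ltr_wpDl.
exists (ofR S e)%:M; split; last first.
  by rewrite det_scalar nrmX (nrm_ofR_ge0 S (ltW e0)) exprn_gt0.
move=> x; rewrite mul_scalar_mx ps.2 (nrm_ofR_ge0 S (ltW e0)).
have xB : p x <= B * l2 x.
  have xE : x = \sum_i x i ord0 *: delta_mx i ord0.
    by rewrite [LHS]matrix_sum_delta; apply: eq_bigr => i _; rewrite big_ord1.
  rewrite {1}xE; apply: le_trans (seminorm_sum _ _ _ ps) _.
  rewrite mulr_suml; apply: ler_sum => i _; rewrite ps.2 mulrC ler_wpM2l//.
    exact: (seminorm_ge0 _ ps).
  exact: nrm_le_l2.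
apply: le_trans (ler_wpM2l (ltW e0) xB) _.
rewrite mulrA ler_piMl ?l2_ge0// /e mulrC ler_pdivrMr ?ltr_wpDl//; lra.
Qed.

(** The entries of an admissible matrix are at most [c], so each term of the Leibniz formula is at
    most c^N. This makes the supremum of the determinants finite. *)
Let admissible_det_le T : admissible T ->
  nrm S (\det T) <= \sum_(s : 'S_N) c ^+ N.
Proof.
move=> Ta; rewrite /determinant; apply: le_trans (nrm_sum _ _ _ _) _.
apply: ler_sum => s _; rewrite nrmM nrmX nrmN nrm1 expr1n mul1r nrm_prod.
rewrite -[X in c ^+ X]card_ord -prodr_const; apply: ler_prod => i _.
rewrite nrm_ge0/=.
have -> : T i (s i) = (T *m (delta_mx (s i) ord0 : 'cV[K]_N)) i ord0.
  by rewrite -colE mxE.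
apply: le_trans (pc _ _) _; rewrite ler_piMr//; apply: le_trans (Ta _) _.
rewrite /l2 -sqrtr1 ler_wsqrtr// /hsq (bigD1 (s i))//= big1; last first.
  by move=> k /negbTE ks; rewrite mxE ks /= nrm0 expr0n.
by rewrite mxE !eqxx nrm1 expr1n addr0.
Qed.

Let grow (T : 'M[K]_N) j (U : 'M[K]_(N, j)) : admissible T ->
  (j < m)%N -> adj U *m U = 1%:M ->
  (forall x, adj U *m x = 0 -> p (T *m x) <= (1 - g) * l2 x) ->
  exists T', admissible T' /\ 2 * nrm S (\det T) <= nrm S (\det T').
Proof.
move=> Ta jm UU small; have g0' := g0; have g1' := g1.
(* [D] is 1/2 on the range of [U] and 1 + g/2 on its complement. It is half the identity plus [s]
   times the projection to the complement, so [T *m D] is bounded by 1/2 + s (1 - g) = 1 - g^2/2.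
   Its determinant gains the factor (1 + g/2)^(N - j) / 2^j >= 2^(m + 1 - j) >= 2. *)
pose al := 1 + g / 2; pose s := 1 / 2 + g / 2.
have al0 : 0 < al by move: g0; rewrite /al; lra.
pose D := ofR S al *: (1%:M - ofR S (s / al) *: (U *m adj U)).
exists (T *m D); split.
  move=> x; rewrite -mulmxA.
  pose Px := x - U *m (adj U *m x).
  have -> : D *m x = ofR S (1 / 2) *: x + ofR S s *: Px.
    rewrite /D -scalemxAl mulmxBl mul1mx -scalemxAl scalerBr scalerA -rmorphM.
    rewrite mulrC divfK ?gt_eqF// /Px scalerBr addrA -scalerDl -rmorphD -mulmxA.
    by congr (ofR S _ *: _ - _); rewrite /al /s; lra.
  rewrite mulmxDr -!scalemxAr.
  apply: le_trans (ps.1 _ _) _; rewrite !ps.2 !nrm_ofR_ge0; [|rewrite /s; lra|lra].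
  have h1 := Ta x.
  have h2 : p (T *m Px) <= (1 - g) * l2 Px.
    by apply: small; rewrite /Px mulmxBr (mulmxA (adj U) U) UU mul1mx subrr.
  have h3 : l2 Px <= l2 x by rewrite ler_wsqrtr// hsq_complement.
  have h4 := l2_ge0 x.
  have h5 : p (T *m Px) <= (1 - g) * l2 x.
    by apply: le_trans h2 _; rewrite ler_wpM2l//; lra.
  rewrite /s; nra.
have detD : nrm S (\det D) = al ^+ (N - j) * (1 / 2) ^+ j.
  rewrite /D -mul_scalar_mx det_mulmx det_scalar (det_1_sub_mul UU).
  have s0 : 0 <= 1 - s / al by rewrite subr_ge0 ler_pdivrMr// /s /al; lra.
  have -> : 1 - ofR S (s / al) = ofR S (1 - s / al) by rewrite rmorphB rmorph1.
  rewrite nrmM !nrmX (nrm_ofR_ge0 S (ltW al0)) (nrm_ofR_ge0 S s0).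
  have -> : 1 - s / al = (1 / 2) / al by rewrite /s /al; field; apply: lt0r_neq0; lra.
  have jN : (j <= N)%N.
    have := mxrankM_maxr (adj U) U; rewrite UU mxrank1 => /leq_trans; apply.
    exact: rank_leq_row.
  rewrite -{1}(subnK jN) exprD -mulrA -exprMn; congr (_ * _ ^+ _).
  by field; rewrite gt_eqF.
rewrite det_mulmx nrmM detD mulrC ler_wpM2l ?nrm_ge0//.
have : al ^+ (N - m) <= al ^+ (N - j).
  by apply: ler_weXn2l; [rewrite /al; lra|exact: leq_sub2l (ltnW jm)].
move=> /(le_trans Nbig) h.
rewrite expr_div_n expr1n mul1r ler_pdivlMr ?exprn_gt0//.
by rewrite -exprS; apply: le_trans h; apply: ler_weXn2l; [lra|exact: ltnW].
Qed.

(* If [T] nearly maximises the determinant among contractions from a Hilbert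
   space, it cannot be smaller than [1 - g] on the complement of few vectors:
   expanding that complement would double the determinant. *)
Lemma dvoretzky_rogers : exists Y : 'M[K]_(N, m),
  (forall a, p (Y *m a) <= l2 a) /\ (forall i, 1 - g <= p (col i Y)).
Proof.
pose D := [set nrm S (\det T) | T in admissible].
have [T0 [T0a T0d]] := some_admissible.
have Dsup : has_sup D.
  split; first by exists (nrm S (\det T0)), T0.
  by exists (\sum_(s : 'S_N) c ^+ N) => _ [T Ta <-]; exact: admissible_det_le.
have sD0 : 0 < sup D.
  by apply: lt_le_trans T0d _; apply: sup_upper_bound => //; exists T0.
have [_ [T Ta <-] Td] : exists2 d, D d & sup D - sup D / 2 < d.
  by apply: sup_adherent => //; rewrite divr_gt0.
suff /(_ m (leqnn m)) [U [UU Up]] : forall j, (j <= m)%N ->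
    exists U : 'M[K]_(N, j), adj U *m U = 1%:M /\
      forall i, 1 - g <= p (T *m col i U).
  exists (T *m U); split=> [a|i].
    by rewrite -mulmxA; apply: le_trans (Ta _) _; rewrite /l2 hsq_isometry.
  by rewrite colE -mulmxA -colE.
elim=> [_|j IH jm]; first by exists 0; split=> [|[]//]; apply/matrixP => -[].
have [U [UU Up]] := IH (ltnW jm).
have [x [Ux px]] : exists x, adj U *m x = 0 /\ (1 - g) * l2 x < p (T *m x).
  apply: contrapT => /forallNP nx.
  have [|T' [T'a T'd]] := grow Ta jm UU.
    by move=> x Ux; rewrite leNgt; apply/negP => h; apply: (nx x).
  have : nrm S (\det T') <= sup D by apply: sup_upper_bound => //; exists T'.
  lra.
have x0 : 0 < l2 x.
  rewrite lt_def l2_ge0 andbT; apply/negP => /eqP x0.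
  have /hsq_eq0 xz : hsq x = 0 by rewrite -sqr_l2 x0 expr0n.
  by move: px; rewrite xz mulmx0 (seminorm0 ps) -xz x0 mulr0 ltxx.
pose y := ofR S (l2 x)^-1 *: x.
have y1 : hsq y = 1.
  by rewrite hsqZ nrm_ofR_ge0 ?invr_ge0 ?l2_ge0// -sqr_l2 -exprMn mulVf ?gt_eqF// expr1n.
have Uy : adj U *m y = 0 by rewrite -scalemxAr Ux scaler0.
have yU : adj y *m U = 0 by rewrite -[adj y *m U]adjK adjM adjK Uy /adj trmx0 map_mx0.
have -> : j.+1 = (j + 1)%N by rewrite addn1.
exists (row_mx U y); split.
  rewrite /adj tr_row_mx map_col_mx mul_col_row -/(adj U) -/(adj y).
  by rewrite UU Uy yU adj_mul_self y1 rmorph1 -scalar_mx_block.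
move=> i; case: (splitP i) => k ik.
  have -> : i = lshift 1 k by apply/val_inj.
  by rewrite colKl.
have -> : i = rshift j k by apply/val_inj.
rewrite colKr ord1.
rewrite (_ : col 0 y = y); last by apply/matrixP => a b; rewrite !mxE ord1.
rewrite /y -scalemxAr ps.2 nrm_ofR_ge0 ?invr_ge0 ?l2_ge0// mulrC.
by rewrite ler_pdivlMr// ltW.
Qed.

End dvoretzky_rogers.

End hilbert.

(** Lagrange's identity: [D] is twice the difference of the two sides. *)
Lemma cauchy_schwarz (R : realDomainType) (I : finType) (u v : I -> R) :
  (\sum_i u i * v i) ^+ 2 <= (\sum_i u i ^+ 2) * (\sum_i v i ^+ 2).
Proof.
pose D := \sum_i \sum_j (u i * v j - u j * v i) ^+ 2.
have D0 : 0 <= D by apply: sumr_ge0 => i _; apply: sumr_ge0 => j _; rewrite sqr_ge0.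
have uv : (\sum_i u i ^+ 2) * (\sum_i v i ^+ 2) =
    \sum_i \sum_j u i ^+ 2 * v j ^+ 2.
  by rewrite mulr_suml; apply: eq_bigr => i _; rewrite mulr_sumr.
have vu : (\sum_i u i ^+ 2) * (\sum_i v i ^+ 2) =
    \sum_i \sum_j u j ^+ 2 * v i ^+ 2 by rewrite uv exchange_big.
have cr : (\sum_i u i * v i) ^+ 2 = \sum_i \sum_j (u i * v j) * (u j * v i).
  rewrite expr2 mulr_suml; apply: eq_bigr => i _; rewrite mulr_sumr.
  by apply: eq_bigr => j _; ring.
have : D = (\sum_i u i ^+ 2) * (\sum_i v i ^+ 2) *+ 2 - (\sum_i u i * v i) ^+ 2 *+ 2.
  rewrite mulr2n {1}uv vu cr -sumrMnl /D -big_split -sumrB; apply: eq_bigr => i _ /=.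
  rewrite -sumrMnl -big_split -sumrB; apply: eq_bigr => j _ /=; ring.
by move=> DE; move: D0; rewrite DE subr_ge0 lerMn2r.
Qed.

(** Bernoulli's inequality. *)
Lemma exprn_unbounded (R : realType) (a B : R) : 1 < a -> exists k, B <= a ^+ k.
Proof.
move=> a1; have h k : 1 + (a - 1) *+ k <= a ^+ k.
  elim: k => [|k IH]; first by rewrite mulr0n addr0 expr0.
  rewrite exprS mulrSr; have : 0 <= (a - 1) *+ k by rewrite mulrn_wge0// subr_ge0 ltW.
  nra.
exists (Num.truncn (`|B| / (a - 1))).+1; apply: le_trans (h _).
apply: le_trans (ler_norm B) _; rewrite -mulr_natr.
have a0 : 0 < a - 1 by rewrite subr_gt0.
have := truncnS_gt (`|B| / (a - 1)); rewrite ltr_pdivrMr// mulrC; lra.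
Qed.

(** * From almost biorthogonal to biorthogonal systems *)

Section near_identity.
Variables (R : realType) (K : numFieldType) (S : scalars R K) (m : nat).

(** Self-duality of Hilbert space: test with the conjugates of the [b i]. *)
Lemma l2_dual (b : 'I_m -> K) (M : R) : 0 <= M ->
  (forall a : 'cV[K]_m, nrm S (\sum_i a i ord0 * b i) <= M * l2 S a) ->
  \sum_i nrm S (b i) ^+ 2 <= M ^+ 2.
Proof.
move=> M0 h; set s := \sum_i _.
have s0 : 0 <= s by apply: sumr_ge0 => i _; rewrite sqr_ge0.
have := h (\col_i cj S (b i)).
have -> : \sum_i (\col_i cj S (b i)) i ord0 * b i = ofR S s.
  by rewrite rmorph_sum; apply: eq_bigr => i _; rewrite mxE mulrC nrm_sqr.
have -> : l2 S (\col_i cj S (b i)) = Num.sqrt s.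
  by congr Num.sqrt; apply: eq_bigr => i _; rewrite mxE nrm_cj.
rewrite nrm_ofR_ge0// => sM.
have [->|sn0] := eqVneq s 0; first by rewrite sqr_ge0.
have r0 : 0 < Num.sqrt s by rewrite sqrtr_gt0 lt_def sn0.
have sE : s = Num.sqrt s ^+ 2 by rewrite sqr_sqrtr.
rewrite sE ler_pXn2r ?nnegrE ?sqrtr_ge0// -(ler_pM2r r0).
by rewrite -expr2 -sE.
Qed.

(** The squared distance from b to the i-th unit vector is |b|^2 - 2 t + 1 <= 2 - 2 t. *)
Lemma unit_vector_dist (b : 'I_m -> K) i (t eta : R) :
  b i = ofR S t -> 1 - eta <= t -> \sum_j nrm S (b j) ^+ 2 <= 1 ->
  \sum_j nrm S (b j - (i == j)%:R) ^+ 2 <= 2 * eta.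
Proof.
move=> bi te; rewrite (bigD1 i)//= [X in _ -> X <= _](bigD1 i)//= bi eqxx.
rewrite nrm_ofR real_normK ?num_real// => h.
rewrite -(rmorph1 (ofR S)) -rmorphB nrm_ofR real_normK ?num_real//.
rewrite (eq_bigr (fun j => nrm S (b j) ^+ 2)); last first.
  by move=> j /negbTE ji; rewrite eq_sym ji subr0.
by move: h te; set x := \sum_(_ | _) _; nra.
Qed.

(** [G] is within 1/2 of the identity in the Hilbert-Schmidt norm, so |G a - a| <= |a| / 2 and |a|
    <= 2 |G a|. *)
Lemma near_identity (G : 'M[K]_m) :
  \sum_i \sum_j nrm S (G i j - (i == j)%:R) ^+ 2 <= 4^-1 ->
  G \in unitmx /\ forall b, hsq S (invmx G *m b) <= 4 * hsq S b.
Proof.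
move=> Gh.
have key a : hsq S a <= 4 * hsq S (G *m a).
  have h1 : hsq S (G *m a - a) <= 4^-1 * hsq S a.
    apply: le_trans (ler_wpM2r (hsq_ge0 S a) Gh).
    rewrite mulr_suml; apply: ler_sum => i _.
    have -> : (G *m a - a) i ord0 = \sum_j (G i j - (i == j)%:R) * a j ord0.
      rewrite !mxE -[X in _ - X]mul1r; under [RHS]eq_bigr do rewrite mulrBl.
      rewrite sumrB; congr (_ - _); rewrite (bigD1 i)//= eqxx big1 ?addr0//.
      by move=> j /negbTE ji; rewrite eq_sym ji mul0r.
    apply: le_trans (cauchy_schwarz _ _).
    rewrite ler_pXn2r ?nnegrE ?nrm_ge0//; last first.
      by apply: sumr_ge0 => j _; rewrite mulr_ge0 ?nrm_ge0.
    apply: le_trans (nrm_sum _ _ _ _) _.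
    by under eq_bigr do rewrite nrmM.
  have h2 : hsq S a <= 2 * hsq S (G *m a) + 2 * hsq S (G *m a - a).
    rewrite /hsq !mulr_sumr -big_split; apply: ler_sum => i _ /=.
    set u := (G *m a) i ord0; set v := (G *m a - a) i ord0.
    have -> : a i ord0 = u - v.
      rewrite /v [(G *m a - a) i ord0]mxE -/u [(- a) i ord0]mxE; ring.
    have := nrmD S u (- v); rewrite nrmN; have := nrm_ge0 S (u - v).
    by have := sqr_ge0 (nrm S u - nrm S v); nra.
  by lra.
have Gu : G \in unitmx.
  rewrite -unitmx_tr -row_free_unit; apply: inj_row_free => v vG.
  have : G *m v^T = 0 by rewrite -[LHS]trmxK trmx_mul trmxK vG trmx0.
  move=> Gv; have := key v^T; rewrite Gv {2}/hsq big1; last first.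
    by move=> i _; rewrite mxE nrm0 expr0n.
  rewrite mulr0 => h; apply: trmx_inj; rewrite trmx0.
  by apply: (hsq_eq0 (S := S)); apply/eqP; rewrite eq_le h hsq_ge0.
split=> // b; have := key (invmx G *m b).
by rewrite mulmxA mulmxV// mul1mx.
Qed.

End near_identity.

Section exact_systems.
Variables (R : realType) (K : numFieldType) (S : scalars R K).
Variable E : normedModType K.
Hypothesis Einf : ~ finite_dimensional E.
Variable m : nat.

(** Small enough that m rows (or columns), each at squared distance at most 2 * (2 * g) from a unit
    vector, stay below the 1/4 of [near_identity]. One [g] is lost in [dvoretzky_rogers], the other
    pays for near-maximisers. *)
Let g : R := (16 * m.+1%:R)^-1.

Let g_gt0 : 0 < g. Proof. by rewrite invr_gt0 mulr_gt0// ltr0n. Qed.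

Let g_le : g <= 16^-1.
Proof. by rewrite lef_pV2 ?posrE ?mulr_gt0// ?ltr0n// ler_peMr// ler1n. Qed.

Let g_lt1 : g < 1. Proof. by have := g_le; lra. Qed.

Let g_m : m%:R * (2 * (2 * g)) <= 4^-1.
Proof.
have : m.+1%:R * g = 16^-1 by rewrite /g invfM mulrCA mulfV ?mulr1// pnatr_eq0.
by rewrite -natr1 mulrDl mul1r; have := g_gt0; lra.
Qed.

Let system : exists N (e : 'I_N -> E) (f : 'I_N -> {linear E -> K^o}),
  biorthogonal S (@nrm R K S E) e f /\ 2 ^+ m.+1 <= (1 + g / 2) ^+ (N - m).
Proof.
have [|k kbig] := @exprn_unbounded R (1 + g / 2) (2 ^+ m.+1).
  by rewrite ltrDl divr_gt0.
have [e [f b]] := biorthogonal_infinite (nrm_seminorm S E)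
  (@nrm0_eq0 _ _ S E) (k + m)%N Einf.
by exists (k + m)%N, e, f; rewrite addnK.
Qed.

(** The Dvoretzky-Rogers vectors [y i] in the span of the [e k] have norm nearly 1. A norming
    functional [h i] of [y i] has (h i (y j))_j in the Hilbert ball with i-th entry nearly 1, so [G]
    is nearly the identity. Correcting the vectors by its inverse leaves the functionals in the dual
    ball. *)
Lemma hilbert_bounded_system : exists (x : 'I_m -> E) (f : 'I_m -> {linear E -> K^o}),
  [/\ forall i y, nrm S (f i y : K) <= nrm S y,
      forall i j, f i (x j) = (i == j)%:R &
      forall a : 'I_m -> K,
        nrm S (\sum_i a i *: x i) ^+ 2 <= 4 * \sum_i nrm S (a i) ^+ 2].
Proof.
have [N [e [f [[fe /choice[C fb]] Nbig]]]] := system.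
pose p (x : 'cV[K]_N) := nrm S (\sum_i x i ord0 *: e i).
have ps : seminorm S p.
  split=> [x y|a x].
    apply: le_trans (nrmD _ _ _); rewrite -big_split/= /p.
    by under [in leLHS]eq_bigr do rewrite mxE scalerDl.
  rewrite -nrmZ scaler_sumr; congr (nrm S _); apply: eq_bigr => i _.
  by rewrite mxE scalerA.
have fp (x : 'cV[K]_N) i : f i (\sum_i x i ord0 *: e i) = x i ord0.
  rewrite linear_form (bigD1 i)//= fe eqxx mulr1 big1 ?addr0// => j /negbTE ji.
  by rewrite fe eq_sym ji mulr0.
have [||Y [Ya Yi]] := @dvoretzky_rogers R K S N m p (\sum_i `|C i|) g
  ps _ g_gt0 g_lt1 _ Nbig.
- by apply: sumr_ge0.
- move=> x i; rewrite -(fp x); apply: le_trans (fb _ _) _.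
  rewrite ler_wpM2r ?nrm_ge0// (bigD1 i)//= ler_wpDr ?sumr_ge0//; exact: ler_norm.
pose y j := \sum_k Y k j *: e k.
have yE (a : 'cV[K]_m) : \sum_j a j ord0 *: y j = \sum_k (Y *m a) k ord0 *: e k.
  under eq_bigr do rewrite scaler_sumr; rewrite exchange_big; apply: eq_bigr => k _.
  rewrite mxE scaler_suml; apply: eq_bigr => j _.
  by rewrite scalerA mulrC.
have ya (a : 'cV[K]_m) : nrm S (\sum_j a j ord0 *: y j) <= l2 S a.
  by rewrite yE; exact: Ya.
have yi i : 1 - g <= nrm S (y i).
  by have := Yi i; rewrite /p; under eq_bigr do rewrite mxE.
have /choice[h hp] i := norming_functional (nrm_seminorm S E) (y i).
pose G := \matrix_(i, j) (h i (y j) : K).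
have [|Gu Gb] := @near_identity R K S m G.
  apply: le_trans g_m; rewrite mulr_natl -[X in _ *+ X]card_ord -sumr_const.
  apply: ler_sum => i _; apply: (@unit_vector_dist _ _ _ _ _ _ (nrm S (y i))).
  - by rewrite mxE (hp i).2.
  - by apply: le_trans (yi i); have := g_gt0; lra.
  - rewrite -(expr1n _ 2); apply: l2_dual => // a; rewrite mul1r.
    apply: le_trans (ya a); apply: le_trans ((hp i).1 _).
    rewrite linear_form; under eq_bigr do rewrite mxE.
    by [].
exists (fun j => \sum_k invmx G k j *: y k), h; split.
- by move=> i; exact: (hp i).1.
- move=> i j; rewrite linear_form; have /matrixP/(_ i j) := mulmxV Gu.
  rewrite !mxE => <-; apply: eq_bigr => k _.
  by rewrite mxE mulrC.
- move=> a; have -> : \sum_i a i *: (\sum_k invmx G k i *: y k) =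
      \sum_k (invmx G *m \col_i a i) k ord0 *: y k.
    under eq_bigr do rewrite scaler_sumr; rewrite exchange_big; apply: eq_bigr => k _.
    rewrite mxE scaler_suml; apply: eq_bigr => j _.
    by rewrite mxE scalerA mulrC.
  apply: (@le_trans _ _ (l2 S (invmx G *m \col_i a i) ^+ 2)).
    by rewrite ler_pXn2r ?nnegrE ?nrm_ge0 ?l2_ge0.
  rewrite sqr_l2; apply: le_trans (Gb _) _; rewrite /hsq.
  by under eq_bigr do rewrite mxE.
Qed.

(** The dual argument: [p] is the dual norm on the span of the [f k], Dvoretzky-Rogers yields
    functionals [h j], and [x j] is a vector of the unit ball at which [h j] is nearly maximal. Here
    the functionals are corrected, and the vectors stay in the ball. *)
Lemma hilbert_valued_system : exists (x : 'I_m -> E) (f : 'I_m -> {linear E -> K^o}),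
  [/\ forall i, nrm S (x i) <= 1,
      forall i j, f i (x j) = (i == j)%:R &
      forall y, \sum_i nrm S (f i y : K) ^+ 2 <= 4 * nrm S y ^+ 2].
Proof.
have [N [e [f [[fe /choice[C fb]] Nbig]]]] := system.
pose D (a : 'cV[K]_N) :=
  [set nrm S (\sum_i a i ord0 * (f i y : K)) | y in [set y | nrm S y <= 1]].
pose p a := sup (D a).
have D0 a : D a 0.
  exists 0; first by rewrite /= nrm0.
  by rewrite big1 ?nrm0// => i _; rewrite linear0 mulr0.
have Dub a : has_sup (D a).
  split; first by exists 0.
  exists (\sum_i nrm S (a i ord0) * `|C i|) => _ [y /= y1 <-].
  apply: le_trans (nrm_sum _ _ _ _) _; apply: ler_sum => i _.
  rewrite nrmM ler_wpM2l ?nrm_ge0//; apply: le_trans (fb _ _) _.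
  apply: (@le_trans _ _ (`|C i| * nrm S y)).
    by rewrite ler_wpM2r ?nrm_ge0 ?ler_norm.
  by rewrite ler_piMr.
have Dp (a : 'cV[K]_N) y : nrm S y <= 1 -> nrm S (\sum_i a i ord0 * (f i y : K)) <= p a.
  by move=> y1; apply: sup_upper_bound => //; exists y.
have pD (a : 'cV[K]_N) y : nrm S (\sum_i a i ord0 * (f i y : K)) <= p a * nrm S y.
  have [y0|y0] := eqVneq (nrm S y) 0.
    rewrite (nrm0_eq0 y0) nrm0 mulr0 big1 ?nrm0// => i _.
    by rewrite linear0 mulr0.
  have y00 : 0 < nrm S y by rewrite lt_def y0 nrm_ge0.
  have := Dp a (ofR S (nrm S y)^-1 *: y).
  rewrite nrmZ nrm_ofR_ge0 ?invr_ge0 ?nrm_ge0// mulVf// => /(_ (lexx _)).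
  have -> : \sum_i a i ord0 * (f i (ofR S (nrm S y)^-1 *: y) : K) =
      ofR S (nrm S y)^-1 * \sum_i a i ord0 * (f i y : K).
    by rewrite mulr_sumr; apply: eq_bigr => i _; rewrite linearZ mulrCA.
  rewrite nrmM nrm_ofR_ge0 ?invr_ge0 ?nrm_ge0// mulrC.
  by rewrite ler_pdivrMr.
have p0 a : 0 <= p a by apply: sup_upper_bound.
have pZle b (a : 'cV[K]_N) : p (b *: a) <= nrm S b * p a.
  apply: ge_sup; first by exists 0.
  move=> _ [y /= y1 <-].
  have -> : \sum_i (b *: a) i ord0 * (f i y : K) = b * \sum_i a i ord0 * (f i y : K).
    by rewrite mulr_sumr; apply: eq_bigr => i _; rewrite mxE mulrA.
  by rewrite nrmM ler_wpM2l ?nrm_ge0// Dp.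
have ps : seminorm S p.
  split=> [a b|b a].
    apply: ge_sup; first by exists 0.
    move=> _ [y /= y1 <-].
    apply: le_trans (lerD (Dp a _ y1) (Dp b _ y1)).
    apply: le_trans (nrmD _ _ _); rewrite -big_split/=.
    by under [in leLHS]eq_bigr do rewrite mxE mulrDl.
  exact: homogeneous_of_le.
have [||Y [Ya Yi]] := @dvoretzky_rogers R K S N m p (\sum_i nrm S (e i)) g
  ps _ g_gt0 g_lt1 _ Nbig.
- by apply: sumr_ge0 => i _; exact: nrm_ge0.
- move=> a i; have := pD a (e i).
  rewrite (bigD1 i)//= fe eqxx mulr1 big1 ?addr0; last first.
    by move=> j /negbTE ji; rewrite fe ji mulr0.
  move=> h; apply: le_trans h _; rewrite mulrC ler_wpM2r ?p0// (bigD1 i)//=.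
  by rewrite lerDl sumr_ge0// => j _; exact: nrm_ge0.
have hl j : linear (fun x => \sum_k Y k j * (f k x : K) : K^o).
  move=> a x y; rewrite scaler_sumr -big_split; apply: eq_bigr => k _ /=.
  rewrite linearP mulrDr; congr (_ + _).
  by rewrite /GRing.scale/= mulrCA.
pose h j := mklin (hl j).
have hE (a : 'cV[K]_m) x : \sum_j a j ord0 * (h j x : K) =
    \sum_k (Y *m a) k ord0 * (f k x : K).
  under eq_bigr do rewrite mulr_sumr; rewrite exchange_big; apply: eq_bigr => k _.
  rewrite mxE mulr_suml; apply: eq_bigr => j _ /=.
  by rewrite mulrA (mulrC (a j ord0)).
have h2 x : \sum_j nrm S (h j x : K) ^+ 2 <= nrm S x ^+ 2.
  apply: l2_dual => [|a]; first exact: nrm_ge0.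
  rewrite hE; apply: le_trans (pD _ _) _; rewrite mulrC ler_wpM2l ?nrm_ge0//.
have hi i : exists x, nrm S x <= 1 /\
    exists2 t, 1 - 2 * g <= t & h i x = ofR S t.
  have [_ [x /= x1 <-] xi] := sup_adherent g_gt0 (Dub (col i Y)).
  have [t [t1 tx]] := unimodular S (h i x).
  exists (t *: x); split; first by rewrite nrmZ t1 mul1r.
  exists (nrm S (h i x : K)); last by rewrite -[LHS]/(h i (t *: x)) linearZ.
  have := Yi i; rewrite -/(p _) in xi; move: xi.
  have -> : \sum_i0 col i Y i0 ord0 * (f i0 x : K) = h i x.
    by apply: eq_bigr => k _; rewrite mxE.
  by lra.
have [x xP] := choice hi.
pose G := \matrix_(i, j) (h i (x j) : K).
have [|Gu Gb] := @near_identity R K S m G.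
  apply: le_trans g_m; rewrite mulr_natl -[X in _ *+ X]card_ord -sumr_const.
  rewrite exchange_big; apply: ler_sum => j _.
  have [x1 [t t1 tE]] := xP j.
  have -> : \sum_i nrm S (G i j - (i == j)%:R) ^+ 2 =
     \sum_i nrm S ((h i (x j) : K) - (j == i)%:R) ^+ 2.
    by apply: eq_bigr => i _; rewrite mxE eq_sym.
  apply: (@unit_vector_dist _ _ _ _ (fun i => h i (x j)) j t) => //.
  by apply: le_trans (h2 _) _; rewrite expr_le1 ?nrm_ge0.
have kl i : linear (fun y => \sum_k invmx G i k * (h k y : K) : K^o).
  move=> a u v; rewrite scaler_sumr -big_split; apply: eq_bigr => k _ /=.
  rewrite hl mulrDr; congr (_ + _).
  by rewrite /GRing.scale/= mulrCA.
exists x, (fun i => mklin (kl i)); split.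
- by move=> i; have [] := xP i.
- move=> i j; have /matrixP/(_ i j) := mulVmx Gu.
  by rewrite !mxE => <-; apply: eq_bigr => k _; rewrite mxE.
- move=> y; apply: le_trans (ler_wpM2l _ (h2 y)) => //.
  have := Gb (\col_k (h k y : K)); rewrite /hsq.
  under [X in _ <= 4 * X]eq_bigr do rewrite mxE.
  apply: le_trans; apply: ler_sum => i _; rewrite mxE.
  by under [X in _ <= nrm S X ^+ 2]eq_bigr do rewrite mxE.
Qed.

End exact_systems.

(** * Riesz products and Khinchin inequality *)

Section rademacher.
Variable m : nat.
Local Notation cube := {ffun 'I_m -> bool}.

(** The coordinates of the cube are independent: the sum of products is a product of sums over one
    sign each. *)
Lemma sum_sign_sign_prod (A : comNzRingType) i (F : 'I_m -> A) (G : 'I_m -> A) :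
  \sum_(w : cube) (-1) ^+ w i * \prod_j (F j + (-1) ^+ w j * G j) =
  G i *+ 2 * \prod_(j | j != i) (F j *+ 2).
Proof.
pose H j (b : bool) := (if j == i then (-1) ^+ b else 1) * (F j + (-1) ^+ b * G j).
rewrite (eq_bigr (fun w : cube => \prod_j H j (w j))); last first.
  move=> w _; rewrite big_split /=; congr (_ * _).
  rewrite (bigD1 i)//= eqxx big1 ?mulr1// => j /negbTE ->//.
rewrite -(bigA_distr_bigA H) (bigD1 i)//=; congr (_ * _).
  by rewrite big_bool /H eqxx /= expr0 expr1; ring.
apply: eq_bigr => j /negbTE ji; rewrite big_bool /H ji /= expr0 expr1; ring.
Qed.

Lemma sum_signs (A : comNzRingType) i j :
  \sum_(w : cube) ((-1) ^+ w i * (-1) ^+ w j : A) = (i == j)%:R * 2 ^+ m.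
Proof.
have [->|ij] := eqVneq i j.
  rewrite (eq_bigr (fun=> 1)) => [|w _]; last by rewrite -expr2 sqrr_sign.
  by rewrite sumr_const card_ffun card_bool card_ord mul1r natrX.
rewrite mul0r.
rewrite (eq_bigr (fun w : cube => (-1) ^+ w i *
    \prod_k ((if k == j then 0 else 1 : A) + (-1) ^+ w k * (if k == j then 1 else 0)))).
  by rewrite sum_sign_sign_prod (negbTE ij) mul0rn mul0r.
move=> w _; congr (_ * _); rewrite (bigD1 j)//= eqxx add0r mulr1 big1 ?mulr1//.
by move=> k /negbTE ->; rewrite mulr0 addr0.
Qed.

(** An elementary substitute for bounding the product by the exponential of the sum. *)
Lemma prod_1_add_le (R : realFieldType) (I : Type) (s : seq I) (a : I -> R) :
  (forall i, 0 <= a i) ->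
  0 <= \prod_(i <- s) (1 + a i) /\
  \prod_(i <- s) (1 + a i) * (1 - \sum_(i <- s) a i) <= 1.
Proof.
move=> a0; elim: s => [|i s [IH0 IH]]; first by rewrite !big_nil; split; lra.
rewrite !big_cons; split; first by rewrite mulr_ge0// addr_ge0.
have s0 : 0 <= \sum_(j <- s) a j by exact: sumr_ge0.
apply: le_trans IH; rewrite mulrAC mulrC ler_wpM2l//.
by have := a0 i; nra.
Qed.

(* The Riesz product [prod_j (1 + i r_j v_j)] is bounded and its correlation
   with [r_i] is [i v_i]. *)
Lemma riesz_product_real (R : realType) (v : 'I_m -> R) :
  \sum_i v i ^+ 2 <= 1 -> exists g : cube -> R,
    (forall w, `|g w| <= 4) /\ forall i, \sum_(w : cube) (-1) ^+ w i * g w = 2 ^+ m * v i.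
Proof.
move=> v1.
(* Halving [v] gives |z|^2 <= 1 / (1 - 1/4) = 4/3, whence the bound 4. The imaginary part removes
   the factor i of the correlation, and the factor 2 undoes the halving. *)
pose z (w : cube) : R[i] := \prod_j (1 + (-1) ^+ w j * ('i%C * (v j / 2)%:C%C)).
exists (fun w => 2 * complex.Im (z w)); split=> [w|i].
  have zz : `|z w| ^+ 2 = (\prod_j (1 + (v j / 2) ^+ 2))%:C%C.
    rewrite normr_prod -prodrXl rmorph_prod; apply: eq_bigr => j _.
    rewrite -add_Re2_Im2; congr (_%:C)%C.
    by case: (w j); rewrite ?expr0 ?expr1; simpc => /=; ring.
  have Im_le : complex.Im (z w) ^+ 2 <= \prod_j (1 + (v j / 2) ^+ 2).
    rewrite -lecR -zz -add_Re2_Im2 lecR lerDr sqr_ge0//.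
  have [|P0 P1] := prod_1_add_le (index_enum 'I_m) (a := fun j => (v j / 2) ^+ 2).
    by move=> j; exact: sqr_ge0.
  have sE : \sum_j (v j / 2) ^+ 2 = (\sum_j v j ^+ 2) / 4.
    by rewrite mulr_suml; apply: eq_bigr => j _; field.
  move: P1; rewrite sE => P1.
  rewrite -(ler_pXn2r (n := 2))// ?nnegrE// real_normK ?num_real// exprMn.
  by nra.
have := congr1 (@complex.Im R) (sum_sign_sign_prod i (fun=> 1 : R[i])
  (fun j => 'i%C * (v j / 2)%:C%C)).
have -> : \prod_(j < m | j != i) (1 *+ 2 : R[i]) = (2 ^+ m.-1)%:C%C.
  rewrite prodr_const rmorphXn /= rmorphMn rmorph1; congr (_ ^+ _).
  by rewrite -[m in RHS]card_ord -(cardC1 i).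
have Im_sum (F : cube -> R[i]) : complex.Im (\sum_w F w) = \sum_w complex.Im (F w).
  by apply: (big_morph (@complex.Im R)) => [[? ?] [? ?]|].
rewrite Im_sum -/(z _).
have -> : complex.Im (('i%C * (v i / 2)%:C%C) *+ 2 * (2 ^+ m.-1)%:C%C) = v i * 2 ^+ m.-1.
  by rewrite mulr2n; simpc => /=; lra.
move=> h; rewrite (eq_bigr (fun w : cube => 2 * complex.Im ((-1) ^+ w i * z w))).
  rewrite -mulr_sumr h; have : (0 < m)%N by apply: leq_trans (ltn_ord i).
  by case: (m) => // k _; rewrite exprS /=; ring.
move=> w _; have -> : (-1 : R[i]) ^+ w i = ((-1) ^+ w i)%:C%C.
  by rewrite rmorphXn rmorphN1.
by case: (z w) => a b; simpc => /=; ring.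
Qed.

Section scalars.
Variables (R : realType) (K : numFieldType) (S : scalars R K).

Lemma ofR_sign (b : bool) : ofR S ((-1) ^+ b) = (-1) ^+ b.
Proof. by rewrite rmorphXn rmorphN1. Qed.

Lemma nrm_sign (b : bool) : nrm S ((-1) ^+ b : K) = 1.
Proof. by rewrite -ofR_sign nrm_ofR normrX normrN1 expr1n. Qed.

(** Real and imaginary parts are treated separately, whence 8 = 4 + 4. *)
Lemma riesz_product (v : 'I_m -> K) : \sum_i nrm S (v i) ^+ 2 <= 1 ->
  exists g : cube -> K, (forall w, nrm S (g w) <= 8) /\
    forall i, (2 ^+ m)^-1 * \sum_(w : cube) (-1) ^+ w i * g w = v i.
Proof.
move=> v1.
have sq_le (a : R) b : `|a| <= b -> a ^+ 2 <= b ^+ 2.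
  by move=> ab; rewrite -[a ^+ 2]real_normK ?num_real// lerXn2r ?nnegrE// (le_trans _ ab).
have [|g1 [g1b g1E]] := @riesz_product_real R (fun i => re S (v i)).
  by apply: le_trans v1; apply: ler_sum => i _; apply: sq_le; exact: re_le.
have [|g2 [g2b g2E]] := @riesz_product_real R (fun i => im S (v i)).
  by apply: le_trans v1; apply: ler_sum => i _; apply: sq_le; exact: im_le.
exists (fun w => ofR S (g1 w) + iu S * ofR S (g2 w)); split=> [w|i].
  apply: le_trans (nrmD _ _ _) _; rewrite nrmM !nrm_ofR.
  have := g1b w; have := g2b w; have := nrm_iu S; have := nrm_ge0 S (iu S).
  by have := normr_ge0 (g2 w); nra.
have -> : \sum_(w : cube) (-1) ^+ w i * (ofR S (g1 w) + iu S * ofR S (g2 w)) =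
    ofR S (\sum_(w : cube) (-1) ^+ w i * g1 w) +
    iu S * ofR S (\sum_(w : cube) (-1) ^+ w i * g2 w).
  rewrite !rmorph_sum mulr_sumr -big_split; apply: eq_bigr => w _ /=.
  by rewrite !rmorphM ofR_sign; ring.
rewrite g1E g2E !rmorphM rmorphXn rmorph_nat [RHS](scalars_reim S).
by field; rewrite expf_neq0// pnatr_eq0.
Qed.

Lemma sum_sqr_rademacher (a : 'cV[K]_m) :
  \sum_(w : cube) nrm S (\sum_i a i ord0 * (-1) ^+ w i) ^+ 2 = 2 ^+ m * hsq S a.
Proof.
apply: (ofR_inj (S := S)); rewrite rmorphM rmorphXn rmorph_nat !rmorph_sum.
under eq_bigr do rewrite -nrm_sqr rmorph_sum mulr_suml.
under eq_bigr do under eq_bigr do rewrite mulr_sumr.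
rewrite exchange_big mulr_sumr; apply: eq_bigr => i _ /=.
rewrite -nrm_sqr exchange_big.
have inner j : \sum_(w : cube) a i ord0 * (-1) ^+ w i * cj S (a j ord0 * (-1) ^+ w j) =
    a i ord0 * cj S (a j ord0) * ((i == j)%:R * 2 ^+ m).
  rewrite -sum_signs mulr_sumr; apply: eq_bigr => w _.
  by rewrite rmorphM rmorphXn rmorphN1; ring.
rewrite (eq_bigr _ (fun j _ => inner j)) (bigD1 i)//= eqxx mul1r mulrC big1 ?addr0//.
by move=> j /negbTE ji; rewrite eq_sym ji mul0r mulr0.
Qed.

(** The coefficients of degree one in the Walsh expansion of [s]. *)
Definition fourier (s : cube -> K) i : K := (2 ^+ m)^-1 * \sum_(w : cube) (-1) ^+ w i * s w.

Let two0 : (2 : R) ^+ m > 0. Proof. by rewrite exprn_gt0. Qed.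

Let nrm_two : nrm S (2 ^+ m : K)^-1 = (2 ^+ m)^-1.
Proof.
by rewrite nrmV nrmX -(rmorph_nat (ofR S)) nrm_ofR_ge0// ler0n.
Qed.

(** By duality this is the comparison of the mean with the quadratic mean of a Rademacher sum. *)
Lemma bessel (s : cube -> K) : (forall w, nrm S (s w) <= 1) ->
  \sum_i nrm S (fourier s i) ^+ 2 <= 1.
Proof.
move=> s1; rewrite -[leRHS](expr1n _ 2); apply: l2_dual => // a; rewrite mul1r.
have -> : \sum_i a i ord0 * fourier s i =
    (2 ^+ m)^-1 * \sum_(w : cube) (\sum_i a i ord0 * (-1) ^+ w i) * s w.
  rewrite mulr_sumr; under [RHS]eq_bigr do rewrite mulr_suml mulr_sumr.
  rewrite exchange_big; apply: eq_bigr => i _ /=.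
  rewrite /fourier mulrCA mulr_sumr mulr_sumr; apply: eq_bigr => w _; ring.
rewrite nrmM nrm_two mulrC ler_pdivrMr//.
apply: (@le_trans _ _ (\sum_(w : cube) nrm S (\sum_i a i ord0 * (-1) ^+ w i) * 1)).
  apply: le_trans (nrm_sum _ _ _ _) _; apply: ler_sum => w _.
  by rewrite nrmM ler_wpM2l ?nrm_ge0.
have := cauchy_schwarz (fun w : cube => nrm S (\sum_i a i ord0 * (-1) ^+ w i)) (fun=> 1).
rewrite sum_sqr_rademacher sumr_const card_ffun card_bool card_ord expr1n.
rewrite -sqr_l2 natrX => h.
rewrite -(ler_pXn2r (n := 2))// ?nnegrE; last 2 first.
- by apply: sumr_ge0 => w _; rewrite mulr1 nrm_ge0.
- by rewrite mulr_ge0 ?l2_ge0// ltW.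
by apply: le_trans h _; rewrite exprMn expr2; lra.
Qed.

(** The Rademacher sum of [a] is tested against the Riesz product, bounded by 8, whose coefficients
    are the conjugates of a / |a|. *)
Lemma khinchin (a : 'cV[K]_m) :
  l2 S a <= 8 * ((2 ^+ m)^-1 * \sum_(w : cube) nrm S (\sum_i a i ord0 * (-1) ^+ w i)).
Proof.
have [a0|a0] := eqVneq (l2 S a) 0.
  rewrite a0; apply: mulr_ge0 => //; apply: mulr_ge0.
    by rewrite invr_ge0 ltW.
  by apply: sumr_ge0 => w _; exact: nrm_ge0.
have ap : 0 < l2 S a by rewrite lt_def a0 l2_ge0.
have [|g [g8 gE]] := @riesz_product (fun i => ofR S (l2 S a)^-1 * cj S (a i ord0)).
  under eq_bigr do rewrite nrmM nrm_cj exprMn nrm_ofR_ge0 ?invr_ge0 ?l2_ge0//.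
  by rewrite -mulr_sumr -/(hsq S a) -sqr_l2 -exprMn mulVf// expr1n.
have -> : l2 S a = nrm S (\sum_i a i ord0 * (ofR S (l2 S a)^-1 * cj S (a i ord0))).
  under eq_bigr do rewrite mulrCA nrm_sqr.
  rewrite -mulr_sumr -rmorph_sum -/(hsq S a) -rmorphM -sqr_l2 expr2 mulKf//.
  by rewrite nrm_ofR_ge0 ?l2_ge0.
under eq_bigr do rewrite -gE.
have -> : \sum_i a i ord0 * ((2 ^+ m)^-1 * \sum_(w : cube) (-1) ^+ w i * g w) =
    (2 ^+ m)^-1 * \sum_(w : cube) (\sum_i a i ord0 * (-1) ^+ w i) * g w.
  rewrite mulr_sumr; under [RHS]eq_bigr do rewrite mulr_suml mulr_sumr.
  rewrite exchange_big; apply: eq_bigr => i _ /=.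
  rewrite mulrCA mulr_sumr mulr_sumr; apply: eq_bigr => w _; ring.
rewrite nrmM nrm_two mulrCA ler_wpM2l ?invr_ge0 ?exprn_ge0//.
apply: le_trans (nrm_sum _ _ _ _) _; rewrite mulr_sumr; apply: ler_sum => w _.
by rewrite nrmM mulrC ler_wpM2r ?nrm_ge0.
Qed.

End scalars.

End rademacher.

(** * The fermionic trilinear form *)

(** This is 2^r, written so that it matches the dimensions of [block_mx]. *)
Fixpoint fock_dim r : nat := if r is r'.+1 then (fock_dim r' + fock_dim r')%N else 1.

Section creation.
Variables (R : realType) (K : numFieldType) (S : scalars R K).

(* The creation operator of the vector [x] on the fermionic Fock space over
   [K^r]; [creation_car] is the canonical anticommutation relation. *)
Fixpoint creation r (x : nat -> K) : 'M[K]_(fock_dim r) :=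
  if r is r'.+1 then
    block_mx (creation r' (fun i => x i.+1)) (x 0)%:M 0
             (- creation r' (fun i => x i.+1))
  else 0.

Lemma adj_block m1 m2 n1 n2 (A : 'M[K]_(m1, n1)) B C (D : 'M[K]_(m2, n2)) :
  adj S (block_mx A B C D) = block_mx (adj S A) (adj S C) (adj S B) (adj S D).
Proof. by rewrite /adj tr_block_mx map_block_mx. Qed.

Lemma adj0 m n : adj S (0 : 'M[K]_(m, n)) = 0.
Proof. by rewrite /adj trmx0 map_mx0. Qed.

Lemma adjN m n (A : 'M[K]_(m, n)) : adj S (- A) = - adj S A.
Proof. by rewrite /adj linearN map_mxN. Qed.

Lemma adj_scalar n (a : K) : adj S (a%:M : 'M[K]_n) = (cj S a)%:M.
Proof. by rewrite /adj tr_scalar_mx map_scalar_mx. Qed.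

Lemma creation_car r x :
  adj S (creation r x) *m creation r x + creation r x *m adj S (creation r x) =
  (ofR S (\sum_(i < r) nrm S (x i) ^+ 2))%:M.
Proof.
elim: r x => [|r IH] x /=.
  by rewrite big_ord0 rmorph0 mulmx0 mul0mx addr0 raddf0.
set A := creation r _; have IHA := IH (fun i => x i.+1); rewrite -/A in IHA.
rewrite adj_block adj0 adjN adj_scalar !mulmx_block.
rewrite !(mul0mx, mulmx0, addr0, add0r) !mulNmx !mulmxN !opprK.
rewrite !mul_scalar_mx !mul_mx_scalar add_block_mx !scale_scalar_mx !subrr.
rewrite (mulrC (cj S (x 0))) addrA addrC IHA -addrA IHA addrC.
rewrite big_ord_recl rmorphD /= -nrm_sqr -raddfD /=.
by rewrite -scalar_mx_block addrC.
Qed.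

Lemma creation_eq r (x y : nat -> K) : (forall i, (i < r)%N -> x i = y i) ->
  creation r x = creation r y.
Proof.
elim: r x y => [|r IH] x y xy //=.
by rewrite (IH _ (fun i => y i.+1)) ?xy// => i ir; exact: xy.
Qed.

Lemma creation_linear r a x y :
  creation r (fun i => a * x i + y i) = a *: creation r x + creation r y.
Proof.
elim: r x y => [|r IH] x y /=; first by rewrite scaler0 addr0.
rewrite IH scale_block_mx add_block_mx scaler0 addr0 scale_scalar_mx -raddfD.
by rewrite scalerN opprD.
Qed.

Definition dirac_seq (i l : nat) : K := (l == i)%:R.

Lemma creation_sum r x :
  creation r x = \sum_(i < r) x i *: creation r (dirac_seq i).
Proof.
have lin (s : seq nat) : creation r (fun l => \sum_(i <- s) x i * dirac_seq i l) =
    \sum_(i <- s) x i *: creation r (dirac_seq i).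
  elim: s => [|i s IH].
    rewrite big_nil; have := creation_linear r 0 (fun=> 0) (fun=> 0).
    rewrite scale0r add0r => e; have := creation_linear r 1 (fun=> 0) (fun=> 0).
    rewrite scale1r mul1r addr0 => /eqP; rewrite addrC -subr_eq subrr => /eqP e0.
    by rewrite e0; apply: creation_eq => l _; rewrite big_nil.
  rewrite big_cons -IH -creation_linear; apply: creation_eq => l _.
  by rewrite big_cons.
rewrite -(big_mkord xpredT (fun i => x i *: creation r (dirac_seq i))) -lin.
apply: creation_eq => l lr.
rewrite (bigD1_seq l) ?mem_index_iota ?iota_uniq//= /dirac_seq eqxx mulr1.
by rewrite big1 ?addr0// => i /negbTE il; rewrite eq_sym il mulr0.
Qed.

Lemma cj_creation r x : (forall i, cj S (x i) = x i) ->
  map_mx (cj S) (creation r x) = creation r x.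
Proof.
elim: r x => [|r IH] x xr /=; first by rewrite map_mx0.
by rewrite map_block_mx map_mxN IH// map_scalar_mx xr map_mx0.
Qed.

(** By the anticommutation relation, |A z|^2 + |A^* z|^2 = |x|^2 |z|^2. *)
Lemma creation_bound r x (z : 'cV[K]_(fock_dim r)) :
  hsq S (creation r x *m z) <= (\sum_(i < r) nrm S (x i) ^+ 2) * hsq S z.
Proof.
set A := creation r x.
have : hsq S (A *m z) + hsq S (adj S A *m z) = (\sum_(i < r) nrm S (x i) ^+ 2) * hsq S z.
  apply: (ofR_inj (S := S)); apply: scalar_mx1_inj.
  rewrite rmorphD rmorphM raddfD /= -!adj_mul_self !adjM adjK -!mulmxA -mulmxDr.
  rewrite (mulmxA (adj S A)) (mulmxA A) -mulmxDl creation_car mul_scalar_mx.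
  by rewrite -scalemxAr adj_mul_self scale_scalar_mx.
by move=> <-; rewrite lerDl hsq_ge0.
Qed.

(** The slice [a i] is the creation operator of the i-th unit vector. [creation_bound] and
    Cauchy-Schwarz bound the form; the trace of the anticommutation relation gives each slice the
    sum of squares d / 2, its entries being self-conjugate. *)
Lemma fermionic_form r : exists d (a : 'I_r -> 'I_d -> 'I_d -> K),
  [/\ (0 < d)%N,
      forall x y z, nrm S (\sum_i \sum_j \sum_k a i j k * (x i * y j * z k)) ^+ 2 <=
        (\sum_i nrm S (x i) ^+ 2) * (\sum_j nrm S (y j) ^+ 2) *
        (\sum_k nrm S (z k) ^+ 2) &
      2 * \sum_i \sum_j \sum_k a i j k ^+ 2 = (r * d)%:R].
Proof.
exists (fock_dim r), (fun i => creation r (dirac_seq i)); split.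
- by elim: r => //= r IH; rewrite addn_gt0 IH.
- move=> x y z; pose x' l := oapp x 0 (insub l).
  have x'E (i : 'I_r) : x' i = x i by rewrite /x' valK.
  have -> : \sum_(i < r) \sum_j \sum_k creation r (dirac_seq i) j k * (x i * y j * z k) =
      \sum_j y j * (creation r x' *m \col_k z k) j ord0.
    rewrite exchange_big; apply: eq_bigr => j _ /=.
    rewrite creation_sum mulmx_suml summxE mulr_sumr; apply: eq_bigr => i _.
    rewrite -scalemxAl !mxE x'E !mulr_sumr; apply: eq_bigr => k _.
    by rewrite mxE; ring.
  apply: (@le_trans _ _ ((\sum_j nrm S (y j) *
      nrm S ((creation r x' *m \col_k z k) j ord0)) ^+ 2)).
    rewrite ler_pXn2r ?nnegrE ?nrm_ge0//; last first.
      by apply: sumr_ge0 => j _; rewrite mulr_ge0 ?nrm_ge0.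
    apply: le_trans (nrm_sum _ _ _ _) _.
    by under eq_bigr do rewrite nrmM.
  apply: le_trans (cauchy_schwarz _ _) _.
  rewrite mulrAC mulrC ler_wpM2r//; first by apply: sumr_ge0 => j _; rewrite sqr_ge0.
  have := creation_bound x' (\col_k z k); rewrite /hsq.
  under [X in _ <= _ * X]eq_bigr do rewrite mxE.
  by under [X in _ <= X * _]eq_bigr do rewrite x'E.
- have one (i : 'I_r) : 2 * \sum_j \sum_k creation r (dirac_seq i) j k ^+ 2 = (fock_dim r)%:R.
    have := congr1 mxtrace (creation_car r (dirac_seq i)).
    rewrite mxtraceD mxtrace_mulC -mulr2n mxtrace_scalar.
    rewrite (bigD1 i)//= /dirac_seq eqxx nrm1 expr1n big1 ?addr0; last first.
      by move=> j; rewrite -val_eqE /= => /negbTE ->; rewrite nrm0 expr0n.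
    rewrite rmorph1 => <-; rewrite mulr_natl; congr (_ *+ 2).
    have di l : cj S (dirac_seq i l) = dirac_seq i l by rewrite /dirac_seq rmorph_nat.
    rewrite /mxtrace; apply: eq_bigr => j _; rewrite mxE; apply: eq_bigr => k _.
    have /matrixP/(_ j k) := cj_creation r di; rewrite mxE => cA.
    by rewrite [adj _ _ _ _]mxE [_^T _ _]mxE cA expr2.
  rewrite mulr_sumr (eq_bigr _ (fun i _ => one i)) sumr_const card_ord.
  by rewrite natrM mulr_natl.
Qed.

End creation.

(** * Symmetrisation by signs *)

Lemma monomials_multilinear (K : numFieldType) n (J : Type) (T : finType)
    (a : T -> K) (idx : T -> 'I_n -> J) :
  multilinear (fun X : 'I_n -> (J -> K^o) => \sum_t a t * \prod_l X l (idx t l)).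
Proof.
move=> X i b u v; rewrite mulr_sumr -big_split; apply: eq_bigr => t _ /=.
have dfE w : \prod_l dfwith X i w l (idx t l) =
             w (idx t i) * \prod_(l | l != i) X l (idx t l).
  rewrite (bigD1 i)//= dfwithin; congr (_ * _).
  by apply: eq_bigr => l li; rewrite dfwithout// eq_sym.
by rewrite !dfE mulrDl mulrDr; congr (_ + _); rewrite -mulrA mulrCA.
Qed.

(** The coefficients that survive in (X + Y)^n - (X - Y)^n; even powers of Y cancel. *)
Definition sign_weight n i : nat := if odd i then 'C(n, i).*2 else 0.

Lemma sum_sign_expr (A : comNzRingType) (X Y : A) n :
  \sum_(b : bool) (-1) ^+ b * (X + (-1) ^+ b * Y) ^+ n =
  \sum_(i < n.+1) (sign_weight n i)%:R * (X ^+ (n - i) * Y ^+ i).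
Proof.
under eq_bigr do rewrite exprDn mulr_sumr.
rewrite exchange_big; apply: eq_bigr => i _ /=.
rewrite big_bool expr0 expr1 !mul1r exprMn /sign_weight.
move: (X ^+ (n - i)) (Y ^+ i) ('C(n, i)) => x y k.
rewrite -(signr_odd _ i); case: (odd i) => /=.
  by rewrite expr1 !mulN1r mulrN mulNrn opprK -mulrnDr addnn mulr_natl.
by rewrite expr0 mul1r mulN1r addNr mul0r.
Qed.

(** The weights are at most ['C(n, i).*2], of total 2^(n + 1). The larger exponent [N] lets nested
    sums of different lengths share one bound. *)
Lemma sign_weight_sum (R : realType) (K : numFieldType) (S : scalars R K) n N
    (Z : nat -> K) (M : R) : (n <= N)%N -> 0 <= M ->
  (forall i, odd i -> nrm S (Z i) <= M) ->
  nrm S (\sum_(i < n.+1) (sign_weight n i)%:R * Z i) <= 2 ^+ N.+1 * M.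
Proof.
move=> nN M0 ZM; apply: (@le_trans _ _ (\sum_(i < n.+1) ('C(n, i).*2)%:R * M)).
  apply: le_trans (nrm_sum _ _ _ _) _; apply: ler_sum => i _.
  rewrite nrmM -(rmorph_nat (ofR S)) nrm_ofR_ge0 ?ler0n// /sign_weight.
  case: ifP => [/ZM h|_]; last by rewrite mul0r mulr_ge0.
  by rewrite ler_wpM2l ?ler0n.
rewrite -mulr_suml ler_wpM2r// -natr_sum.
have -> : (\sum_(i < n.+1) 'C(n, i).*2 = 2 ^ n.+1)%N.
  under eq_bigr do rewrite -muln2.
  rewrite -big_distrl /= expnS mulnC; congr (_ * _)%N.
  by rewrite -[in RHS](addn1 1) Pascal; apply: eq_bigr => i _; rewrite !exp1n !muln1.
by rewrite natrX ler_weXn2l// ler1n.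
Qed.

Lemma sum_sign_expr2 (A : comNzRingType) (s t V : A) n :
  \sum_(b2 : bool) (-1) ^+ b2 * \sum_(b1 : bool) (-1) ^+ b1 *
    (V + (-1) ^+ b2 * t + (-1) ^+ b1 * s) ^+ n =
  \sum_(i < n.+1) \sum_(j < (n - i).+1) (sign_weight n i)%:R *
    ((sign_weight (n - i) j)%:R * (s ^+ i * t ^+ j)) * V ^+ (n - i - j).
Proof.
transitivity (\sum_(b2 : bool) \sum_(i < n.+1) (sign_weight n i)%:R * s ^+ i *
    ((-1) ^+ b2 * (V + (-1) ^+ b2 * t) ^+ (n - i))).
  apply: eq_bigr => b _; rewrite sum_sign_expr mulr_sumr; apply: eq_bigr => i _.
  ring.
rewrite exchange_big; apply: eq_bigr => i _ /=.
rewrite -mulr_sumr sum_sign_expr mulr_sumr; apply: eq_bigr => j _ /=.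
ring.
Qed.

(** Only monomials odd in each of s, t and u remain, so each of the three variables really occurs; v
    fills up the degree. *)
Lemma sum_sign_cube (A : comNzRingType) (s t u v : A) n :
  \sum_(b : bool * bool * bool) (-1) ^+ b.1.1 * (-1) ^+ b.1.2 * (-1) ^+ b.2 *
    ((-1) ^+ b.1.1 * s + (-1) ^+ b.1.2 * t + (-1) ^+ b.2 * u + v) ^+ n =
  \sum_(i < n.+1) \sum_(j < (n - i).+1) \sum_(k < (n - i - j).+1)
    (sign_weight n i)%:R * ((sign_weight (n - i) j)%:R *
    ((sign_weight (n - i - j) k)%:R * (v ^+ (n - i - j - k) *
    (s ^+ i * t ^+ j * u ^+ k)))).
Proof.
pose F b1 b2 b3 : A := (-1) ^+ nat_of_bool b1 *
    (-1) ^+ nat_of_bool b2 * (-1) ^+ nat_of_bool b3 *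
    ((-1) ^+ b1 * s + (-1) ^+ b2 * t + (-1) ^+ b3 * u + v) ^+ n.
transitivity (\sum_(b : bool * bool * bool) F b.1.1 b.1.2 b.2); first by [].
have -> : \sum_(b : bool * bool * bool) F b.1.1 b.1.2 b.2 =
    \sum_(b1 : bool) \sum_(b2 : bool) \sum_(b3 : bool) F b1 b2 b3.
  by rewrite pair_bigA /= pair_bigA /=; apply: eq_bigr.
transitivity (\sum_(b3 : bool) (-1) ^+ b3 * \sum_(b2 : bool) (-1) ^+ b2 *
    \sum_(b1 : bool) (-1) ^+ b1 *
    (v + (-1) ^+ b3 * u + (-1) ^+ b2 * t + (-1) ^+ b1 * s) ^+ n).
  rewrite pair_bigA exchange_big /=; apply: eq_bigr => b3 _.
  rewrite -(pair_bigA _ (fun b1 b2 => F b1 b2 b3)) exchange_big mulr_sumr.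
  apply: eq_bigr => b2 _; rewrite !mulr_sumr; apply: eq_bigr => b1 _.
  rewrite /F; have -> : (-1) ^+ b1 * s + (-1) ^+ b2 * t + (-1) ^+ b3 * u + v =
    v + (-1) ^+ b3 * u + (-1) ^+ b2 * t + (-1) ^+ b1 * s.
    by move: (_ * s) (_ * t) (_ * u) => x y z; ring.
  by move: (_ ^+ n) => x; ring.
transitivity (\sum_(b3 : bool) \sum_(i < n.+1) \sum_(j < (n - i).+1) (sign_weight n i)%:R *
    ((sign_weight (n - i) j)%:R * (s ^+ i * t ^+ j)) *
    ((-1) ^+ b3 * (v + (-1) ^+ b3 * u) ^+ (n - i - j))).
  apply: eq_bigr => b3 _; rewrite sum_sign_expr2 mulr_sumr; apply: eq_bigr => i _.
  by rewrite mulr_sumr; apply: eq_bigr => j _; rewrite mulrCA.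
rewrite exchange_big; apply: eq_bigr => i _ /=.
rewrite exchange_big; apply: eq_bigr => j _ /=.
rewrite -mulr_sumr sum_sign_expr mulr_sumr; apply: eq_bigr => k _ /=.
ring.
Qed.

Section test_tensor.
Variables (R : realType) (K : numFieldType) (S : scalars R K).

(** The symmetric tensor over K^J with summands p.1 * p.2^n, evaluated at the n-th power of the
    functional [g]. Its supremum over the sup-norm ball is an injective norm over ell_1 J. *)
Definition power_sum n (J : finType) (s : seq (K * (J -> K))) (g : J -> K) : K :=
  \sum_(p <- s) p.1 * (\sum_j p.2 j * g j) ^+ n.

Section signs.
Variables (T : finType) (a : T -> K) (n : nat).

(** One factor 2^(n + 1) for each of the three signs. *)
Lemma sign_cube_bound (s t u : T -> K) (v : K) (M : R) : nrm S v <= 1 -> 0 <= M ->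
  (forall i j k, odd i -> odd j -> odd k ->
    nrm S (\sum_x a x * (s x ^+ i * t x ^+ j * u x ^+ k)) <= M) ->
  nrm S (\sum_x \sum_(b : bool * bool * bool)
    (-1) ^+ b.1.1 * (-1) ^+ b.1.2 * (-1) ^+ b.2 * a x *
    ((-1) ^+ b.1.1 * s x + (-1) ^+ b.1.2 * t x + (-1) ^+ b.2 * u x + v) ^+ n)
  <= (2 ^+ n.+1) ^+ 3 * M.
Proof.
move=> v1 M0 aM; have M1 : 0 <= 2 ^+ n.+1 * M by rewrite mulr_ge0// exprn_ge0.
pose Z3 (m i j k : nat) := v ^+ (m - k) * \sum_x a x * (s x ^+ i * t x ^+ j * u x ^+ k).
pose Z2 m i j := \sum_(k < (m - j).+1) (sign_weight (m - j) k)%:R * Z3 (m - j)%N i j k.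
pose Z1 i := \sum_(j < (n - i).+1) (sign_weight (n - i) j)%:R * Z2 (n - i)%N i j.
have -> : \sum_x \sum_(b : bool * bool * bool)
    (-1) ^+ b.1.1 * (-1) ^+ b.1.2 * (-1) ^+ b.2 * a x *
    ((-1) ^+ b.1.1 * s x + (-1) ^+ b.1.2 * t x + (-1) ^+ b.2 * u x + v) ^+ n =
    \sum_(i < n.+1) (sign_weight n i)%:R * Z1 i.
  have E x : \sum_(b : bool * bool * bool)
      (-1) ^+ b.1.1 * (-1) ^+ b.1.2 * (-1) ^+ b.2 * a x *
      ((-1) ^+ b.1.1 * s x + (-1) ^+ b.1.2 * t x + (-1) ^+ b.2 * u x + v) ^+ n =
    \sum_(i < n.+1) \sum_(j < (n - i).+1) \sum_(k < (n - i - j).+1)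
      (sign_weight n i)%:R * ((sign_weight (n - i) j)%:R *
      ((sign_weight (n - i - j) k)%:R * (v ^+ (n - i - j - k) *
      (a x * (s x ^+ i * t x ^+ j * u x ^+ k))))).
    under eq_bigr do rewrite mulrAC.
    rewrite -mulr_suml sum_sign_cube mulr_suml; apply: eq_bigr => i _.
    rewrite mulr_suml; apply: eq_bigr => j _; rewrite mulr_suml.
    by apply: eq_bigr => k _; ring.
  under eq_bigr do rewrite E.
  rewrite exchange_big; apply: eq_bigr => i _ /=.
  rewrite exchange_big mulr_sumr; apply: eq_bigr => j _ /=.
  rewrite exchange_big !mulr_sumr; apply: eq_bigr => k _ /=.
  by rewrite /Z3 !mulr_sumr.
rewrite exprSr expr2 -!mulrA; apply: sign_weight_sum => //.
  by rewrite !mulr_ge0 ?exprn_ge0.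
move=> i io; apply: sign_weight_sum => //; first exact: leq_subr.
move=> j jo; apply: sign_weight_sum => //.
  by apply: leq_trans (leq_subr _ _) _; exact: leq_subr.
move=> k ko; rewrite nrmM nrmX; apply: le_trans (aM i j k io jo ko).
by rewrite ler_piMl ?nrm_ge0// exprn_ile1 ?nrm_ge0.
Qed.

End signs.

Lemma nrm_expr_le (x : K) i : odd i -> nrm S x <= 1 -> nrm S (x ^+ i) <= nrm S x.
Proof.
by case: i => // i _ x1; rewrite nrmX exprS ler_piMr ?nrm_ge0// exprn_ile1 ?nrm_ge0.
Qed.

Lemma sum_sqr_inj (I J : finType) (h : I -> J) (F : J -> R) :
  injective h -> (forall j, 0 <= F j) -> \sum_i F (h i) <= \sum_j F j.
Proof.
move=> hi F0; rewrite -(big_imset F (in2W hi)) [leRHS](bigID (mem (h @: I)))/=.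
by rewrite lerDl sumr_ge0.
Qed.

(* The tensor [P] and the form [Q] are both made of the fermionic trilinear
   form: [P] is small in the injective norm over Hilbert space, [Q] is small on
   the sup-norm ball, and they pair to something much larger than the product. *)
Lemma test_tensor n q : (3 <= n)%N -> exists m (P : seq (K * ('I_m -> K)))
    (Q : mlform n ('I_m -> K^o)) d, (0 < d)%N /\
  [/\ forall g, \sum_i nrm S (g i) ^+ 2 <= 1 ->
        nrm S (power_sum n P g) <= (2 ^+ n.+1) ^+ 3,
      forall g, (forall i, nrm S (g i) <= 1) ->
        nrm S (power_sum n P g) <= (2 ^+ n.+1) ^+ 3 * (q * d)%:R,
      forall g, \sum_i nrm S (g i) ^+ 2 <= 1 -> nrm S (Q (fun=> g)) <= 1,
      forall g, (forall i, nrm S (g i) <= 1) -> nrm S (Q (fun=> g)) <= (q * d)%:R &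
      \sum_(p <- P) p.1 * Q (fun=> p.2) = (4 * (q * q) * d)%:R].
Proof.
case: n => [|[|[|n]]]// _.
have [d [a0 [d0 a0b a0s]]] := fermionic_form S (q * q).
pose T := ('I_(q * q) * 'I_d * 'I_d)%type.
pose a (t : T) := a0 t.1.1 t.1.2 t.2.
have sumT (V : nmodType) (F : 'I_(q * q) -> 'I_d -> 'I_d -> V) :
    \sum_i \sum_j \sum_k F i j k = \sum_(t : T) F t.1.1 t.1.2 t.2.
  rewrite pair_bigA /= pair_bigA /=; exact: eq_bigr.
have ab (x : 'I_(q * q) -> K) (y z : 'I_d -> K) :
    nrm S (\sum_t a t * (x t.1.1 * y t.1.2 * z t.2)) ^+ 2 <=
    (\sum_i nrm S (x i) ^+ 2) * (\sum_j nrm S (y j) ^+ 2) * (\sum_k nrm S (z k) ^+ 2).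
  by have := a0b x y z; rewrite sumT.
have as2 : 2 * \sum_t a t ^+ 2 = (q * q * d)%:R by rewrite -a0s sumT.
(* One block of coordinates for each argument of the trilinear form, and a single coordinate, [vi],
   to raise the degree from 3 to n. *)
pose J := (('I_(q * q) + 'I_d) + ('I_d + unit))%type.
pose m := #|{: J}|; pose e (j : J) : 'I_m := enum_rank j.
have ei : injective e by exact: enum_rank_inj.
pose si i := e (inl (inl i)); pose ti i := e (inl (inr i)).
pose ui i := e (inr (inl i)); pose vi := e (inr (inr tt)).
pose idx (t : T) (l : 'I_n.+3) : 'I_m :=
  match val l with 0 => si t.1.1 | 1 => ti t.1.2 | 2 => ui t.2 | _ => vi end.
pose Q := MLForm (monomials_multilinear a idx).
have QE g : Q (fun=> g) =
    \sum_t a t * (g (si t.1.1) * g (ti t.1.2) * g (ui t.2) * g vi ^+ n).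
  rewrite /=; apply: eq_bigr => t _; congr (_ * _).
  rewrite !big_ord_recl /= (eq_bigr (fun=> g vi)) => [|i _]; last by [].
  by rewrite prodr_const card_ord !mulrA.
(* For each monomial of the form, the n-th powers of e_s, e_t, e_u with all signs, plus e_v, are
   summed with the product of the signs as weight. *)
pose c (p : T * (bool * bool * bool)) (j : 'I_m) : K :=
  (-1) ^+ p.2.1.1 * (j == si p.1.1.1)%:R + (-1) ^+ p.2.1.2 * (j == ti p.1.1.2)%:R +
  (-1) ^+ p.2.2 * (j == ui p.1.2)%:R + (j == vi)%:R.
pose w (p : T * (bool * bool * bool)) : K :=
  (-1) ^+ p.2.1.1 * (-1) ^+ p.2.1.2 * (-1) ^+ p.2.2 * a p.1.
pose P := [seq (w p, c p) | p <- index_enum (T * (bool * bool * bool))%type].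
have PE g : power_sum n.+3 P g = \sum_t \sum_(b : bool * bool * bool)
    (-1) ^+ b.1.1 * (-1) ^+ b.1.2 * (-1) ^+ b.2 * a t *
    ((-1) ^+ b.1.1 * g (si t.1.1) + (-1) ^+ b.1.2 * g (ti t.1.2) +
     (-1) ^+ b.2 * g (ui t.2) + g vi) ^+ n.+3.
  rewrite /power_sum big_map -(pair_bigA _ (fun t b => w (t, b) *
    (\sum_j c (t, b) j * g j) ^+ n.+3)); apply: eq_bigr => t _; apply: eq_bigr => b _.
  congr (_ * _ ^+ _); rewrite /c /=.
  under eq_bigr do rewrite !mulrDl -!mulrA.
  have del (k : 'I_m) : \sum_j (j == k)%:R * g j = g k.
    rewrite (bigD1 k)//= eqxx mul1r big1 ?addr0// => j /negbTE ->.
    by rewrite mul0r.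
  by rewrite !big_split /= -!mulr_sumr !del.
have l2_sub (I : finType) (h : I -> 'I_m) g : injective h ->
    \sum_i nrm S (g i) ^+ 2 <= 1 -> \sum_i nrm S (g (h i)) ^+ 2 <= 1.
  move=> hi; apply: le_trans.
  by apply: (sum_sqr_inj (F := fun j => nrm S (g j) ^+ 2)) => // j; rewrite sqr_ge0.
have le1 (I : finType) (g : I -> K) :
    \sum_i nrm S (g i) ^+ 2 <= 1 -> forall j, nrm S (g j) <= 1.
  move=> g1 j; rewrite -(expr_le1 (n := 2)) ?nrm_ge0//; apply: le_trans g1.
  by rewrite (bigD1 j)//= lerDl sumr_ge0// => k _; rewrite sqr_ge0.
have sij : injective si by move=> i j /ei [].
have tij : injective ti by move=> i j /ei [].
have uij : injective ui by move=> i j /ei [].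
have sq0 (I : finType) (x : I -> K) : 0 <= \sum_i nrm S (x i) ^+ 2.
  by apply: sumr_ge0 => i _; rewrite sqr_ge0.
have hil (x : 'I_(q * q) -> K) (y z : 'I_d -> K) :
    \sum_i nrm S (x i) ^+ 2 <= 1 -> \sum_i nrm S (y i) ^+ 2 <= 1 ->
    \sum_i nrm S (z i) ^+ 2 <= 1 ->
    nrm S (\sum_t a t * (x t.1.1 * y t.1.2 * z t.2)) <= 1.
  move=> x1 y1 z1; rewrite -(expr_le1 (n := 2)) ?nrm_ge0//.
  by apply: le_trans (ab x y z) _; rewrite mulr_ile1 ?mulr_ge0// mulr_ile1.
(* The three sums of squares are at most q * q, d and d, and q * d is the root of their product. *)
have sup (x : 'I_(q * q) -> K) (y z : 'I_d -> K) :
    (forall i, nrm S (x i) <= 1) -> (forall i, nrm S (y i) <= 1) ->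
    (forall i, nrm S (z i) <= 1) ->
    nrm S (\sum_t a t * (x t.1.1 * y t.1.2 * z t.2)) <= (q * d)%:R.
  move=> x1 y1 z1.
  have card k (f : 'I_k -> K) : (forall i, nrm S (f i) <= 1) ->
      \sum_i nrm S (f i) ^+ 2 <= k%:R.
    move=> f1; rewrite -[k in k%:R]card_ord -sumr_const; apply: ler_sum => i _.
    by rewrite expr_le1 ?nrm_ge0.
  rewrite -(ler_pXn2r (n := 2))// ?nnegrE ?nrm_ge0//.
  apply: le_trans (ab x y z) _.
  have -> : ((q * d)%:R : R) ^+ 2 = (q * q)%:R * d%:R * d%:R by rewrite !natrM; ring.
  by apply: ler_pM; rewrite ?mulr_ge0 ?card//; apply: ler_pM; rewrite ?card.
(* Odd powers of the coordinates stay in the sup-norm ball and, by [odd_l2], in the Hilbert ball; so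
   the form bounds also the terms of higher degree in s, t, u. *)
have odd_le (x : K) i : odd i -> nrm S x <= 1 -> nrm S (x ^+ i) <= 1.
  by move=> io x1; apply: le_trans (nrm_expr_le io x1) _.
have odd_l2 (I : finType) (x : I -> K) i : odd i -> \sum_k nrm S (x k) ^+ 2 <= 1 ->
    \sum_k nrm S (x k ^+ i) ^+ 2 <= 1.
  move=> io x1; have xk := le1 _ _ x1.
  apply: le_trans x1; apply: ler_sum => k _.
  apply: lerXn2r; rewrite ?nnegrE ?nrm_ge0//.
  by apply: nrm_expr_le => //; exact: xk.
exists m, P, Q, d; split=> //; split=> [g g1|g g1|g g1|g g1|].
- rewrite PE -[leRHS]mulr1; apply: sign_cube_bound => //; first exact: le1.
  move=> i j k io jo ko.
  apply: (hil (fun x => g (si x) ^+ i) (fun x => g (ti x) ^+ j)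
    (fun x => g (ui x) ^+ k)); apply: odd_l2 => //; exact: l2_sub.
- rewrite PE; apply: sign_cube_bound => // i j k io jo ko.
  by apply: (sup (fun x => g (si x) ^+ i) (fun x => g (ti x) ^+ j)
    (fun x => g (ui x) ^+ k)) => x; exact: odd_le.
- rewrite QE; under eq_bigr do rewrite mulrA; rewrite -mulr_suml nrmM nrmX.
  rewrite mulr_ile1 ?nrm_ge0 ?exprn_ge0 ?nrm_ge0//.
    by apply: (hil (fun i => g (si i)) (fun i => g (ti i)) (fun i => g (ui i)));
      exact: l2_sub.
  by rewrite exprn_ile1 ?nrm_ge0 ?le1.
- rewrite QE; under eq_bigr do rewrite mulrA; rewrite -mulr_suml nrmM nrmX.
  apply: (@le_trans _ _ ((q * d)%:R * 1)); last by rewrite mulr1.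
  rewrite ler_pM ?nrm_ge0 ?exprn_ge0 ?nrm_ge0//.
    by apply: (sup (fun i => g (si i)) (fun i => g (ti i)) (fun i => g (ui i))).
  by rewrite exprn_ile1 ?nrm_ge0.
- have eE i j : (e i == e j) = (i == j) by exact: inj_eq.
  rewrite big_map -(pair_bigA _ (fun t b => w (t, b) * Q (fun=> c (t, b)))) /=.
  (* Each of the 8 sign patterns contributes the sum of squares q * q * d / 2. *)
  have -> : (4 * (q * q) * d)%:R = \sum_t a t ^+ 2 * 8 :> K.
    rewrite -mulr_suml; have -> : (4 * (q * q) * d)%:R = (q * q * d)%:R * 4 :> K.
      by rewrite !natrM; ring.
    by rewrite -as2; ring.
  apply: eq_bigr => t _.
  rewrite (eq_bigr (fun=> a t ^+ 2)) => [|b _].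
    by rewrite sumr_const !card_prod card_bool mulr_natr.
  transitivity (w (t, b) * Q (fun=> c (t, b))); first by [].
  have -> : Q (fun=> c (t, b)) = (-1) ^+ b.1.1 * (-1) ^+ b.1.2 * (-1) ^+ b.2 * a t.
    have cs i : c (t, b) (si i) = (-1) ^+ b.1.1 * (i == t.1.1)%:R.
      by rewrite /c /si !eE /= ?eqE /= !(mulr0, addr0).
    have ct i : c (t, b) (ti i) = (-1) ^+ b.1.2 * (i == t.1.2)%:R.
      by rewrite /c /ti !eE /= ?eqE /= !(mulr0, addr0, add0r).
    have cu i : c (t, b) (ui i) = (-1) ^+ b.2 * (i == t.2)%:R.
      by rewrite /c /ui !eE /= ?eqE /= !(mulr0, addr0, add0r).
    have cv : c (t, b) vi = 1.
      by rewrite /c /vi !eE /= ?eqE /= !(mulr0, addr0, add0r).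
    rewrite QE (bigD1 t)//= big1 ?addr0 => [|t' t't].
      by rewrite cs ct cu cv !eqxx expr1n !mulr1 mulrC.
    rewrite cs ct cu; move: t't; rewrite -pair_eqE /pair_eq -pair_eqE /pair_eq /=.
    by move=> /nandP[/nandP[]|] /negbTE ->; rewrite !(mulr0, mul0r).
  rewrite /w /=.
  have sg (b' : bool) : (-1 : K) ^+ b' * (-1) ^+ b' = 1 by rewrite -expr2 sqrr_sign.
  transitivity (((-1) ^+ b.1.1 * (-1) ^+ b.1.1) * ((-1) ^+ b.1.2 * (-1) ^+ b.1.2) *
     ((-1) ^+ b.2 * (-1) ^+ b.2) * a t ^+ 2); first by ring.
  by rewrite !sg !mul1r.
Qed.

End test_tensor.

(** * Symmetric tensors and the extreme norms *)

Section order_in_K.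
Variables (R : realType) (K : numFieldType) (S : scalars R K).

(** Whatever lies below a real element of K is real, so lower bounds in K are compared within R. *)
Lemma infimums_ofR (A : set K) : A !=set0 -> (forall a, A a -> 0 <= a) ->
  infimums A (ofR S (inf (re S @` A))).
Proof.
move=> [a0 Aa0] A0.
have lb : has_inf (re S @` A).
  split; first by exists (re S a0), a0.
  by exists 0 => _ [a Aa <-]; apply: re_ge0; exact: A0.
split=> [a Aa|l ll].
  rewrite (ge0_ofR S (A0 _ Aa)) le_ofR.
  by apply: (inf_lbound lb.2); exists a.
have la0 := ll _ Aa0.
have lE : l = ofR S (re S a0 - re S (a0 - l)).
  rewrite rmorphB -(ge0_ofR S (A0 _ Aa0)) -ge0_ofR ?subr_ge0//; ring.
rewrite lE le_ofR; apply: lb_le_inf; first by case: lb.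
move=> _ [a Aa <-]; rewrite -(le_ofR S) -lE -(ge0_ofR S (A0 _ Aa)).
exact: ll.
Qed.

Lemma infimum_ofR (A : set K) : A !=set0 -> (forall a, A a -> 0 <= a) ->
  infimums A (infimum 0 A).
Proof.
move=> A0 Age; rewrite /infimum ifF; last first.
  by apply/negP => /eqP A00; case: A0 => x; rewrite A00.
by case: xgetP => // /(_ _ (infimums_ofR A0 Age)).
Qed.

(** The condition 0 <= M covers the default value 0, taken when there is no supremum. *)
Lemma supremum_le (A : set K) M : 0 <= M -> (forall a, A a -> a <= M) ->
  supremum 0 A <= M.
Proof.
move=> M0 AM; rewrite /supremum; case: ifPn => // _.
by case: xgetP => // x _ [_ lx]; exact: lx.
Qed.

End order_in_K.

Section tensor_facts.
Variables (R : realType) (K : numFieldType) (S : scalars R K) (n : nat).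

Definition tsum (E : lmodType K) (s : seq (K * E)) : symtensor n E :=
  \sum_(p <- s) p.1 *: tpow n p.2.

Lemma symval_sum (E : lmodType K) (I : Type) (s : seq I) (F : I -> symtensor n E) phi :
  symval (\sum_(i <- s) F i) phi = \sum_(i <- s) symval (F i) phi.
Proof. by elim/big_ind2 : _ => // x a y b <- <-. Qed.

Lemma symval_tsum (E : lmodType K) (s : seq (K * E)) (phi : mlform n E) :
  symval (tsum s) phi = \sum_(p <- s) p.1 * phi (fun=> p.2).
Proof. by rewrite symval_sum. Qed.

Lemma symtensor_ext (E : lmodType K) (z w : symtensor n E) :
  (forall phi, symval z phi = symval w phi) -> z = w.
Proof. by move=> zw; apply/val_inj/funext. Qed.

Lemma tsumP (E : lmodType K) (z : symtensor n E) : exists s, z = tsum s.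
Proof.
have /asboolP[s zs] := symvalP z; exists s; apply: symtensor_ext => phi.
by rewrite symval_tsum zs fct_sumE.
Qed.

Lemma tmap_tsum (E F : lmodType K) (T : {linear E -> F}) (s : seq (K * E)) :
  tmap T (tsum s) = tsum [seq (p.1, T p.2) | p <- s].
Proof.
rewrite /tsum big_map linear_sum; apply: eq_bigr => p _ /=.
by rewrite linearZ /= tmap_tpow.
Qed.

Lemma tsum_cat (E : lmodType K) (s t : seq (K * E)) : tsum (s ++ t) = tsum s + tsum t.
Proof. exact: big_cat. Qed.

Lemma tsumZ (E : lmodType K) a (s : seq (K * E)) :
  tsum [seq (a * p.1, p.2) | p <- s] = a *: tsum s.
Proof.
by rewrite /tsum big_map scaler_sumr; apply: eq_bigr => p _; rewrite scalerA.
Qed.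

Lemma eps_norm_le (E : completeNormedModType K) (z : symtensor n E) M : 0 <= M ->
  (forall f : {linear E -> K^o}, (forall x, `|f x| <= `|x|) ->
    `|symval z (mlprod n f)| <= M) -> eps_norm K n E z <= M.
Proof. by move=> M0 h; apply: supremum_le => // _ [f ff <-]; exact: h. Qed.

Lemma pi_norm_ge (E : completeNormedModType K) (z : symtensor n E) l :
  (forall s, z = tsum s -> l <= \sum_(p <- s) `|p.1| * `|p.2| ^+ n) ->
  l <= pi_norm K n E z.
Proof.
move=> h; have [s zs] := tsumP z.
set A := [set \sum_(p <- s) `|p.1| * `|p.2| ^+ n
            | s in [set s : seq (K * E) | z = \sum_(p <- s) p.1 *: tpow n p.2]].
have [||_ ub] := @infimum_ofR _ _ S A.
- by exists (\sum_(p <- s) `|p.1| * `|p.2| ^+ n), s.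
- by move=> _ [t _ <-]; apply: sumr_ge0 => p _; rewrite mulr_ge0// exprn_ge0.
by apply: ub => _ [t zt <-]; exact: h.
Qed.

Section opnorm.
Variables (E F : normedModType K) (T : {linear E -> F}).

Let bounds : set K := [set M : K | 0 <= M /\ forall x : E, `|T x| <= M * `|x|].

Lemma opnormP : continuous T -> 0 <= opnorm T /\ forall x, `|T x| <= opnorm T * `|x|.
Proof.
move=> Tc.
have [r r0 Tr] : exists2 r, r > 0 & forall x, `|T x| <= r * `|x|.
  have /linear_boundedP/pinfty_ex_gt0[r r0 Tr] := continuous_linear_bounded 0 (Tc 0).
  by exists r.
have [||lb ub] := @infimum_ofR _ _ S bounds.
- by exists r; split=> //; exact: ltW.
- by move=> ? [].
split=> [|x]; first by apply: ub => ? [].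
have [->|x0] := eqVneq x 0; first by rewrite linear0 !normr0 mulr0.
have xp : 0 < `|x| by rewrite normr_gt0.
by rewrite -ler_pdivrMr//; apply: ub => M [_ TM]; rewrite ler_pdivrMr.
Qed.

End opnorm.

End tensor_facts.

(** * Lower bounds for the injective hull of pi *)

Section multilinear_forms.
Variables (K : numFieldType) (n : nat).

Lemma mlform_ext (E : lmodType K) (phi psi : mlform n E) :
  (forall x, phi x = psi x) -> phi = psi.
Proof.
case: phi psi => [f fP] [g gP] /= /funext fg; subst g.
by rewrite (Prop_irrelevance fP gP).
Qed.

Lemma mlform_scale (E : lmodType K) (phi : mlform n E) a (x : E) :
  phi (fun=> a *: x) = a ^+ n * phi (fun=> x).
Proof.
have phi0 X i : phi (dfwith X i 0) = 0.
  have := mlvalP phi X i (-1) 0 0; rewrite scaler0 addr0 => {1}->.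
  by rewrite mulN1r addNr.
pose X k (i : 'I_n) := if (i < k)%N then a *: x else x.
suff h k : (k <= n)%N -> phi (X k) = a ^+ k * phi (fun=> x).
  rewrite -h//; congr (phi _); apply/funext => i; by rewrite /X ltn_ord.
elim: k => [_|k IH kn].
  by rewrite expr0 mul1r; congr (phi _); apply/funext.
have XS : X k.+1 = dfwith (X k) (Ordinal kn) (a *: x + 0).
  apply/funext => i; have [->|ik] := eqVneq i (Ordinal kn).
    by rewrite dfwithin addr0 /X /= ltnSn.
  rewrite dfwithout 1?eq_sym// /X ltnS leq_eqVlt.
  by have /negbTE -> : (i : nat) != k by [].
have Xk : dfwith (X k) (Ordinal kn) x = X k.
  apply/funext => i; have [->|ik] := eqVneq i (Ordinal kn).
    by rewrite dfwithin /X /= ltnn.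
  by rewrite dfwithout// eq_sym.
by rewrite XS mlvalP phi0 addr0 Xk IH ?exprS ?mulrA// ltnW.
Qed.

Lemma mlpull_scale (E F : lmodType K) (T T' : {linear E -> F}) (phi : mlform n F)
    a (z : symtensor n E) : (forall x, T x = a *: T' x) ->
  symval z (mlpull T phi) = a ^+ n * symval z (mlpull T' phi).
Proof.
move=> TT'; have [s ->] := tsumP z; rewrite !symval_tsum mulr_sumr.
apply: eq_bigr => p _; rewrite mulrCA; congr (_ * _) => /=.
have -> : T \o (fun=> p.2) = (fun=> a *: T' p.2) :> ('I_n -> F).
  by apply/funext => i /=.
exact: mlform_scale.
Qed.

Lemma mlpull_comp (E F G : lmodType K) (T : {linear F -> G}) (I : {linear E -> F})
    (phi : mlform n G) (z : symtensor n E) :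
  symval (tmap I z) (mlpull T phi) = symval z (mlpull (T \o I) phi).
Proof. by congr (symval z _); exact: mlform_ext. Qed.

End multilinear_forms.

Section form_norm.
Variables (R : realType) (K : numFieldType) (S : scalars R K) (n : nat).
Variables (J : Type) (Q : mlform n (J -> K^o)) (B : R).
Hypothesis B0 : 0 < B.
Hypothesis QB : forall y : J -> K^o, (forall j, nrm S (y j : K) <= 1) ->
  nrm S (Q (fun=> y)) <= B.

Lemma form_bound (y : J -> K^o) M : 0 <= M -> (forall j, nrm S (y j : K) <= M) ->
  nrm S (Q (fun=> y)) <= B * M ^+ n.
Proof.
move=> M0 yM.
have yE : y = ofR S M *: (ofR S M^-1 *: y).
  rewrite scalerA -rmorphM; have [M00|M00] := eqVneq M 0; last first.
    by rewrite divff// rmorph1 scale1r.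
  rewrite M00 mul0r rmorph0 scale0r; apply/funext => j.
  apply: (nrm0_eq0 (S := S)); apply/eqP; rewrite eq_le nrm_ge0 andbT.
  by apply: le_trans (yM j) _; rewrite M00.
rewrite {1}yE mlform_scale nrmM nrmX nrm_ofR_ge0// mulrC ler_wpM2r ?exprn_ge0//.
apply: QB => j; rewrite [(_ *: y) j]/(ofR S M^-1 * y j) nrmM nrm_ofR_ge0 ?invr_ge0//.
have [->|M00] := eqVneq M 0; first by rewrite invr0 mul0r.
by rewrite mulrC ler_pdivrMr ?mul1r// lt_def M00.
Qed.

(** A contraction into ell_infty J. The function space itself carries no norm here; the bound is
    imposed on coordinates. *)
Definition contractive (E : normedModType K) (Phi : {linear E -> (J -> K^o)}) :=
  forall x j, nrm S (Phi x j : K) <= nrm S x.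

Definition form_values (E : normedModType K) (z : symtensor n E) : set R :=
  [set nrm S (symval z (mlpull Phi Q)) | Phi in @contractive E].

(** Division by [B], the bound of [Q] on the unit ball of ell_infty J, places it below pi. *)
Definition form_norm (E : normedModType K) (z : symtensor n E) : R :=
  sup (form_values z) / B.

Section theory.
Variable E : normedModType K.
Implicit Types z w : symtensor n E.

Lemma form_values_le (s : seq (K * E)) (Phi : {linear E -> (J -> K^o)}) :
  contractive Phi ->
  nrm S (symval (tsum n s) (mlpull Phi Q)) <= B * \sum_(p <- s) nrm S p.1 * nrm S p.2 ^+ n.
Proof.
move=> Pc; rewrite symval_tsum mulr_sumr; apply: le_trans (nrm_sum _ _ _ _) _.
apply: ler_sum => p _; rewrite nrmM mulrCA ler_wpM2l ?nrm_ge0//.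
by apply: form_bound => [|j]; [exact: nrm_ge0|exact: Pc].
Qed.

Lemma form_values_sup z : has_sup (form_values z).
Proof.
split.
  exists (nrm S (symval z (mlpull (\0 : {linear E -> (J -> K^o)}) Q))), \0 => //.
  by move=> x j; rewrite nrm0 nrm_ge0.
have [s ->] := tsumP z.
by eexists => _ [Phi Pc <-]; exact: form_values_le.
Qed.

Lemma form_norm_ub z Phi : contractive Phi ->
  nrm S (symval z (mlpull Phi Q)) <= B * form_norm z.
Proof.
move=> Pc; rewrite mulrC divfK ?gt_eqF//.
by apply: sup_upper_bound; [exact: form_values_sup|exists Phi].
Qed.

Lemma form_norm_le z M : (forall Phi, contractive Phi ->
  nrm S (symval z (mlpull Phi Q)) <= B * M) -> form_norm z <= M.
Proof.
move=> h; rewrite ler_pdivrMr// mulrC; apply: ge_sup.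
  by case: (form_values_sup z).
by move=> _ [Phi Pc <-]; exact: h.
Qed.

Lemma form_norm_ge0 z : 0 <= form_norm z.
Proof.
have [[_ [Phi Pc _]] _] := form_values_sup z.
by rewrite -(pmulr_rge0 _ B0); apply: le_trans (form_norm_ub z Pc); exact: nrm_ge0.
Qed.

Lemma form_normD z w : form_norm (z + w) <= form_norm z + form_norm w.
Proof.
apply: form_norm_le => Phi Pc; rewrite mulrDr.
exact: le_trans (nrmD _ _ _) (lerD (form_norm_ub z Pc) (form_norm_ub w Pc)).
Qed.

Lemma form_normZ a z : form_norm (a *: z) = nrm S a * form_norm z.
Proof.
move: a z; apply: homogeneous_of_le => [|b w]; first exact: form_norm_ge0.
apply: form_norm_le => Phi Pc; rewrite mulrCA.
rewrite [symval (b *: w) _]/(b * symval w (mlpull Phi Q)) nrmM.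
by rewrite ler_wpM2l ?nrm_ge0// form_norm_ub.
Qed.

Lemma form_norm_tsum (s : seq (K * E)) :
  form_norm (tsum n s) <= \sum_(p <- s) nrm S p.1 * nrm S p.2 ^+ n.
Proof. by apply: form_norm_le => Phi; exact: form_values_le. Qed.

End theory.

Lemma form_norm_map (E F : normedModType K) (T : {linear E -> F}) M z : 0 <= M ->
  (forall x, nrm S (T x) <= M * nrm S x) ->
  form_norm (tmap T z) <= M ^+ n * form_norm z.
Proof.
move=> M0 TM; apply: form_norm_le => Phi Pc; rewrite mlpull_comp.
(* Rescaling makes [Phi \o T] contractive. For M = 0 the inverse is 0 and [T] vanishes, so the
   formulas persist. *)
pose f (x : E) : J -> K^o := ofR S M^-1 *: Phi (T x).
have fl : linear f.
  move=> a x y; rewrite /f linearP linearP scalerDr !scalerA; congr (_ *: _ + _).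
  exact: mulrC.
have PT x : (Phi \o T) x = ofR S M *: mklin fl x.
  rewrite /= /f scalerA -rmorphM; have [M00|M00] := eqVneq M 0; last first.
    by rewrite divff// rmorph1 scale1r.
  rewrite M00 mul0r rmorph0 scale0r; have -> : T x = 0; last by rewrite linear0.
  apply: (nrm0_eq0 (S := S)); apply/eqP; rewrite eq_le nrm_ge0 andbT.
  by apply: le_trans (TM x) _; rewrite M00 mul0r.
rewrite (mlpull_scale Q z PT) nrmM nrmX nrm_ofR_ge0// mulrCA ler_wpM2l ?exprn_ge0//.
apply: form_norm_ub => x j.
rewrite [mklin fl x j]/(ofR S M^-1 * Phi (T x) j) nrmM nrm_ofR_ge0 ?invr_ge0//.
apply: le_trans (ler_wpM2l _ (le_trans (Pc _ _) (TM x))) _; first by rewrite invr_ge0.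
rewrite mulrA; have [->|M00] := eqVneq M 0; first by rewrite invr0 !mul0r nrm_ge0.
by rewrite mulVf// mul1r.
Qed.

(** Contractions into ell_infty J extend along [I]: Hahn-Banach applies to each coordinate. *)
Lemma form_norm_isometry (E F : normedModType K) (I : {linear E -> F}) z :
  (forall x, nrm S (I x) = nrm S x) -> form_norm (tmap I z) = form_norm z.
Proof.
move=> Iiso; apply/eqP; rewrite eq_le; apply/andP; split.
  rewrite -[leRHS]mul1r -(expr1n _ n); apply: form_norm_map => // x.
  by rewrite mul1r Iiso.
apply: form_norm_le => Phi Pc.
have cl j : linear (fun x => Phi x j : K^o) by move=> a x y; rewrite linearP.
have /choice[f fP] j : exists f : {linear F -> K^o},
    (forall y, nrm S (f y : K) <= nrm S y) /\ (forall x, f (I x) = Phi x j).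
  have [|f [fb fI]] := @hahn_banach _ _ S _ _ I (@nrm _ _ S F)
      (nrm_seminorm S F) (mklin (cl j)).
    by move=> x; rewrite Iiso; exact: Pc.
  by exists f.
pose Psi := mklin (functionals_linear f).
have -> : symval z (mlpull Phi Q) = symval (tmap I z) (mlpull Psi Q).
  rewrite mlpull_comp; congr (symval z _); apply: mlform_ext => x /=.
  congr (Q _); apply/funext => i; apply/funext => j /=.
  by rewrite -(fP j).2.
by apply: form_norm_ub => y j; exact: (fP j).1.
Qed.

End form_norm.

Section injective_hull.
Variables (R : realType) (K : numFieldType) (S : scalars R K) (n : nat).

(* [max ipi (form_norm Q)] is again an injective s-tensor norm below [pi]. *)
Lemma injective_hull_ge (ipi : tensor_norm K n) (J : Type) (Q : mlform n (J -> K^o)) (B : R)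
    (E : completeNormedModType K) (Phi : {linear E -> (J -> K^o)}) (z : symtensor n E) :
  is_injective_hull (pi_norm K n) ipi ->
  0 < B -> (forall y : J -> K^o, (forall j, nrm S (y j : K) <= 1) ->
    nrm S (Q (fun=> y)) <= B) ->
  contractive S Phi -> nrm S (symval z (mlpull Phi Q)) <= B * re S (ipi E z).
Proof.
move=> hipi B0 QB Pc.
have [[inorm ieps ilepi imap ifg] iinj ipile imax] := hipi.
have iE (F : completeNormedModType K) (w : symtensor n F) : ipi F w = ofR S (re S (ipi F w)).
  by apply: ge0_ofR; case: (inorm F).
(* Alone, [form_norm] may vanish on nonzero tensors and fall below epsilon; the maximum with [ipi]
   inherits definiteness and the lower bound. *)
pose delta : tensor_norm K n := fun F w =>
  ofR S (Num.max (re S (ipi F w)) (form_norm S Q B w)).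
have dinj : is_injective delta.
  move=> F G I Iiso w; rewrite /delta iinj//.
  by rewrite form_norm_isometry// => x; rewrite /nrm Iiso.
have le_delta : tnorm_le ipi delta.
  by move=> F w; rewrite iE le_ofR le_max lexx.
have dpi : tnorm_le delta (pi_norm K n).
  move=> F w; rewrite /delta; have [_|_] := leP; last by rewrite -iE; exact: ipile.
  apply: (pi_norm_ge S) => s ->.
  have -> : \sum_(p <- s) `|p.1| * `|p.2| ^+ n =
      ofR S (\sum_(p <- s) nrm S p.1 * nrm S p.2 ^+ n).
    by rewrite rmorph_sum; apply: eq_bigr => p _; rewrite rmorphM rmorphXn -!nrmE.
  by rewrite le_ofR; exact: form_norm_tsum.
suff ds : is_s_tensor_norm delta.
  have := imax _ ds dinj dpi E z; rewrite [leRHS]iE le_ofR ge_max => /andP[_ h].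
  apply: le_trans (form_norm_ub B0 QB z Pc) _.
  by rewrite ler_pM2l.
split.
- move=> F; have [i0 ieq0 iZ iD] := inorm F; split.
  + by move=> w; rewrite /delta ofR_ge0 le_max (re_ge0 S (i0 w)).
  + move=> w /eqP; rewrite fmorph_eq0 => /eqP w0; apply: ieq0.
    apply/eqP; rewrite eq_le i0 andbT iE -(rmorph0 (ofR S)) le_ofR -w0.
    by rewrite le_max lexx.
  + move=> a w; rewrite /delta iZ (nrmE S a) reZ form_normZ// -rmorphM.
    by rewrite maxr_pMr ?nrm_ge0.
  + move=> v w; rewrite /delta -rmorphD le_ofR ge_max; apply/andP; split.
      apply: (@le_trans _ _ (re S (ipi F v) + re S (ipi F w))).
        by rewrite -(le_ofR S) rmorphD -!iE.
      by apply: lerD; rewrite le_max lexx.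
    apply: le_trans (form_normD B0 QB v w) _.
    by apply: lerD; rewrite le_max lexx orbT.
- by move=> F w; apply: le_trans (ieps F w) (le_delta F w).
- exact: dpi.
- move=> F G T Tc w; have [T0 TM] := opnormP S Tc.
  rewrite /delta (ge0_ofR S T0) -rmorphXn -rmorphM le_ofR maxr_pMr ?exprn_ge0 ?re_ge0//.
  rewrite ge_max !le_max; apply/andP; split; apply/orP; [left|right].
    rewrite -(le_ofR S) rmorphM rmorphXn -(ge0_ofR S T0) -!iE.
    exact: imap.
  apply: form_norm_map => //; first exact: re_ge0.
  by move=> x; rewrite -(le_ofR S) rmorphM -!nrmE -ge0_ofR.
- move=> F w; have [flb fub] := ifg F w.
  split=> [_ [M [I [v [Mfd Iiso <- ->]]]]|l ll]; first by rewrite (dinj _ _ _ Iiso).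
  (* As [delta] is injective, all members of the set equal its value at [w], and one member
     suffices. It exists because [ipi] is finitely generated: over the empty set [ipi F w + 1] would
     be a lower bound too. *)
  have [[M [I [v [Mfd Iiso Iv]]]]|none] := pselect (exists (M : completeNormedModType K)
      (I : {linear M -> F}) (v : symtensor n M), [/\ finite_dimensional M,
        isometric_embedding (@Num.norm K M) (@Num.norm K F) I & tmap I v = w]).
    rewrite -Iv (dinj _ _ _ Iiso); apply: ll.
    by exists M, I, v; rewrite Iv.
  have := fub (ipi F w + 1); rewrite gerDl ler10 => h.
  suff : false by [].
  apply: h => r [M [I [v [Mfd Iiso Iv rE]]]]; exfalso; apply: none.
  by exists M, I, v.
Qed.

End injective_hull.

(** * Polarisation *)

(** In characteristic 0 the integers give more roots than the degree allows. *)
Lemma poly0_of_vanishing (K : numFieldType) (P : {poly K}) :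
  (forall t, P.[t] = 0) -> P = 0.
Proof.
move=> P0; apply/eqP/negPn/negP => Pn0.
pose rs : seq K := [seq i%:R | i <- iota 0 (size P)].
have := max_poly_roots (rs := rs) Pn0; rewrite size_map size_iota ltnn => h.
suff : false by [].
apply: h; first by apply/allP => t _; apply/eqP.
by rewrite map_inj_uniq ?iota_uniq// => i j /eqP; rewrite eqr_nat => /eqP.
Qed.

Section polarization.
Variables (K : numFieldType) (n : nat) (E : lmodType K).

Lemma mlform_linear (phi : mlform n E) X i :
  linear (fun u => phi (dfwith X i u) : K^o).
Proof. by move=> a u v; exact: mlvalP. Qed.

(** The arguments of a multilinear form are expanded along [e] one slot at a time, which leaves only
    the monomial sums of the hypothesis. *)
Lemma tsum_eq0 k (e : 'I_k -> E) (f : 'I_k -> {linear E -> K^o}) (s : seq (K * E)) :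
  (forall p, p \in s -> p.2 = \sum_j f j p.2 *: e j) ->
  (forall js : seq 'I_k, size js = n ->
    \sum_(p <- s) p.1 * \prod_(j <- js) (f j p.2 : K) = 0) ->
  tsum n s = 0.
Proof.
move=> sE h; apply: symtensor_ext => phi; rewrite symval_tsum.
(* The first slots hold basis vectors; the default of [nth] puts [x] in the others. *)
pose X js (x : E) (i : 'I_n) := nth x [seq e j | j <- js] i.
suff C m : forall js, (size js + m)%N = n -> \sum_(p <- s) p.1 *
    (\prod_(j <- js) (f j p.2 : K) * phi (X js p.2)) = 0.
  rewrite -[RHS](C n [::] erefl); apply: eq_bigr => p _.
  rewrite big_nil mul1r; congr (_ * phi _); apply/funext => i.
  by rewrite /X nth_nil.
elim: m => [|m IH] js.
  rewrite addn0 => jsn.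
  transitivity ((\sum_(p <- s) p.1 * \prod_(j <- js) (f j p.2 : K)) * phi (X js 0)).
    rewrite mulr_suml; apply: eq_bigr => p _; rewrite -mulrA; congr (_ * (_ * phi _)).
  2: by rewrite h// mul0r.
  by apply/funext => i; apply: set_nth_default; rewrite size_map jsn.
move=> jsm; have jn : (size js < n)%N by rewrite -jsm addnS ltnS leq_addr.
pose i0 := Ordinal jn.
transitivity (\sum_j \sum_(p <- s) p.1 *
    (\prod_(j' <- rcons js j) (f j' p.2 : K) * phi (X (rcons js j) p.2))); last first.
  by rewrite big1// => j _; rewrite IH// size_rcons addSnnS.
rewrite exchange_big big_seq [RHS]big_seq; apply: eq_bigr => p ps.
have -> : X js p.2 = dfwith (X js p.2) i0 (\sum_j f j p.2 *: e j).
  apply/funext => i; have [->|ii] := eqVneq i i0; last by rewrite dfwithout// eq_sym.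
  by rewrite dfwithin -sE// /X /= nth_default// size_map.
rewrite -[phi _]/(mklin (mlform_linear phi (X js p.2) i0) _) linear_form.
rewrite !mulr_sumr; apply: eq_bigr => j _; congr (_ * _).
rewrite -cats1 big_cat big_seq1 -mulrA; congr (_ * (_ * phi _)).
apply/funext => i; rewrite /X map_cat cats1 nth_rcons size_map.
have [->|ii] := eqVneq i i0; first by rewrite dfwithin /= ltnn eqxx.
rewrite dfwithout 1?eq_sym//; have ii' : size js != i :> nat by rewrite eq_sym.
case: ltnP => // ji; rewrite (negbTE ii').
by rewrite nth_default// size_map.
Qed.

(** Polarisation by differentiation: along t + u e_i the sum is a polynomial in u that vanishes, and
    its derivative at 0 is the exponent times the sum with one more factor [p.2 i]. *)
Lemma power_sum_coef k (s : seq (K * ('I_k -> K))) :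
  (forall t : 'I_k -> K, power_sum n s t = 0) ->
  forall js : seq 'I_k, size js = n -> \sum_(p <- s) p.1 * \prod_(j <- js) p.2 j = 0.
Proof.
move=> h js jsn.
suff C l (t : 'I_k -> K) (ks : seq 'I_k) : (size ks + l)%N = n ->
    \sum_(p <- s) p.1 * ((\prod_(j <- ks) p.2 j) * (\sum_j p.2 j * t j) ^+ l) = 0.
  rewrite -[RHS](C 0 (fun=> 0) js); last by rewrite addn0.
  by apply: eq_bigr => p _; rewrite expr0 mulr1.
elim: ks l t => [l t ln|i ks IH l t isl].
  rewrite -[RHS](h t) /power_sum -ln add0n; apply: eq_bigr => p _.
  by rewrite big_nil mul1r.
pose P : {poly K} := \sum_(p <- s) (p.1 * \prod_(j <- ks) p.2 j) *:
  ((\sum_j p.2 j * t j)%:P + p.2 i *: 'X) ^+ l.+1.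
have P0 : P = 0.
  apply: poly0_of_vanishing => u; rewrite /P horner_sum.
  rewrite -[RHS](IH l.+1 (fun j => t j + u * (j == i)%:R)); last by rewrite addnS -isl.
  apply: eq_bigr => p _; rewrite hornerZ horner_exp hornerD hornerC hornerZ hornerX.
  rewrite -mulrA; congr (_ * (_ * _ ^+ _)).
  under [RHS]eq_bigr do rewrite mulrDr; rewrite big_split /=; congr (_ + _).
  rewrite (bigD1 i)//= eqxx mulr1 big1 ?addr0// => j /negbTE ->.
  by rewrite !mulr0.
have := congr1 (fun P : {poly K} => P^`().[0]) P0.
rewrite deriv0 horner0 /P linear_sum horner_sum => h0.
have l0 : (l.+1%:R : K) != 0 by rewrite pnatr_eq0.
apply: (mulfI l0); rewrite mulr0 -[RHS]h0 mulr_sumr; apply: eq_bigr => p _.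
rewrite big_cons /= derivZ deriv_exp derivD derivC derivZ derivX add0r.
rewrite hornerZ hornerMn hornerM horner_exp hornerD !hornerZ hornerX -polyC1 !hornerC mulr0 addr0 mulr1
  -mulr_natl; ring.
Qed.

End polarization.

(** Contractive functionals separate symmetric tensors, which makes epsilon and every norm above it
    definite. In coordinates, vanishing on n-th powers means that the power sum vanishes. *)
Lemma symtensor_eq0 (R : realType) (K : numFieldType) (S : scalars R K) n
    (E : normedModType K) (z : symtensor n E) :
  (forall f : {linear E -> K^o}, (forall x, nrm S (f x : K) <= nrm S x) ->
    symval z (mlprod n f) = 0) -> z = 0.
Proof.
have [s ->] := tsumP z => h.
have [k [e [f [[fe fb] sE]]]] := biorthogonal_span (nrm_seminorm S E)
  (@nrm0_eq0 _ _ S E) [seq p.2 | p <- s].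
apply: (tsum_eq0 (e := e) (f := f)) => [p ps|js jsn].
  by apply: sE; apply: map_f.
pose c (p : K * E) : K * ('I_k -> K) := (p.1, fun j => f j p.2).
suff : power_sum n [seq c p | p <- s] = fun=> 0.
  move=> h'; have := power_sum_coef (s := [seq c p | p <- s]) _ jsn.
  rewrite big_map; apply => t; by rewrite h'.
apply/funext => t; rewrite /power_sum big_map /=.
have [C Cf] := choice fb.
(* Dividing by [D] brings the functional with coordinates [t] into the dual ball. *)
pose D := 1 + \sum_j nrm S (t j) * `|C j|.
have D0 : 0 < D by rewrite ltr_wpDr// sumr_ge0// => j _; rewrite mulr_ge0 ?nrm_ge0.
have gl : linear (fun x => ofR S D^-1 * \sum_j (f j x : K) * t j : K^o).
  move=> a x y; rewrite /GRing.scale/= mulrCA -mulrDr; congr (_ * _).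
  rewrite mulr_sumr -big_split; apply: eq_bigr => j _ /=.
  by rewrite linearP mulrDl mulrA.
have := h (mklin gl); rewrite symval_tsum => h1.
have Dn0 : ofR S D ^+ n != 0 by rewrite expf_neq0// fmorph_eq0 gt_eqF.
apply: (mulfI (x := (ofR S D)^-1 ^+ n)); first by rewrite exprVn invr_neq0.
rewrite mulr0 -[RHS]h1.
  rewrite mulr_sumr; apply: eq_bigr => p _ /=.
  by rewrite prodr_const card_ord fmorphV exprMn mulrCA.
move=> x /=; rewrite nrmM nrm_ofR_ge0 ?invr_ge0 ?(ltW D0)// mulrC ler_pdivrMr//.
apply: le_trans (nrm_sum _ _ _ _) _.
rewrite mulrC mulrDl mul1r; apply: ler_wpDl; first exact: nrm_ge0.
rewrite mulr_suml; apply: ler_sum => j _; rewrite nrmM [leLHS]mulrC -[leRHS]mulrA.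
rewrite ler_wpM2l ?nrm_ge0//; apply: le_trans (Cf j x) _.
by rewrite ler_wpM2r ?nrm_ge0// ler_norm.
Qed.

(** * Finite dimensional subspaces as Banach spaces *)

Section finite_dimensional_subspaces.
Variables (R : realType) (K : numFieldType) (S : scalars R K).

(** Finite generation speaks of Banach spaces embedded in E, so the span of [e] is rebuilt on
    coordinates with the norm induced by E; the bounded [f i] make it complete. *)
Lemma biorthogonal_banach (E : completeNormedModType K) k (e : 'I_k -> E)
    (f : 'I_k -> {linear E -> K^o}) : biorthogonal S (@nrm R K S E) e f ->
  exists (M : completeNormedModType K) (I : {linear M -> E}),
    [/\ finite_dimensional M, isometric_embedding (@Num.norm K M) (@Num.norm K E) I,
        forall v, I v = \sum_i f i (I v) *: e i &
        forall c : 'I_k -> K, exists v, I v = \sum_i c i *: e i].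
Proof.
move=> [fe fb].
pose J := mklin (lincomb_linear e); pose r := mklin (functionals_linear f).
pose p (c : 'I_k -> K^o) : K := `|J c|.
have fJ c i : f i (J c) = c i.
  rewrite linear_form (bigD1 i)//= fe eqxx mulr1 big1 ?addr0// => j /negbTE ji.
  by rewrite fe eq_sym ji mulr0.
have rJ c : r (J c) = c by apply/funext => i; exact: fJ.
have pn : is_norm p.
  split=> [c|c /normr0_eq0 c0|a c|c d]; rewrite /p.
  - exact: normr_ge0.
  - by rewrite -(rJ c) c0 linear0.
  - by rewrite linearZ normrZ.
  - by rewrite linearD ler_normD.
have [C Cf] := choice fb.
pose D := 1 + \sum_i `|C i| * nrm S (e i).
have D0 : 0 < D by rewrite ltr_wpDr// sumr_ge0// => i _; rewrite mulr_ge0 ?nrm_ge0.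
have pc : renormed_complete pn.
  apply: (@renormed_completeP _ _ _ _ E J r 1 (ofR S D)) => //.
  - by rewrite ofR_gt0.
  - by move=> x; rewrite mul1r.
  move=> y; rewrite (nrmE S y) -rmorphM /p nrm_le_ofR.
  apply: le_trans (nrm_sum _ _ _ _) _; rewrite mulrDl mul1r.
  apply: ler_wpDl; first exact: nrm_ge0.
  rewrite mulr_suml; apply: ler_sum => i _; rewrite nrmZ mulrAC.
  rewrite ler_wpM2r ?nrm_ge0//; apply: le_trans (Cf i y) _.
  by rewrite ler_wpM2r ?nrm_ge0// ler_norm.
have Il : linear (fun c : banach_space pc => J c) by exact: linearP J.
exists (banach_space pc), (mklin Il); split.
- apply: (@finite_dimensional_family _ _ k (fun i => (fun j => (j == i)%:R) : 'I_k -> K^o)).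
  move=> c; exists c; apply/funext => j; rewrite fct_sumE (bigD1 j)//=.
  rewrite [X in _ = X + _](_ : _ = c j) ?big1 ?addr0//.
    move=> i /negbTE ij; rewrite -[LHS]/(c i * (j == i)%:R) eq_sym ij.
    by rewrite mulr0.
  by rewrite -[LHS]/(c j * (j == j)%:R) eqxx mulr1.
- by move=> x.
- move=> v; rewrite -[mklin Il v]/(J v) {1}/J /=.
  by apply: eq_bigr => i _; rewrite fJ.
- by move=> c; exists c.
Qed.

Lemma span_banach (E : completeNormedModType K) (J : finType) (x : J -> E) :
  exists (M : completeNormedModType K) (I : {linear M -> E}) (y : J -> M),
    [/\ finite_dimensional M, isometric_embedding (@Num.norm K M) (@Num.norm K E) I &
        forall j, I (y j) = x j].
Proof.
have [k [e [f [b sE]]]] := biorthogonal_span (nrm_seminorm S E)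
  (@nrm0_eq0 _ _ S E) [seq x j | j <- enum J].
have [M [I [Mfd Iiso _ Isurj]]] := biorthogonal_banach b.
have yP j : exists v, I v = x j.
  have [v vE] := Isurj (fun i => f i (x j)); exists v; rewrite vE -sE//.
  by apply: map_f; rewrite mem_enum.
have [y yE] := choice yP.
by exists M, I, y.
Qed.

End finite_dimensional_subspaces.

(** * Upper bounds for the projective hull of epsilon *)

Section slash_norm.
Variables (R : realType) (K : numFieldType) (S : scalars R K) (n : nat).

Definition comb (E : lmodType K) (J : finType) (x : J -> E)
    (s : seq (K * (J -> K))) : symtensor n E :=
  tsum n [seq (p.1, \sum_j p.2 j *: x j) | p <- s].

Lemma tmap_comb (E F : lmodType K) (T : {linear E -> F}) (J : finType) (x : J -> E) s :
  tmap T (comb x s) = comb (T \o x) s.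
Proof.
rewrite tmap_tsum -map_comp; congr tsum; apply: eq_map => p /=.
by rewrite linear_sum; congr (_, _); apply: eq_bigr => j _; rewrite linearZ.
Qed.

(* [represented z M] means that [z] is the image under a contraction
   [ell_1 J -> E] of a tensor whose injective norm is at most [M]. *)
Definition represented (E : normedModType K) (z : symtensor n E) : set R :=
  [set M | exists (J : finType) (x : J -> E) (s : seq (K * (J -> K))),
    [/\ forall j, nrm S (x j) <= 1, z = comb x s &
        forall g : J -> K, (forall j, nrm S (g j) <= 1) ->
          nrm S (power_sum n s g) <= M]].

Definition slash (E : normedModType K) (z : symtensor n E) : R := inf (represented z).

Lemma power_sumZ (J : finType) (s : seq (K * (J -> K))) a b g :
  power_sum n [seq (a * p.1, fun j => b * p.2 j) | p <- s] g =
  a * b ^+ n * power_sum n s g.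
Proof.
rewrite /power_sum big_map mulr_sumr; apply: eq_bigr => p _ /=.
under eq_bigr do rewrite -mulrA.
by rewrite -mulr_sumr exprMn; ring.
Qed.

Section theory.
Variable E : normedModType K.
Implicit Types z w : symtensor n E.

(** Every term gets its own coordinate and a normalised vector; as the inverse of 0 is 0, zero
    vectors fit in. *)
Lemma represented_tsum (s : seq (K * E)) :
  represented (tsum n s) (\sum_(p <- s) nrm S p.1 * nrm S p.2 ^+ n).
Proof.
pose t j := tnth (in_tuple s) j; pose c j := nrm S (t j).2.
have c0 j : 0 <= c j by exact: nrm_ge0.
pose d j : K * ('I_(size s) -> K) := ((t j).1, fun k => if k == j then ofR S (c j) else 0).
exists 'I_(size s), (fun j => ofR S (c j)^-1 *: (t j).2),
  [seq d j | j <- index_enum 'I_(size s)].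
split=> [j||g g1].
- rewrite nrmZ nrm_ofR_ge0 ?invr_ge0//; have [->|cj] := eqVneq (c j) 0.
    by rewrite invr0 mul0r.
  by rewrite mulVf.
- rewrite /comb /tsum -map_comp big_map (big_tnth _ _ s) /=; apply: eq_bigr => j _.
  congr (_ *: tpow n _); rewrite (bigD1 j)//= eqxx scalerA -rmorphM.
  rewrite big1 ?addr0 => [|k /negbTE ->]; last by rewrite scale0r.
  have [cj|cj] := eqVneq (c j) 0; last by rewrite divff// rmorph1 scale1r.
  by rewrite cj mul0r rmorph0 scale0r; exact: nrm0_eq0 cj.
- rewrite /power_sum big_map (big_tnth _ _ s); apply: le_trans (nrm_sum _ _ _ _) _.
  apply: ler_sum => j _ /=; rewrite (bigD1 j)//= eqxx.
  rewrite big1 ?addr0 => [|k /negbTE ->]; last by rewrite mul0r.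
  rewrite nrmM nrmX nrmM nrm_ofR_ge0// ler_wpM2l ?nrm_ge0//.
  by apply: lerXn2r; rewrite ?nnegrE ?mulr_ge0 ?nrm_ge0// ler_piMr.
Qed.

Lemma represented_ge0 z M : represented z M -> 0 <= M.
Proof.
move=> [J [x [s [_ _ h]]]].
by apply: le_trans (h (fun=> 0) _); rewrite ?nrm_ge0// => j; rewrite nrm0.
Qed.

Lemma represented_inf z : has_inf (represented z).
Proof.
split; last by exists 0 => M; exact: represented_ge0.
have [s ->] := tsumP z; eexists; exact: represented_tsum.
Qed.

Lemma slash_le z M : represented z M -> slash z <= M.
Proof. by move=> h; apply: (inf_lbound (represented_inf z).2). Qed.

Lemma slash_ge z l : (forall M, represented z M -> l <= M) -> l <= slash z.
Proof. by move=> h; apply: lb_le_inf => //; exact: (represented_inf z).1. Qed.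

Lemma slash_ge0 z : 0 <= slash z.
Proof. by apply: slash_ge => M; exact: represented_ge0. Qed.

Lemma slash_tsum (s : seq (K * E)) :
  slash (tsum n s) <= \sum_(p <- s) nrm S p.1 * nrm S p.2 ^+ n.
Proof. by apply: slash_le; exact: represented_tsum. Qed.

End theory.

(** The factor [C] moves from the vectors to the coefficients, where the degree n turns it into
    C^n. *)
Lemma represented_map (E F : normedModType K) (T : {linear E -> F}) C
    (z : symtensor n E) M : 0 <= C ->
  (forall x, nrm S (T x) <= C * nrm S x) ->
  represented z M -> represented (tmap T z) (C ^+ n * M).
Proof.
move=> C0 TC [J [x [s [x1 -> sM]]]].
exists J, (fun j => ofR S C^-1 *: T (x j)),
  [seq (1 * p.1, fun j => ofR S C * p.2 j) | p <- s].
split=> [j||g g1].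
- rewrite nrmZ nrm_ofR_ge0 ?invr_ge0//.
  have [->|Cn0] := eqVneq C 0; first by rewrite invr0 mul0r.
  rewrite mulrC ler_pdivrMr ?lt_def ?Cn0// mul1r; apply: le_trans (TC _) _.
  by rewrite ler_piMr.
- rewrite tmap_comb /comb -map_comp; congr tsum; apply: eq_map => p /=.
  rewrite mul1r; congr (_, _); apply: eq_bigr => j _.
  rewrite scalerA mulrAC -rmorphM; have [CC|Cn0] := eqVneq C 0; last first.
    by rewrite divff// rmorph1 mul1r.
  have -> : T (x j) = 0; last by rewrite !scaler0.
  apply: (nrm0_eq0 (S := S)); apply/eqP; rewrite eq_le nrm_ge0 andbT.
  by apply: le_trans (TC _) _; rewrite CC mul0r.
- rewrite power_sumZ mul1r nrmM nrmX nrm_ofR_ge0// ler_wpM2l ?exprn_ge0//.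
  exact: sM.
Qed.

Lemma slash_map (E F : normedModType K) (T : {linear E -> F}) C (z : symtensor n E) : 0 <= C ->
  (forall x, nrm S (T x) <= C * nrm S x) -> slash (tmap T z) <= C ^+ n * slash z.
Proof.
move=> C0 TC; have [Cn0|Cn0] := eqVneq (C ^+ n) 0.
  have [[M Mz] _] := represented_inf z.
  by have := slash_le (represented_map C0 TC Mz); rewrite Cn0 !mul0r.
have Cp : 0 < C ^+ n by rewrite lt_def Cn0 exprn_ge0.
rewrite mulrC -ler_pdivrMr//; apply: slash_ge => M Mz.
by rewrite ler_pdivrMr// mulrC; exact: slash_le (represented_map C0 TC Mz).
Qed.

Section sums.
Variable E : normedModType K.
Implicit Types z w : symtensor n E.

Lemma represented_scale a z M : represented z M -> represented (a *: z) (nrm S a * M).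
Proof.
move=> [J [x [s [x1 -> sM]]]].
exists J, x, [seq (a * p.1, fun j => 1 * p.2 j) | p <- s].
split=> // [|g g1].
  rewrite /comb -tsumZ -!map_comp; congr tsum; apply: eq_map => p /=.
  by congr (_, _); apply: eq_bigr => j _; rewrite mul1r.
by rewrite power_sumZ expr1n mulr1 nrmM ler_wpM2l ?nrm_ge0// sM.
Qed.

Lemma slashZ a z : slash (a *: z) = nrm S a * slash z.
Proof.
move: a z; apply: homogeneous_of_le => [|b w]; first exact: slash_ge0.
have [->|b0] := eqVneq b 0.
  have [[M Mw] _] := represented_inf w.
  apply: le_trans (slash_le (represented_scale 0 Mw)) _.
  by rewrite nrm0 !mul0r.
rewrite mulrC -ler_pdivrMr ?nrm_gt0//; apply: slash_ge => M Mw.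
rewrite ler_pdivrMr ?nrm_gt0// mulrC.
exact: slash_le (represented_scale b Mw).
Qed.

Lemma representedD z w M N : represented z M -> represented w N ->
  represented (z + w) (M + N).
Proof.
move=> [J [x [s [x1 -> sM]]]] [J' [x' [s' [x1' -> sN]]]].
pose l (p : K * (J -> K)) : K * (J + J' -> K) :=
  (p.1, fun j => match j with inl j => p.2 j | inr _ => 0 end).
pose r (p : K * (J' -> K)) : K * (J + J' -> K) :=
  (p.1, fun j => match j with inl _ => 0 | inr j => p.2 j end).
exists (J + J')%type, (fun j => match j with inl j => x j | inr j => x' j end),
  ([seq l p | p <- s] ++ [seq r p | p <- s']); split=> [[j|j]//||g g1].
- rewrite /comb -tsum_cat map_cat -!map_comp; congr (tsum n (_ ++ _));
    apply: eq_map => p /=; rewrite big_sumType /=.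
    by rewrite [X in _ + X]big1 ?addr0// => j _; rewrite scale0r.
  by rewrite [X in X + _]big1 ?add0r// => j _; rewrite scale0r.
- rewrite /power_sum big_cat !big_map /=; apply: le_trans (nrmD _ _ _) _.
  apply: lerD.
    rewrite (eq_bigr (fun p => p.1 * (\sum_j p.2 j * g (inl j)) ^+ n)).
      exact: sM.
    move=> p _; rewrite big_sumType /= [X in _ + X]big1 ?addr0// => j _.
    by rewrite mul0r.
  rewrite (eq_bigr (fun p => p.1 * (\sum_j p.2 j * g (inr j)) ^+ n)).
    exact: sN.
  move=> p _; rewrite big_sumType /= [X in X + _]big1 ?add0r// => j _.
  by rewrite mul0r.
Qed.

Lemma slashD z w : slash (z + w) <= slash z + slash w.
Proof.
rewrite -lerBlDr; apply: slash_ge => M Mz; rewrite lerBlDr -lerBlDl.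
apply: slash_ge => N Nw; rewrite lerBlDl; exact: slash_le (representedD Mz Nw).
Qed.

Lemma slash_ge_power z (f : {linear E -> K^o}) : (forall x, nrm S (f x : K) <= nrm S x) ->
  nrm S (symval z (mlprod n f)) <= slash z.
Proof.
move=> f1; apply: slash_ge => M [J [x [s [x1 -> sM]]]].
have -> : symval (comb x s) (mlprod n f) = power_sum n s (fun j => f (x j)).
  rewrite symval_tsum /power_sum big_map; apply: eq_bigr => p _ /=.
  by rewrite prodr_const card_ord linear_form.
by apply: sM => j; exact: le_trans (f1 _) (x1 j).
Qed.

End sums.

(** Continuity at e = 0, from the chord bound of the convex power on [0, 1]. Metric surjections lift
    the unit ball only up to a factor 1 + e. *)
Lemma le_of_scaled (l M : R) : 0 <= M ->
  (forall e, 0 < e -> l <= (1 + e) ^+ n * M) -> l <= M.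
Proof.
move=> M0 h; have bound k (e : R) : 0 < e -> e <= 1 -> (1 + e) ^+ k <= 1 + (2 ^+ k - 1) * e.
  move=> e0 e1; elim: k => [|k IH]; first by rewrite !expr0; lra.
  rewrite exprS [2 ^+ _]exprS; have : 1 <= 2 ^+ k :> R by apply: exprn_ege1; lra.
  move: IH; set X := _ ^+ k; set A := 2 ^+ k => IH A1.
  have h1 : (1 + e) * X <= (1 + e) * (1 + (A - 1) * e) by rewrite ler_wpM2l//; lra.
  have h2 : (A - 1) * e * e <= (A - 1) * e by rewrite ler_piMr// mulr_ge0; lra.
  by apply: le_trans h1 _; lra.
rewrite leNgt; apply/negP => lM.
have A1 : 1 <= 2 ^+ n :> R by apply: exprn_ege1; lra.
pose A : R := 2 ^+ n * (M + 1).
have A0 : 0 < A by rewrite mulr_gt0//; lra.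
pose e := Num.min 1 ((l - M) / (2 * A)).
have e0 : 0 < e by rewrite lt_min ltr01 divr_gt0 ?subr_gt0// mulr_gt0.
have e1 : e <= 1 by rewrite ge_min lexx.
have eA : e * (2 * A) <= l - M.
  have A20 : 0 < 2 * A by rewrite mulr_gt0.
  by rewrite -(ler_pdivlMr _ _ A20) /e ge_min lexx orbT.
have := h e e0; have := ler_wpM2r M0 (bound n e e0 e1).
have : (2 ^+ n - 1) * M <= A by rewrite /A; nra.
by nra.
Qed.

Lemma metric_surjection_lift (E F : normedModType K) (Q : {linear E -> F}) y (e : R) :
  metric_surjection (@Num.norm K E) (@Num.norm K F) Q -> 0 < e -> nrm S y <= 1 ->
  exists x, Q x = y /\ nrm S x <= 1 + e.
Proof.
move=> [_ Qinf] e0 y1; apply: contrapT => /forallNP h.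
have [_ /(_ (ofR S (1 + e)))] := Qinf y.
suff lb : lbound [set `|x| | x in [set x | Q x = y]] (ofR S (1 + e)).
  by move=> /(_ lb); rewrite (nrmE S y) le_ofR; lra.
move=> _ [x /= Qx <-]; rewrite (nrmE S x) le_ofR leNgt; apply/negP => xe.
by apply: (h x); split=> //; exact: ltW.
Qed.

Lemma metric_surjection_le (E F : normedModType K) (Q : {linear E -> F}) x :
  metric_surjection (@Num.norm K E) (@Num.norm K F) Q -> nrm S (Q x) <= nrm S x.
Proof. by move=> [_ Qinf]; rewrite -(le_ofR S) -!nrmE; apply: (Qinf _).1; exists x. Qed.

Lemma le_ofR_real (l : K) r : l <= ofR S r -> l = ofR S (re S l).
Proof.
move=> lr; have h : l = ofR S (r - re S (ofR S r - l)).
  by rewrite rmorphB -ge0_ofR ?subr_ge0//; ring.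
by rewrite h re_ofR.
Qed.

Definition slash_norm : tensor_norm K n := fun E z => ofR S (slash z).

Lemma slash_s_tensor_norm : is_s_tensor_norm slash_norm.
Proof.
split.
- move=> E; split=> [z|z /eqP|a z|z w]; rewrite /slash_norm.
  + by rewrite ofR_ge0 slash_ge0.
  + rewrite fmorph_eq0 => /eqP z0; apply: (symtensor_eq0 (S := S)) => f f1.
    apply: (nrm0_eq0 (S := S)); apply/eqP; rewrite eq_le nrm_ge0 andbT -z0.
    exact: slash_ge_power.
  + by rewrite slashZ rmorphM -nrmE.
  + by rewrite -rmorphD le_ofR slashD.
- move=> E z; apply: eps_norm_le; first by rewrite ofR_ge0 slash_ge0.
  move=> f f1; rewrite nrm_le_ofR; apply: slash_ge_power => x.
  by rewrite -(le_ofR S) -!nrmE.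
- move=> E z; apply: (pi_norm_ge S) => s ->.
  have -> : \sum_(p <- s) `|p.1| * `|p.2| ^+ n =
      ofR S (\sum_(p <- s) nrm S p.1 * nrm S p.2 ^+ n).
    by rewrite rmorph_sum; apply: eq_bigr => p _; rewrite rmorphM rmorphXn -!nrmE.
  by rewrite le_ofR slash_tsum.
- move=> E F T Tc z; have [T0 TM] := opnormP S Tc.
  rewrite /slash_norm (ge0_ofR S T0) -rmorphXn -rmorphM le_ofR.
  apply: slash_map; first exact: re_ge0.
  by move=> x; rewrite -(le_ofR S) rmorphM -!nrmE -ge0_ofR.
- move=> E z; split=> [_ [M [I [v [_ Iiso <- ->]]]]|l ll].
    rewrite le_ofR -[leRHS]mul1r -(expr1n _ n); apply: slash_map => // x.
    by rewrite mul1r /nrm Iiso.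
  (* The vectors of a representation span a finite dimensional subspace, where the same
     representation has the same bound. *)
  have lle N : represented z N -> l <= ofR S N.
    move=> [J [x [s [x1 zE sN]]]].
    have [M [I [y [Mfd Iiso Iy]]]] := span_banach S x.
    apply: (@le_trans _ _ (slash_norm (comb y s))).
      apply: ll; exists M, I, (comb y s); split=> //.
      by rewrite tmap_comb zE; congr comb; apply/funext => j /=.
    rewrite le_ofR; apply: slash_le; exists J, y, s; split=> // j.
    by rewrite /nrm -Iiso Iy; exact: x1.
  have [[N0 /lle/le_ofR_real lE] _] := represented_inf z.
  rewrite lE le_ofR; apply: slash_ge => N /lle; by rewrite {1}lE le_ofR.
Qed.

(** Projectivity of ell_1: the finitely many vectors [x j] are lifted along [Q] with norm at most 1
    + e and rescaled. *)
Lemma slash_projective : is_projective slash_norm.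
Proof.
move=> E F Q Qs; have Q1 x : nrm S (Q x) <= 1 * nrm S x.
  by rewrite mul1r metric_surjection_le.
split=> [y|y].
  have [s ->] := tsumP y; have [h hQ] := choice Qs.1.
  exists (tsum n [seq (p.1, h p.2) | p <- s]); rewrite tmap_tsum -map_comp.
  by congr tsum; rewrite -[RHS]map_id; apply: eq_map => -[a x] /=; rewrite hQ.
split=> [_ [z /= <- <-]|l ll].
  by rewrite le_ofR -[leRHS]mul1r -(expr1n _ n); exact: slash_map.
have lle N e : 0 < e -> represented y N -> l <= ofR S ((1 + e) ^+ n * N).
  move=> e0 [J [x [s [x1 yE sN]]]].
  have /choice[h hP] j : exists x', Q x' = x j /\ nrm S x' <= 1 + e.
    exact: metric_surjection_lift.
  have e1 : 0 < 1 + e by rewrite addr_gt0.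
  apply: (@le_trans _ _ (slash_norm (comb h s))).
    apply: ll; exists (comb h s) => //=; rewrite tmap_comb yE.
    by congr comb; apply/funext => j /=; rewrite (hP j).1.
  rewrite le_ofR; apply: slash_le.
  exists J, (fun j => ofR S (1 + e)^-1 *: h j),
    [seq (1 * p.1, fun j => ofR S (1 + e) * p.2 j) | p <- s].
  split=> [j||g g1].
  - rewrite nrmZ nrm_ofR_ge0 ?invr_ge0 ?(ltW e1)// mulrC ler_pdivrMr// mul1r.
    exact: (hP j).2.
  - rewrite /comb -map_comp; congr tsum; apply: eq_map => p /=.
    rewrite mul1r; congr (_, _); apply: eq_bigr => j _.
    by rewrite scalerA mulrAC -rmorphM divff ?gt_eqF// rmorph1 mul1r.
  - rewrite power_sumZ mul1r nrmM nrmX nrm_ofR_ge0 ?(ltW e1)//.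
    by rewrite ler_wpM2l ?exprn_ge0 ?(ltW e1)// sN.
have [[N0 N0y] _] := represented_inf y.
have lE := le_ofR_real (lle _ _ ltr01 N0y).
rewrite lE le_ofR; apply: slash_ge => N Ny.
apply: le_of_scaled => [|e e0]; first exact: represented_ge0 Ny.
by rewrite -(le_ofR S) -lE; exact: lle.
Qed.

Lemma projective_hull_le (peps : tensor_norm K n) (E : completeNormedModType K)
    (z : symtensor n E) M : is_projective_hull (eps_norm K n) peps ->
  represented z M -> peps E z <= ofR S M.
Proof.
move=> [_ _ _ pmin] zM.
have [_ seps _ _ _] := slash_s_tensor_norm.
apply: le_trans (pmin _ slash_s_tensor_norm slash_projective seps E z) _.
by rewrite le_ofR slash_le.
Qed.

End slash_norm.

(** * Equivalence of norms in finite dimension *)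

Section finite_dimension.
Variables (R : realType) (K : numFieldType) (S : scalars R K).

Definition has_dual_basis (V : lmodType K) (p : V -> R) : Prop :=
  exists k (e : 'I_k -> V) (f : 'I_k -> {linear V -> K^o}),
    biorthogonal S p e f /\ forall x, x = \sum_i f i x *: e i.

Lemma finite_dimensional_dual_basis (V : lmodType K) (p : V -> R) :
  seminorm S p -> (forall x, p x = 0 -> x = 0) -> finite_dimensional V ->
  has_dual_basis p.
Proof.
move=> ps p0 [s sp]; have [k [e [f [b sE]]]] := biorthogonal_span ps p0 s.
exists k, e, f; split=> // x; have [c ->] := sp x.
under [RHS]eq_bigr do rewrite linear_form scaler_suml.
rewrite exchange_big; apply: eq_bigr => j _ /=.
under eq_bigr do rewrite -scalerA.
by rewrite -scaler_sumr -sE// mem_nth.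
Qed.

(** In infinite dimension #|T| + 1 independent vectors would have independent images in K^T. *)
Lemma dual_basis_of_injection (V : lmodType K) (p : V -> R) (T : finType)
    (h : {linear V -> (T -> K^o)}) :
  seminorm S p -> (forall x, p x = 0 -> x = 0) -> (forall x, h x = 0 -> x = 0) ->
  has_dual_basis p.
Proof.
move=> ps p0 h0; have [fd|nfd] := pselect (finite_dimensional V).
  exact: finite_dimensional_dual_basis.
have [e [f [fe _]]] := biorthogonal_infinite ps p0 #|T|.+1 nfd.
pose M : 'M[K]_(#|T|.+1, #|T|) := \matrix_(i, t) h (e i) (enum_val t).
have : row_free M.
  apply: inj_row_free => u uM.
  have hu : h (\sum_i u ord0 i *: e i) = 0.
    apply/funext => t; rewrite linear_sum fct_sumE.
    have /matrixP/(_ ord0 (enum_rank t)) := uM; rewrite !mxE => ut.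
    rewrite -[RHS]ut; apply: eq_bigr => i _.
    by rewrite mxE enum_rankK linearZ.
  apply/matrixP => i j; rewrite ord1 mxE.
  have := congr1 (f j) (h0 _ hu); rewrite linear_form linear0 (bigD1 j)//= fe eqxx.
  rewrite mulr1 big1 ?addr0// => l /negbTE lj.
  by rewrite fe eq_sym lj mulr0.
by rewrite /row_free => /eqP rM; have := rank_leq_col M; rewrite rM ltnn.
Qed.

Lemma norm_seminorm (V : lmodType K) (N : V -> K) : is_norm N ->
  seminorm S (fun x => re S (N x)) /\ (forall x, re S (N x) = 0 -> x = 0).
Proof.
move=> [N0 Neq0 NZ ND]; have NE x := ge0_ofR S (N0 x).
split=> [|x x0]; last by apply: Neq0; rewrite NE x0 rmorph0.
split=> [x y|a x]; first by rewrite -(le_ofR S) rmorphD -!NE.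
by rewrite NZ (nrmE S a) reZ.
Qed.

Lemma dual_basis_norm_le (V : lmodType K) (N1 N2 : V -> K) :
  is_norm N1 -> is_norm N2 -> has_dual_basis (fun x => re S (N1 x)) ->
  exists C : K, 0 < C /\ forall x, N2 x <= C * N1 x.
Proof.
move=> n1 n2 [k [e [f [[_ fb] fE]]]]; have [p2 _] := norm_seminorm n2.
have N1E x : N1 x = ofR S (re S (N1 x)) by apply: ge0_ofR; case: n1.
have N2E x : N2 x = ofR S (re S (N2 x)) by apply: ge0_ofR; case: n2.
have [C Cf] := choice fb.
have e0 i : 0 <= re S (N2 (e i)) by apply: re_ge0; case: n2.
pose D := 1 + \sum_i `|C i| * re S (N2 (e i)).
have D0 : 0 < D by rewrite ltr_wpDr// sumr_ge0// => i _; rewrite mulr_ge0.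
exists (ofR S D); split=> [|x]; first by rewrite ofR_gt0.
rewrite N2E N1E -rmorphM le_ofR {1}(fE x).
have x0 : 0 <= re S (N1 x) by apply: re_ge0; case: n1.
apply: le_trans (seminorm_sum _ _ _ p2) _; rewrite mulrDl mul1r.
apply: ler_wpDl => //; rewrite mulr_suml; apply: ler_sum => i _.
rewrite p2.2 mulrAC ler_wpM2r//; apply: le_trans (Cf i x) _.
by rewrite ler_wpM2r// ler_norm.
Qed.

(** The products of coordinate functionals, indexed by n-tuples, separate tensors. So the tensor
    space is finite dimensional, and any two norms on it are equivalent. *)
Lemma equivalent_on_finite n (E : completeNormedModType K) (alpha beta : tensor_norm K n) :
  finite_dimensional E -> is_s_tensor_norm alpha -> is_s_tensor_norm beta ->
  equivalent_on E alpha beta.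
Proof.
move=> Efd [an _ _ _ _] [bn _ _ _ _].
have [k [e [f [_ fE]]]] := finite_dimensional_dual_basis (nrm_seminorm S E)
  (@nrm0_eq0 _ _ S E) Efd.
have ml (t : n.-tuple 'I_k) :
    multilinear (fun X : 'I_n -> E => \prod_(l < n) (f (tnth t l) (X l) : K)).
  move=> X i a u v.
  have dfE w : \prod_(l < n) (f (tnth t l) (dfwith X i w l) : K) =
      f (tnth t i) w * \prod_(l < n | l != i) (f (tnth t l) (X l) : K).
    rewrite (bigD1 i)//= dfwithin; congr (_ * _).
    by apply: eq_bigr => l li; rewrite dfwithout// eq_sym.
  by rewrite !dfE linearP mulrDl -mulrA.
have hl : linear (fun z : symtensor n E => (fun t => symval z (MLForm (ml t))) :
    n.-tuple 'I_k -> K^o).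
  by [].
have h0 z : mklin hl z = 0 -> z = 0.
  have [s ->] := tsumP z => zs; apply: (tsum_eq0 (e := e) (f := f)) => // js jsn.
  have := congr1 (fun g : n.-tuple 'I_k -> K^o => g (tcast jsn (in_tuple js))) zs.
  rewrite [LHS]/= symval_tsum => z0; rewrite -[RHS]z0; apply: eq_bigr => p _ /=.
  rewrite (big_tnth _ _ js) (reindex (cast_ord (esym jsn)))/=.
    by congr (_ * _); apply: eq_bigr => l _; rewrite tcastE.
  by exists (cast_ord jsn) => l _; rewrite ?cast_ordK ?cast_ordKV.
have basis gamma : (forall F, is_norm (gamma F)) ->
    has_dual_basis (fun z : symtensor n E => re S ((gamma : tensor_norm K n) E z)).
  by move=> gn; have [ps p0] := norm_seminorm (gn E); exact: dual_basis_of_injection h0.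
have [C [C0 aC]] := dual_basis_norm_le (bn E) (an E) (basis _ bn).
have [D [D0 bD]] := dual_basis_norm_le (an E) (bn E) (basis _ an).
exists C^-1, D; split; rewrite ?invr_gt0// => z; split=> //.
by rewrite mulrC ler_pdivrMr// mulrC.
Qed.

End finite_dimension.

(** * Injective norms: a pushout *)

Section pushout.
Variables (R : realType) (K : numFieldType) (S : scalars R K).
Variables (E : completeNormedModType K) (m : nat).
Variables (x : 'I_m -> E) (f : 'I_m -> {linear E -> K^o}).
Hypothesis Einf : ~ finite_dimensional E.
Hypothesis f1 : forall i y, nrm S (f i y : K) <= nrm S y.
Hypothesis fx : forall i j, f i (x j) = (i == j)%:R.
Hypothesis xl2 : forall a : 'I_m -> K,
  nrm S (\sum_i a i *: x i) ^+ 2 <= 4 * \sum_i nrm S (a i) ^+ 2.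

Local Notation cube := {ffun 'I_m -> bool}.
Local Notation cubeK := (cube -> K^o).

Definition rademacher (i : 'I_m) : cubeK := fun w => (-1) ^+ w i.

Let L : {linear ('I_m -> K^o) -> cubeK} := mklin (lincomb_linear rademacher).
Let X : {linear ('I_m -> K^o) -> E} := mklin (lincomb_linear x).

Definition l1_norm (g : cubeK) : R := (2 ^+ m)^-1 * \sum_w nrm S (g w : K).

Let two0 : 0 < (2 ^+ m)^-1 :> R. Proof. by rewrite invr_gt0 exprn_gt0. Qed.

Lemma l1_seminorm : seminorm S l1_norm.
Proof.
split=> [g h|a g]; rewrite /l1_norm.
  rewrite -mulrDr; apply: ler_wpM2l; first exact: ltW.
  by rewrite -big_split; apply: ler_sum => w _; exact: nrmD.
rewrite [RHS]mulrCA; congr (_ * _); rewrite mulr_sumr; apply: eq_bigr => w _; exact: nrmM.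
Qed.

Lemma coef_le (a : 'I_m -> K^o) i : nrm S (a i : K) <= nrm S (X a).
Proof.
have := f1 i (X a); rewrite linear_form (bigD1 i)//= fx eqxx mulr1 big1 ?addr0//.
by move=> j /negbTE ji; rewrite fx eq_sym ji mulr0.
Qed.

(** 16 = 2 * 8, from [xl2] and [khinchin]. As the weight of [l1_norm] in [values] it makes the
    embedding isometric. *)
Lemma rademacher_lower (a : 'I_m -> K^o) : nrm S (X a) <= 16 * l1_norm (L a).
Proof.
pose c : 'cV[K]_m := \col_i a i.
have h1 : nrm S (X a) <= 2 * l2 S c.
  rewrite -(ler_pXn2r (n := 2))// ?nnegrE ?nrm_ge0 ?mulr_ge0 ?l2_ge0//.
  apply: le_trans (xl2 a) _; rewrite exprMn sqr_l2 /hsq.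
  under [X in _ <= _ * X]eq_bigr do rewrite mxE.
  by rewrite (_ : 2 ^+ 2 = 4)//; ring.
apply: le_trans h1 _; have := khinchin S c.
have -> : (2 ^+ m)^-1 * \sum_(w : cube) nrm S (\sum_i c i ord0 * (-1) ^+ w i) = l1_norm (L a).
  congr (_ * _); apply: eq_bigr => w _; congr nrm.
  by rewrite /L /= fct_sumE; apply: eq_bigr => i _; rewrite mxE.
by lra.
Qed.

Let values (g : cubeK) : set R :=
  [set 16 * l1_norm (g - L a) + nrm S (X a) | a in setT].

(* The norm of the pushout of [ell_1^m -> E] and of the Rademacher map
   [ell_1^m -> ell_1(cube)], restricted to [ell_1(cube)]. *)
Definition pushout_norm (g : cubeK) : R := inf (values g).

(** A crude bound depending on m; it serves only definiteness and completeness, not the final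
    estimate. *)
Lemma l1_le_values g a : l1_norm g <= m.+1%:R * (16 * l1_norm (g - L a) + nrm S (X a)).
Proof.
have h1 : l1_norm g <= l1_norm (g - L a) + l1_norm (L a).
  by rewrite -{1}[g](subrK (L a)); exact: l1_seminorm.1.
have h2 : l1_norm (L a) <= m%:R * nrm S (X a).
  apply: le_trans (seminorm_sum _ _ _ l1_seminorm) _.
  rewrite -[m in m%:R]card_ord -sumr_const mulr_suml; apply: ler_sum => i _.
  rewrite mul1r l1_seminorm.2.
  have -> : l1_norm (rademacher i) = 1.
    rewrite /l1_norm (eq_bigr (fun=> 1)) => [|w _]; last exact: nrm_sign.
    by rewrite sumr_const card_ffun card_bool card_ord natrX mulVf// expf_neq0.
  by rewrite mulr1 coef_le.
have := seminorm_ge0 (g - L a) l1_seminorm; have := nrm_ge0 S (X a).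
move: h1 h2; rewrite -natr1; have := ler0n R m.
set u := l1_norm (g - L a); set v := nrm S (X a); set k : R := m%:R.
move=> k0 h1 h2 v0 u0; apply: le_trans h1 _.
have : 0 <= k * u by rewrite mulr_ge0.
by nra.
Qed.

Lemma values_inf g : has_inf (values g).
Proof.
split; first by exists (16 * l1_norm (g - L 0) + nrm S (X 0)), 0.
exists 0 => _ [a _ <-]; apply: addr_ge0; last exact: nrm_ge0.
by apply: mulr_ge0 => //; exact: (seminorm_ge0 _ l1_seminorm).
Qed.

Lemma pushout_le g a : pushout_norm g <= 16 * l1_norm (g - L a) + nrm S (X a).
Proof. by apply: (inf_lbound (values_inf g).2); exists a. Qed.

Lemma pushout_le_l1 g : pushout_norm g <= 16 * l1_norm g.
Proof.
by have := pushout_le g 0; rewrite (linear0 L) (linear0 X) subr0 nrm0 addr0.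
Qed.

Lemma pushout_ge g l :
  (forall a, l <= 16 * l1_norm (g - L a) + nrm S (X a)) -> l <= pushout_norm g.
Proof.
by move=> h; apply: lb_le_inf => [|_ [a _ <-]//]; exact: (values_inf g).1.
Qed.

Lemma l1_le_pushout g : l1_norm g <= m.+1%:R * pushout_norm g.
Proof.
rewrite mulrC -ler_pdivrMr ?ltr0n//; apply: pushout_ge => a.
by rewrite ler_pdivrMr ?ltr0n// mulrC l1_le_values.
Qed.

Lemma pushout_ge0 g : 0 <= pushout_norm g.
Proof.
apply: pushout_ge => a; apply: addr_ge0; last exact: nrm_ge0.
by apply: mulr_ge0 => //; exact: (seminorm_ge0 _ l1_seminorm).
Qed.

Lemma pushout_seminorm : seminorm S pushout_norm.
Proof.
have [lD lZ] := l1_seminorm.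
split=> [g h|].
  rewrite -lerBlDr; apply: pushout_ge => a; rewrite lerBlDr -lerBlDl.
  apply: pushout_ge => b; rewrite lerBlDl.
  have LD : L (a + b) = L a + L b by rewrite linearD.
  have XD : X (a + b) = X a + X b by rewrite linearD.
  apply: le_trans (pushout_le _ (a + b)) _; rewrite LD XD opprD addrACA.
  have := lD (g - L a) (h - L b); have := nrmD S (X a) (X b); lra.
apply: homogeneous_of_le => [|b g]; first exact: pushout_ge0.
have [->|b0] := eqVneq b 0.
  rewrite scale0r nrm0 mul0r; apply: le_trans (pushout_le_l1 0) _.
  by rewrite (seminorm0 l1_seminorm) mulr0.
rewrite mulrC -ler_pdivrMr ?nrm_gt0//; apply: pushout_ge => a.
rewrite ler_pdivrMr ?nrm_gt0//; apply: le_trans (pushout_le _ (b *: a)) _.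
have LZ : L (b *: a) = b *: L a by rewrite linearZ.
have XZ : X (b *: a) = b *: X a by rewrite linearZ.
by rewrite LZ XZ -scalerBr lZ nrmZ; lra.
Qed.

(** For any b, |X a| <= |X (a - b)| + |X b| <= 16 l1 (L a - L b) + |X b|. *)
Lemma pushout_isometry a : pushout_norm (L a) = nrm S (X a).
Proof.
apply/eqP; rewrite eq_le; apply/andP; split.
  apply: le_trans (pushout_le _ a) _.
  by rewrite subrr (seminorm0 l1_seminorm) mulr0 add0r.
apply: pushout_ge => b; have := rademacher_lower (a - b).
have LB : L (a - b) = L a - L b by rewrite linearB.
have XB : X (a - b) = X a - X b by rewrite linearB.
by rewrite LB XB; have := nrmD S (X a - X b) (X b); rewrite subrK; lra.
Qed.

Lemma pushout_is_norm : is_norm (fun g => ofR S (pushout_norm g)).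
Proof.
split=> [g|g /eqP|a g|g h].
- by rewrite ofR_ge0 pushout_ge0.
- rewrite fmorph_eq0 => /eqP g0; have := l1_le_pushout g; rewrite g0 mulr0.
  rewrite /l1_norm pmulr_rle0// => h; apply/funext => w.
  apply: (nrm0_eq0 (S := S)); apply/eqP; rewrite eq_le nrm_ge0 andbT.
  apply: le_trans h; rewrite (bigD1 w)//= lerDl sumr_ge0// => v _; exact: nrm_ge0.
- by rewrite pushout_seminorm.2 rmorphM -nrmE.
- by rewrite -rmorphD le_ofR; exact: pushout_seminorm.1.
Qed.

Lemma nrm_le_l1 (g : cubeK) w : nrm S (g w : K) <= 2 ^+ m * l1_norm g.
Proof.
rewrite /l1_norm mulrA mulfV ?mul1r ?expf_neq0// (bigD1 w)//= lerDl.
by apply: sumr_ge0 => v _; exact: nrm_ge0.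
Qed.

Lemma pushout_complete : renormed_complete pushout_is_norm.
Proof.
(* The infinite dimensional E itself is the complete model: it contains a copy of [cubeK] with
   bounded coordinates. *)
have [e [h [he hb]]] := biorthogonal_infinite (nrm_seminorm S E)
  (@nrm0_eq0 _ _ S E) #|{: cube}| Einf.
pose J := mklin (lincomb_linear (fun w : cube => e (enum_rank w))).
pose r := mklin (functionals_linear (fun w : cube => h (enum_rank w))).
have [C Cf] := choice hb.
pose B := \sum_(w : cube) 2 ^+ m * m.+1%:R * nrm S (e (enum_rank w)).
pose D := 1 + 16 * \sum_(w : cube) (2 ^+ m)^-1 * `|C (enum_rank w)|.
have B0 : 0 <= B.
  by apply: sumr_ge0 => w _; rewrite !mulr_ge0 ?nrm_ge0 ?exprn_ge0.
have D1 : 0 <= 16 * \sum_(w : cube) (2 ^+ m)^-1 * `|C (enum_rank w)|.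
  by rewrite mulr_ge0// sumr_ge0// => w _; rewrite mulr_ge0// ltW.
apply: (@renormed_completeP _ _ _ _ E J r (ofR S B) (ofR S D)).
- by rewrite ofR_ge0.
- by rewrite ofR_gt0 /D; lra.
- move=> g; rewrite -rmorphM nrm_le_ofR; apply: le_trans (nrm_sum _ _ _ _) _.
  rewrite mulr_suml; apply: ler_sum => w _; rewrite nrmZ mulrAC.
  rewrite ler_wpM2r ?nrm_ge0//; apply: le_trans (nrm_le_l1 g w) _.
  by rewrite -mulrA ler_wpM2l ?exprn_ge0 ?l1_le_pushout.
- move=> y; rewrite (nrmE S y) -rmorphM le_ofR; apply: le_trans (pushout_le_l1 _) _.
  rewrite /D [leRHS]mulrDl mul1r; apply: ler_wpDl; first exact: nrm_ge0.
  rewrite -[leRHS]mulrA ler_wpM2l// /l1_norm mulr_sumr mulr_suml; apply: ler_sum => w _.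
  rewrite -mulrA ler_wpM2l ?(ltW two0)//; apply: le_trans (Cf _ y) _.
  by rewrite ler_wpM2r ?nrm_ge0// ler_norm.
- move=> g; apply/funext => w /=; rewrite linear_form (bigD1 w)//= he eqxx mulr1.
  rewrite big1 ?addr0// => v /negbTE vw.
  by rewrite he (inj_eq enum_rank_inj) eq_sym vw mulr0.
Qed.

(** The span [M] of the x_i embeds isometrically into both E and the pushout [F], so injectivity
    carries the value of [ipeps] from E to [F]. There [peps] bounds it, and the tensor comes from
    ell_1 of the cube. *)
Lemma injective_hull_le n (peps ipeps : tensor_norm K n) (P : seq (K * ('I_m -> K))) A :
  is_projective_hull (eps_norm K n) peps -> is_injective_hull peps ipeps ->
  (forall g, \sum_i nrm S (g i) ^+ 2 <= 1 -> nrm S (power_sum n P g) <= A) ->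
  ipeps E (comb n x P) <= ofR S (16 ^+ n * A).
Proof.
move=> hpeps [_ iinj ile _] PA.
have fb : biorthogonal S (@nrm R K S E) x f.
  by split=> // i; exists 1 => y; rewrite mul1r.
have [M [I [_ Iiso IE Isurj]]] := biorthogonal_banach fb.
pose F := banach_space pushout_complete.
have I2l : linear (fun v : M => L (fun i => f i (I v)) : F).
  move=> a u v; have -> : (fun i => f i (I (a *: u + v))) =
      a *: ((fun i => f i (I u)) : 'I_m -> K^o) + (fun i => f i (I v)).
    by apply/funext => i; rewrite linearP linearP.
  exact: linearP L a _ _.
pose I2 : {linear M -> F} := mklin I2l.
have I2iso : isometric_embedding (@Num.norm K M) (@Num.norm K F) I2.
  move=> v; rewrite -(Iiso v) banachE [I2 v]/(L _) pushout_isometry -nrmE.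
  by rewrite [in RHS](IE v).
have yP j : exists v, I v = x j.
  have [v vE] := Isurj (fun i => (i == j)%:R); exists v; rewrite vE.
  rewrite (bigD1 j)//= eqxx scale1r big1 ?addr0// => i /negbTE ->.
  by rewrite scale0r.
have [y yE] := choice yP.
have -> : comb n x P = tmap I (comb n y P).
  by rewrite tmap_comb; congr comb; apply/funext => j; rewrite -yE.
rewrite iinj// -(iinj _ _ I2 I2iso) tmap_comb; apply: le_trans (ile _ _) _.
apply: (projective_hull_le hpeps).
pose del (w : cube) : F := (fun v => (v == w)%:R) : cubeK.
(* Point masses have norm at most 16 / 2^m in [F], so [k] scales them into the unit ball. Evaluation
   at [g] then yields 16 times the Fourier coefficients of [g], which lie in the Hilbert ball by
   [bessel]. *)
pose k : R := 2 ^+ m / 16.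
have k0 : 0 < k by rewrite divr_gt0// exprn_gt0.
exists cube, (fun w => ofR S k *: del w),
  [seq (p.1, fun w : cube => ofR S k^-1 * \sum_i p.2 i * (-1) ^+ w i) | p <- P].
split=> [w||g g1].
- rewrite nrmZ nrm_ofR_ge0 ?(ltW k0)//.
  have -> : nrm S (del w) = pushout_norm (del w) by rewrite /nrm banachE re_ofR.
  have h : pushout_norm (del w) <= k^-1.
    apply: le_trans (pushout_le_l1 _) _; rewrite /l1_norm (bigD1 w)//= /del.
    rewrite eqxx nrm1 big1 ?addr0 => [|v /negbTE ->]; last exact: nrm0.
    by rewrite mulr1 /k invf_div.
  apply: le_trans (ler_wpM2l (ltW k0) h) _.
  by rewrite mulfV// gt_eqF.
- rewrite /comb -map_comp; congr tsum; apply: eq_map => p /=; congr (_, _).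
  have I2y j : I2 (y j) = rademacher j.
    have -> : I2 (y j) = L (fun i => f i (I (y j))) by [].
    rewrite yE /L /= (bigD1 j)//= fx eqxx scale1r.
    by rewrite big1 ?addr0// => i /negbTE ij; rewrite fx ij scale0r.
  have e1 : \sum_j p.2 j *: (I2 \o y) j = L p.2 :> F.
    by apply: eq_bigr => j _; congr (_ *: _); exact: I2y.
  rewrite e1.
  have e2 : \sum_(w : cube) (ofR S k^-1 * \sum_i p.2 i * (-1) ^+ w i) *:
      (ofR S k *: ((fun v => (v == w)%:R) : cubeK)) = L p.2.
    apply/funext => w; rewrite /L /= !fct_sumE (bigD1 w)//= [X in _ + X]big1 ?addr0.
      rewrite -[LHS]/(_ * (_ * (w == w)%:R)) eqxx mulr1 mulrAC -rmorphM.
      by rewrite mulVf ?gt_eqF// rmorph1 mul1r.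
    move=> v /negbTE vw; rewrite -[LHS]/(_ * (_ * (w == v)%:R)) eq_sym vw.
    by rewrite !mulr0.
  exact: esym e2.
- have -> : power_sum n [seq (p.1, fun w : cube =>
        ofR S k^-1 * \sum_i p.2 i * (-1) ^+ w i) | p <- P] g =
      16 ^+ n * power_sum n P (fourier g).
    rewrite /power_sum big_map mulr_sumr; apply: eq_bigr => p _ /=.
    rewrite mulrCA -exprMn; congr (_ * _ ^+ _); rewrite mulr_sumr.
    transitivity (\sum_i \sum_(w : cube) 16 * (p.2 i * ((2 ^+ m)^-1 * ((-1) ^+ w i * g w)))).
      rewrite exchange_big; apply: eq_bigr => w _ /=.
      rewrite /k invf_div rmorphM rmorph_nat fmorphV rmorphXn rmorph_nat.
      rewrite mulr_sumr mulr_suml; apply: eq_bigr => i _; ring.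
    by apply: eq_bigr => i _; rewrite /fourier !mulr_sumr.
  rewrite nrmM nrmX -(rmorph_nat (ofR S)) nrm_ofR_ge0 ?ler0n// ler_wpM2l ?exprn_ge0//.
  exact: PA (bessel g1).
Qed.

End pushout.

(** * Projective norms: a pullback *)

Section product_complete.
Variables (K : numFieldType) (V W : completeNormedModType K).

Fact product_complete (F : set_system ((V * W)%type : normedModType K)) :
  ProperFilter F -> cauchy F -> cvg F.
Proof.
move=> FF /cauchy_ballP Fc.
have c1 : cauchy (fst @ F).
  apply/cauchy_ballP => e e0; have [[A B] /= [FA FB] AB] := Fc e e0.
  exists (fst @` A, fst @` B); first by split => /=;
    [apply: filterS FA => z Az; exists z|apply: filterS FB => z Bz; exists z].
  by move=> [_ _] /= [[u Au <-] [v Bv <-]]; have [] := AB (u, v) (conj Au Bv).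
have c2 : cauchy (snd @ F).
  apply/cauchy_ballP => e e0; have [[A B] /= [FA FB] AB] := Fc e e0.
  exists (snd @` A, snd @` B); first by split => /=;
    [apply: filterS FA => z Az; exists z|apply: filterS FB => z Bz; exists z].
  by move=> [_ _] /= [[u Au <-] [v Bv <-]]; have [] := AB (u, v) (conj Au Bv).
have /cauchy_cvg/cvg_ex[/= y1 h1] := c1.
have /cauchy_cvg/cvg_ex[/= y2 h2] := c2.
suff h : F --> ((y1, y2) : (V * W)%type : normedModType K) by exact: cvgP h.
apply/fcvg_ballP => e e0.
have {}h1 := cvg_ball h1 e0; have {}h2 := cvg_ball h2 e0.
by near=> z; split; near: z; [exact: h1|exact: h2].
Unshelve. all: by end_near. Qed.

HB.instance Definition _ := Uniform_isComplete.Build (V * W)%type product_complete.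

End product_complete.

Section max_seminorm.
Variables (R : realType) (K : numFieldType) (S : scalars R K) (V : lmodType K).
Variables (T : finType) (q : T -> V -> R).
Hypothesis qs : forall t, seminorm S (q t).

Definition max_seminorm (v : V) : R := \big[Num.max/0]_t q t v.

Lemma max_seminorm_le v M : 0 <= M -> (forall t, q t v <= M) -> max_seminorm v <= M.
Proof. by move=> M0 h; apply: bigmax_le => // t _. Qed.

Lemma le_max_seminorm v t : q t v <= max_seminorm v.
Proof. exact: (le_bigmax _ (fun t => q t v)). Qed.

Lemma max_seminorm_ge0 v : 0 <= max_seminorm v.
Proof.
rewrite /max_seminorm; elim/big_ind : _ => [//|x y x0 _|t _].
  by rewrite le_max x0.
exact: (seminorm_ge0 v (qs t)).
Qed.

Lemma max_seminorm_seminorm : seminorm S max_seminorm.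
Proof.
split=> [u v|].
  apply: max_seminorm_le => [|t]; first by rewrite addr_ge0 ?max_seminorm_ge0.
  exact: le_trans ((qs t).1 u v) (lerD (le_max_seminorm u t) (le_max_seminorm v t)).
apply: homogeneous_of_le => [|b w]; first exact: max_seminorm_ge0.
apply: max_seminorm_le => [|t]; first by rewrite mulr_ge0 ?nrm_ge0 ?max_seminorm_ge0.
by rewrite (qs t).2 ler_wpM2l ?nrm_ge0 ?le_max_seminorm.
Qed.

End max_seminorm.

Section pullback.
Variables (R : realType) (K : numFieldType) (S : scalars R K).
Variables (E : completeNormedModType K) (m : nat).
Variables (f : 'I_m -> {linear E -> K^o}).
Hypothesis Einf : ~ finite_dimensional E.
Hypothesis fl2 : forall y, \sum_i nrm S (f i y : K) ^+ 2 <= 4 * nrm S y ^+ 2.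

Local Notation cube := {ffun 'I_m -> bool}.
Local Notation cubeK := (cube -> K^o).
Local Notation V := (E * cubeK)%type.

Lemma fourier_linear : linear (fun h : cubeK => (fun i => fourier h i) : 'I_m -> K^o).
Proof.
move=> a g h; apply/funext => i; rewrite /fourier.
transitivity (a * ((2 ^+ m)^-1 * \sum_(w : cube) (-1) ^+ w i * g w) +
  (2 ^+ m)^-1 * \sum_(w : cube) (-1) ^+ w i * h w); last by [].
rewrite mulrCA -mulrDr; congr (_ * _); rewrite mulr_sumr -big_split.
apply: eq_bigr => w _; rewrite -[(a *: g + h) w]/(a * g w + h w) mulrDr; congr (_ + _).
exact: mulrCA.
Qed.

Lemma fourier_sum (c : 'I_m -> K) i :
  fourier (\sum_j c j *: (rademacher K j : cubeK)) i = c i.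
Proof.
rewrite /fourier.
transitivity ((2 ^+ m)^-1 * \sum_j c j * \sum_(w : cube) ((-1) ^+ w i * (-1) ^+ w j) : K).
  congr (_ * _); under [RHS]eq_bigr do rewrite mulr_sumr.
  rewrite exchange_big; apply: eq_bigr => w _ /=; rewrite fct_sumE mulr_sumr.
  apply: eq_bigr => j _; exact: mulrCA.
rewrite (bigD1 i)//= sum_signs eqxx mul1r big1 ?addr0 => [|j /negbTE ji].
  by rewrite mulrC mulfK// expf_neq0// pnatr_eq0.
by rewrite sum_signs eq_sym ji mul0r mulr0.
Qed.

(** The pullback consists of the pairs (y, g) with [fourier g i = f i y]. Replacing the Rademacher
    coefficients of [v.2] by the prescribed ones parametrises it by the whole product. *)
Definition residual (v : V) : cubeK :=
  v.2 + \sum_i (f i v.1 - fourier v.2 i) *: (rademacher K i : cubeK).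

Lemma residual_linear : linear residual.
Proof.
move=> a u v; rewrite /residual scalerDr addrACA; congr (_ + _).
rewrite scaler_sumr -big_split; apply: eq_bigr => i _ /=.
rewrite scalerA -scalerDl; congr (_ *: _).
have /(congr1 (fun g => g i)) /= -> := fourier_linear a u.2 v.2.
rewrite linearP -[(_ + _) i]/(a * fourier u.2 i + fourier v.2 i).
rewrite -[(a *: _ : K^o)]/(a * f i u.1) mulrBr; ring.
Qed.

Lemma fourier_residual v i : fourier (residual v) i = f i v.1.
Proof.
have /(congr1 (fun g => g i)) /= := fourier_linear 1 v.2
  (\sum_i (f i v.1 - fourier v.2 i) *: (rademacher K i : cubeK)).
rewrite scale1r => ->.
rewrite -[(_ + _) i]/(1 * fourier v.2 i + fourier (\sum_j _) i) fourier_sum mul1r.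
by rewrite addrC subrK.
Qed.

(** The coefficients [fourier v.2 i] are lost in [residual]; as separate coordinates they make the
    maximum definite. *)
Definition pullback_coord (t : option (cube + 'I_m)) (v : V) : R :=
  match t with
  | None => nrm S v.1
  | Some (inl w) => nrm S (residual v w : K) / 16
  | Some (inr i) => nrm S (fourier v.2 i)
  end.

Lemma pullback_coord_seminorm t : seminorm S (pullback_coord t).
Proof.
have RD u v : residual (u + v) = residual u + residual v.
  exact: (linearD (mklin residual_linear) u v).
have RZ a v : residual (a *: v) = a *: residual v.
  exact: (linearZ_LR (mklin residual_linear) a v).
have FD (g h : cubeK) i : fourier (g + h) i = fourier g i + fourier h i.
  exact: (congr1 (fun c => c i) (linearD (mklin fourier_linear) g h)).
have FZ a (g : cubeK) i : fourier (a *: g) i = a * fourier g i.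
  exact: (congr1 (fun c => c i) (linearZ_LR (mklin fourier_linear) a g)).
case: t => [[w|i]|]; split=> [u v|a v] /=.
- by rewrite -mulrDl ler_wpM2r// RD; exact: nrmD.
- by rewrite RZ -[(a *: _) w]/(a * residual v w) nrmM mulrA.
- by rewrite FD; exact: nrmD.
- by rewrite FZ nrmM.
- exact: nrmD.
- exact: nrmZ.
Qed.

Definition pullback_norm : V -> R := max_seminorm pullback_coord.

Let ps : seminorm S pullback_norm.
Proof. exact: max_seminorm_seminorm pullback_coord_seminorm. Qed.

Let ple v t : pullback_coord t v <= pullback_norm v.
Proof. exact: le_max_seminorm. Qed.

Let p0 v : 0 <= pullback_norm v. Proof. exact: (seminorm_ge0 v ps). Qed.

Lemma functional_le y i : nrm S (f i y : K) <= 2 * nrm S y.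
Proof.
rewrite -(ler_pXn2r (n := 2))// ?nnegrE ?mulr_ge0 ?nrm_ge0// exprMn.
have -> : 2 ^+ 2 = 4 :> R by ring.
apply: le_trans (fl2 y); rewrite (bigD1 i)//= lerDl sumr_ge0// => j _.
exact: sqr_ge0.
Qed.

(** The 3 adds 2 for [f i v.1] and 1 for [fourier v.2 i]. The dependence on m is harmless: only
    definiteness and completeness use the bound. *)
Lemma pullback_snd_le v w : nrm S (v.2 w : K) <= (16 + 3 * m%:R) * pullback_norm v.
Proof.
have -> : v.2 w = residual v w - \sum_i (f i v.1 - fourier v.2 i) * (-1) ^+ w i.
  by rewrite /residual -[(_ + _) w]/(v.2 w + _) fct_sumE addrK.
apply: le_trans (nrmD _ _ _) _; rewrite nrmN mulrDl; apply: lerD.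
  by have := ple v (Some (inl w)); rewrite /= ler_pdivrMr// mulrC.
apply: le_trans (nrm_sum _ _ _ _) _.
have -> : 3 * m%:R * pullback_norm v = \sum_(i < m) 3 * pullback_norm v.
  by rewrite sumr_const card_ord -[RHS]mulr_natl; ring.
apply: ler_sum => i _; rewrite nrmM nrm_sign mulr1.
apply: le_trans (nrmD _ _ _) _; rewrite nrmN.
have := functional_le v.1 i; have := ple v None; have := ple v (Some (inr i)) => /=.
by lra.
Qed.

Lemma pullback_is_norm : is_norm (fun v => ofR S (pullback_norm v)).
Proof.
split=> [v|v /eqP|a v|u v].
- by rewrite ofR_ge0 p0.
- rewrite fmorph_eq0 => /eqP v0; case: v v0 => y h v0; congr (_, _).
    apply: (nrm0_eq0 (S := S)); apply/eqP; rewrite eq_le nrm_ge0 andbT -v0.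
    exact: (ple (y, h) None).
  apply/funext => w; apply: (nrm0_eq0 (S := S)); apply/eqP.
  rewrite eq_le nrm_ge0 andbT; have := pullback_snd_le (y, h) w.
  by rewrite v0 mulr0.
- by rewrite ps.2 rmorphM -nrmE.
- by rewrite -rmorphD le_ofR; exact: ps.1.
Qed.

Lemma nrm_pair (F : normedModType K) (y : E) (z : F) :
  nrm S (y, z) = Num.max (nrm S y) (nrm S z).
Proof.
apply: (ofR_inj (S := S)); rewrite -nrmE prod_normE /= (nrmE S y) (nrmE S z) /Num.max.
by rewrite lt_ofR [in RHS]/Num.max; case: ifP.
Qed.

Lemma pullback_complete : renormed_complete pullback_is_norm.
Proof.
(* The complete model is E * E, whose second factor contains a copy of [cubeK]. *)
have [e [h [he hb]]] := biorthogonal_infinite (nrm_seminorm S E)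
  (@nrm0_eq0 _ _ S E) #|{: cube}| Einf.
pose J2 := mklin (lincomb_linear (fun w : cube => e (enum_rank w))).
pose r2 := mklin (functionals_linear (fun w : cube => h (enum_rank w))).
have Jl : linear (fun v : V => (v.1, J2 v.2)).
  by move=> a u v; rewrite [(a *: u + v).2]/(a *: u.2 + v.2) (linearP J2).
have rl : linear (fun y : E * E => (y.1, r2 y.2) : V).
  by move=> a u v; rewrite [(a *: u + v).2]/(a *: u.2 + v.2) (linearP r2).
have [C Cf] := choice hb.
pose B := 1 + \sum_(w : cube) (16 + 3 * m%:R) * nrm S (e (enum_rank w)).
pose H := \sum_(w : cube) `|C (enum_rank w)|.
pose D := 1 + H + m%:R * (2 + H).
have H0 : 0 <= H by apply: sumr_ge0.
have m0 : 0 <= m%:R :> R by exact: ler0n.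
have mH : 0 <= m%:R * (2 + H) by rewrite mulr_ge0// addr_ge0.
have B0 : 0 <= \sum_(w : cube) (16 + 3 * m%:R) * nrm S (e (enum_rank w)).
  by apply: sumr_ge0 => w _; rewrite mulr_ge0 ?nrm_ge0// addr_ge0// mulr_ge0.
apply: (@renormed_completeP _ _ _ _ (E * E)%type (mklin Jl) (mklin rl) (ofR S B) (ofR S D)).
- by rewrite ofR_ge0 /B; lra.
- by rewrite ofR_gt0 /D; lra.
- move=> v; rewrite -rmorphM nrm_le_ofR nrm_pair ge_max; apply/andP; split.
    apply: le_trans (ple v None) _; rewrite ler_peMl ?p0// /B; lra.
  apply: le_trans (nrm_sum _ _ _ _) _; rewrite /B mulrDl mul1r.
  apply: ler_wpDl; first exact: p0.
  rewrite mulr_suml; apply: ler_sum => w _.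
  by rewrite nrmZ mulrAC ler_wpM2r ?nrm_ge0// pullback_snd_le.
- move=> y; rewrite (nrmE S y) -rmorphM le_ofR.
  have [y1 y2] : nrm S y.1 <= nrm S y /\ nrm S y.2 <= nrm S y.
    by case: y => a b; rewrite nrm_pair !le_max !lexx orbT.
  have y0 := nrm_ge0 S y.
  have hw w : nrm S (h (enum_rank w) y.2 : K) <= `|C (enum_rank w)| * nrm S y.
    apply: le_trans (Cf _ _) _; apply: (@le_trans _ _ (`|C (enum_rank w)| * nrm S y.2)).
      by rewrite ler_wpM2r ?nrm_ge0// ler_norm.
    by rewrite ler_wpM2l.
  have hH w : nrm S (h (enum_rank w) y.2 : K) <= H * nrm S y.
    apply: le_trans (hw w) _; rewrite ler_wpM2r// /H (bigD1 w)//= lerDl.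
    exact: sumr_ge0.
  have fH i : nrm S (fourier (r2 y.2) i) <= H * nrm S y.
    rewrite /fourier nrmM nrmV nrmX -(rmorph_nat (ofR S)) nrm_ofR_ge0 ?ler0n//.
    rewrite mulrC ler_pdivrMr ?exprn_gt0//.
    apply: le_trans (nrm_sum _ _ _ _) _.
    apply: (@le_trans _ _ (H * nrm S y)).
      rewrite /H mulr_suml; apply: ler_sum => w _.
      by rewrite nrmM nrm_sign mul1r hw.
    by rewrite ler_peMr ?mulr_ge0// exprn_ege1// ler1n.
  apply: max_seminorm_le => [|[[w|i]|]] /=.
  + by rewrite mulr_ge0// /D; lra.
  + apply: (@le_trans _ _ (nrm S (residual (y.1, r2 y.2) w : K))).
      by rewrite ler_pdivrMr// ler_peMr ?nrm_ge0// ler1n.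
    rewrite /residual -[(_ + _) w]/(r2 y.2 w + _); apply: le_trans (nrmD _ _ _) _.
    rewrite fct_sumE.
    have s1 : nrm S (\sum_i (f i y.1 - fourier (r2 y.2) i) * (-1) ^+ w i) <=
        m%:R * (2 + H) * nrm S y.
      apply: le_trans (nrm_sum _ _ _ _) _.
      have -> : m%:R * (2 + H) * nrm S y = \sum_(i < m) (2 + H) * nrm S y.
        by rewrite sumr_const card_ord -[RHS]mulr_natl mulrA.
      apply: ler_sum => i _; rewrite nrmM nrm_sign mulr1.
      apply: le_trans (nrmD _ _ _) _; rewrite nrmN mulrDl; apply: lerD => //.
      by apply: le_trans (functional_le _ _) _; rewrite ler_wpM2l.
    apply: le_trans (lerD (hH w) s1) _; rewrite -mulrDl ler_wpM2r// /D; lra.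
  + by apply: le_trans (fH i) _; rewrite ler_wpM2r// /D; lra.
  + by apply: le_trans y1 _; rewrite ler_peMl// /D; lra.
- move=> v /=; rewrite [RHS]surjective_pairing; congr (_, _).
  apply/funext => w /=; rewrite linear_form (bigD1 w)//= he eqxx mulr1.
  rewrite big1 ?addr0// => u /negbTE uw.
  by rewrite he (inj_eq enum_rank_inj) eq_sym uw mulr0.
Qed.

(** By [fl2], f y / (2 |y|) lies in the Hilbert ball, so a Riesz product times 2 |y|, bounded by 16
    |y|, has the coefficients [f i y]. *)
Lemma pullback_lift (y : E) : exists h : cubeK, pullback_norm (y, h) <= nrm S y.
Proof.
have y0 := nrm_ge0 S y.
have [g [g16 gE]] : exists g : cube -> K,
    (forall w, nrm S (g w) <= 16 * nrm S y) /\ forall i, fourier g i = f i y.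
  have [yn|yn] := eqVneq (nrm S y) 0.
    exists (fun=> 0); split=> [w|i]; first by rewrite nrm0 yn mulr0.
    rewrite (nrm0_eq0 yn) linear0 /fourier big1 ?mulr0// => w _.
    by rewrite mulr0.
  have yp : 0 < nrm S y by rewrite lt_def yn.
  have k0 : 0 < 2 * nrm S y by rewrite mulr_gt0.
  have [|g [g8 gE]] := @riesz_product m R K S (fun i => ofR S (2 * nrm S y)^-1 * f i y).
    under eq_bigr do rewrite nrmM exprMn nrm_ofR_ge0 ?invr_ge0 ?(ltW k0)//.
    rewrite -mulr_sumr; apply: le_trans (ler_wpM2l _ (fl2 y)) _; first exact: sqr_ge0.
    have -> : 4 * nrm S y ^+ 2 = (2 * nrm S y) ^+ 2 by ring.
    by rewrite -exprMn mulVf ?expr1n ?gt_eqF.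
  exists (fun w => ofR S (2 * nrm S y) * g w); split=> [w|i].
    rewrite nrmM nrm_ofR_ge0 ?(ltW k0)//.
    have := ler_wpM2l (ltW k0) (g8 w); lra.
  rewrite /fourier; under eq_bigr do rewrite mulrCA.
  rewrite -mulr_sumr mulrCA gE mulrA -rmorphM mulfV ?gt_eqF// rmorph1.
  exact: mul1r.
(* Without its Rademacher part [h] has vanishing coefficients, and [residual (y, h)] is [g]. *)
pose h : cubeK := g - \sum_i f i y *: (rademacher K i : cubeK).
have hF i : fourier h i = 0.
  have /(congr1 (fun c => c i)) /= := linearB (mklin fourier_linear) (g : cubeK)
    (\sum_i f i y *: (rademacher K i : cubeK)).
  rewrite -/h => ->; rewrite -[(_ - _) i]/(fourier g i - fourier (\sum_j _) i).
  by rewrite gE fourier_sum subrr.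
exists h; apply: max_seminorm_le => // -[[w|i]|] //=.
- rewrite ler_pdivrMr// mulrC.
  have -> : residual (y, h) = g; last exact: g16.
  rewrite /residual /=; under eq_bigr do rewrite hF subr0.
  by rewrite subrK.
- by rewrite hF nrm0.
Qed.

(** [q] is a metric surjection, so [pipi] on E is the infimum over lifts to [G], where [pipi] is at
    least [ipi]. On [G] the functionals [f] factor through ell_infty of the cube, and
    [injective_hull_ge] applies. *)
Lemma projective_hull_ge n (ipi pipi : tensor_norm K n) (Q : mlform n ('I_m -> K^o))
    (z : symtensor n E) :
  is_injective_hull (pi_norm K n) ipi -> is_projective_hull ipi pipi ->
  (forall g, \sum_i nrm S (g i : K) ^+ 2 <= 1 -> nrm S (Q (fun=> g)) <= 1) ->
  nrm S (symval z (mlpull (mklin (functionals_linear f)) Q)) <=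
  16 ^+ n * re S (pipi E z).
Proof.
move=> hipi [[pn _ _ _ _] pproj ple' _] Q1.
pose G := banach_space pullback_complete.
have ql : linear (fun v : G => (v : V).1 : E) by [].
pose q : {linear G -> E} := mklin ql.
have GE (v : G) : nrm S v = pullback_norm v by rewrite /nrm banachE re_ofR.
have qs : metric_surjection (@Num.norm K G) (@Num.norm K E) q.
  split=> [y|y]; first by exists ((y, 0) : V).
  split=> [_ [v /= <- <-]|l ll].
    by rewrite !(nrmE S) le_ofR GE; exact: (ple v None).
  have [h hy] := pullback_lift y.
  apply: (@le_trans _ _ `|((y, h) : V) : G|).
    by apply: ll; exists ((y, h) : V).
  by rewrite !(nrmE S) le_ofR GE.
pose FL : {linear cubeK -> ('I_m -> K^o)} := mklin fourier_linear.
(* The factor 16 makes up for [Psi], which is [residual] divided by 16 to be contractive. *)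
have Ll : linear (fun s : cubeK => (16 : K) *: FL s).
  by move=> a u v; rewrite (linearP FL) scalerDr !scalerA (mulrC 16).
pose Lf : {linear cubeK -> ('I_m -> K^o)} := mklin Ll.
have k16 : nrm S (16 : K) = 16 by rewrite -(rmorph_nat (ofR S)) nrm_ofR_ge0 ?ler0n.
have Q'B (s : cubeK) : (forall w, nrm S (s w : K) <= 1) ->
    nrm S (mlpull Lf Q (fun=> s)) <= 16 ^+ n.
  move=> s1; have -> : mlpull Lf Q (fun=> s) = Q (fun=> (16 : K) *: FL s) by [].
  rewrite mlform_scale nrmM nrmX k16 ler_piMr ?exprn_ge0//.
  by apply: Q1; exact: bessel.
have Pl : linear (fun v : G => (16 : K)^-1 *: residual v : cubeK).
  move=> a u v; rewrite [residual _](residual_linear a u v) scalerDr !scalerA.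
  by rewrite (mulrC 16^-1).
pose Psi : {linear G -> cubeK} := mklin Pl.
have Pc : contractive S Psi.
  move=> v w; rewrite [Psi v w]/(16^-1 * residual v w) nrmM nrmV k16 mulrC GE.
  exact: (ple v (Some (inl w))).
have key (w : symtensor n G) : tmap q w = z ->
    nrm S (symval z (mlpull (mklin (functionals_linear f)) Q)) <= 16 ^+ n * re S (pipi G w).
  move=> wz.
  have -> : symval z (mlpull (mklin (functionals_linear f)) Q) =
      symval w (mlpull Psi (mlpull Lf Q)).
    rewrite -wz mlpull_comp; congr (symval w _); apply: mlform_ext => X /=.
    congr (Q _); apply/funext => l; apply/funext => i /=.
    rewrite -fourier_residual.
    have := congr1 (fun c => c i) (linearZ_LR FL (16 : K)^-1 (residual (X l))).
    rewrite /= => FE.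
    rewrite -[RHS]/(16 * fourier ((16 : K)^-1 *: residual (X l)) i) FE.
    by rewrite -[(_ *: _) i]/(16^-1 * fourier (residual (X l)) i) mulVKf// pnatr_eq0.
  apply: le_trans (injective_hull_ge w hipi _ Q'B Pc) _; first by rewrite exprn_gt0.
  rewrite ler_wpM2l ?exprn_ge0// -(le_ofR S) -!ge0_ofR; first exact: ple'.
    by case: (pn G).
  by have [[inn _ _ _ _] _ _ _] := hipi; case: (inn G).
have [_ pinf] := pproj _ _ _ qs; have [_ ub] := pinf z.
have k0 : 0 < 16 ^+ n :> R by rewrite exprn_gt0.
rewrite mulrC -ler_pdivrMr// -(le_ofR S) -(ge0_ofR S); last by case: (pn E).
apply: ub => _ [w /= wz <-]; rewrite (ge0_ofR S (x := pipi G w)); last by case: (pn G).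
by rewrite le_ofR ler_pdivrMr// mulrC; exact: key.
Qed.

End pullback.

(** * Main theorem *)

Lemma comb_pairing (K : numFieldType) n (E : lmodType K) m (x : 'I_m -> E)
    (f : 'I_m -> {linear E -> K^o}) (P : seq (K * ('I_m -> K)))
    (Q : mlform n ('I_m -> K^o)) : (forall i j, f i (x j) = (i == j)%:R) ->
  symval (comb n x P) (mlpull (mklin (functionals_linear f)) Q) =
  \sum_(p <- P) p.1 * Q (fun=> p.2).
Proof.
move=> fx; rewrite symval_tsum big_map; apply: eq_bigr => p _ /=.
congr (_ * Q _); apply/funext => l; apply/funext => i /=.
rewrite linear_form (bigD1 i)//= fx eqxx mulr1 big1 ?addr0// => j /negbTE ji.
by rewrite fx eq_sym ji mulr0.
Qed.

Section infinite_dimension.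
Variables (R : realType) (K : numFieldType) (S : scalars R K) (n : nat).
Hypothesis hn : (3 <= n)%N.
Variable E : completeNormedModType K.
Hypothesis Einf : ~ finite_dimensional E.

Lemma not_equivalent_projective (peps ipi pipi : tensor_norm K n) :
  is_projective_hull (eps_norm K n) peps -> is_injective_hull (pi_norm K n) ipi ->
  is_projective_hull ipi pipi -> ~ equivalent_on E peps pipi.
Proof.
move=> hpeps hipi hpipi [c [C [_ C0 le]]].
have CE := ge0_ofR S (ltW C0).
(* [A] depends only on n and C, and q exceeds it. Equivalence would give 4 q * (q d) <= A * (q
   d). *)
pose A : R := 16 ^+ n * (re S C * (2 ^+ n.+1) ^+ 3).
pose q := (Num.truncn A).+1.
have Aq : A < q%:R by exact: truncnS_gt.
have [m [P [Q [d [d0 [_ Psup Qhil _ PQ]]]]]] := test_tensor S q hn.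
have [x [f [x1 fx fl2]]] := hilbert_valued_system S Einf m.
have up : peps E (comb n x P) <= ofR S ((2 ^+ n.+1) ^+ 3 * (q * d)%:R).
  by apply: (projective_hull_le hpeps); exists 'I_m, x, P.
have low := projective_hull_ge Einf fl2 (comb n x P) hipi hpipi Qhil.
have := (le (comb n x P)).2; rewrite comb_pairing// PQ in low.
rewrite -(rmorph_nat (ofR S)) nrm_ofR_ge0 ?ler0n// in low.
have pE : pipi E (comb n x P) = ofR S (re S (pipi E (comb n x P))).
  by apply: ge0_ofR; have [[pn _ _ _ _] _ _ _] := hpipi; case: (pn E).
rewrite pE CE => /le_trans/(_ (ler_wpM2l _ up)).
rewrite ofR_ge0 re_ge0 ?(ltW C0)// => /(_ isT); rewrite -rmorphM le_ofR => h.
have d1 : 0 < d%:R :> R by rewrite ltr0n.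
have q1 : 0 < q%:R :> R by rewrite ltr0n.
have h16 : 0 <= 16 ^+ n :> R by rewrite exprn_ge0.
have := le_trans low (ler_wpM2l h16 h).
have -> : 16 ^+ n * (re S C * ((2 ^+ n.+1) ^+ 3 * (q * d)%:R)) = A * (q%:R * d%:R).
  by rewrite natrM /A; ring.
have -> : (4 * (q * q) * d)%:R = (4 * q%:R) * (q%:R * d%:R) :> R by rewrite !natrM; ring.
rewrite ler_pM2r ?mulr_gt0//; lra.
Qed.

Lemma not_equivalent_injective (peps ipi ipeps : tensor_norm K n) :
  is_projective_hull (eps_norm K n) peps -> is_injective_hull (pi_norm K n) ipi ->
  is_injective_hull peps ipeps -> ~ equivalent_on E ipi ipeps.
Proof.
move=> hpeps hipi hipeps [c [C [c0 _ le]]].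
have cE := ge0_ofR S (ltW c0).
have cp : 0 < re S c by rewrite -(ofR_gt0 S) -cE.
(* Here equivalence would give c * 4 q <= A, while q > A / c. *)
pose A : R := 16 ^+ n * (2 ^+ n.+1) ^+ 3.
pose q := (Num.truncn (A / re S c)).+1.
have Aq : A / re S c < q%:R by exact: truncnS_gt.
have [m [P [Q [d [d0 [Phil _ _ Qsup PQ]]]]]] := test_tensor S q hn.
have [x [f [f1 fx xl2]]] := hilbert_bounded_system S Einf m.
have up := injective_hull_le Einf f1 fx xl2 hpeps hipeps Phil.
have qd0 : 0 < (q * d)%:R :> R by rewrite ltr0n muln_gt0.
have Pc : contractive S (mklin (functionals_linear f)) by move=> y j; exact: f1.
have low := injective_hull_ge (comb n x P) hipi qd0 Qsup Pc.
have := (le (comb n x P)).1; rewrite comb_pairing// PQ in low.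
rewrite -(rmorph_nat (ofR S)) nrm_ofR_ge0 ?ler0n// in low.
have iE : ipi E (comb n x P) = ofR S (re S (ipi E (comb n x P))).
  by apply: ge0_ofR; have [[pn _ _ _ _] _ _ _] := hipi; case: (pn E).
rewrite iE cE -rmorphM => /le_trans/(_ up); rewrite le_ofR -/A => h.
move: low; have -> : (4 * (q * q) * d)%:R = (q * d)%:R * (4 * q%:R) :> R.
  by rewrite !natrM; ring.
rewrite ler_pM2l// => low.
have := le_trans (ler_wpM2l (ltW cp) low) h.
move: Aq; rewrite ltr_pdivrMr// => Aq.
have : 0 < q%:R * re S c by rewrite mulr_gt0// ltr0n.
lra.
Qed.

End infinite_dimension.

(* The real and the complex case are both covered by hK.  The names record the
   hulls: peps = \eps/, ipi = /pi\, pipi = \/pi\/, ipeps = /\eps/\. *)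
Theorem theorem3p8 (R : realType) (K : numFieldType)
    (hK : K = R :> numFieldType \/ K = R[i] :> numFieldType)
    (n : nat) (hn : (3 <= n)%N)
    (peps ipi pipi ipeps : tensor_norm K n)
    (hpeps : is_projective_hull (eps_norm K n) peps)
    (hipi : is_injective_hull (pi_norm K n) ipi)
    (hpipi : is_projective_hull ipi pipi)
    (hipeps : is_injective_hull peps ipeps)
    (E : completeNormedModType K) :
  (equivalent_on E peps pipi <-> finite_dimensional E) /\
  (equivalent_on E ipi ipeps <-> finite_dimensional E).
Proof.
have S := scalars_of hK.
have [speps _ _ _] := hpeps; have [sipi _ _ _] := hipi.
have [spipi _ _ _] := hpipi; have [sipeps _ _ _] := hipeps.
split; split=> [eqv|Efd]; try exact: (equivalent_on_finite S).
  apply: contrapT => Einf.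
  exact: (not_equivalent_projective S hn Einf hpeps hipi hpipi eqv).
apply: contrapT => Einf.
exact: (not_equivalent_injective S hn Einf hpeps hipi hipeps eqv).
Qed.
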